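(* Let $p<20000$ be a prime. Define the following sets of primes: $R=\{2, 3, 5, 7, 11, 13, 17, 19, 23, 29, 31, 37, 41, 43, 61, 67, 71\}$, $U=\{251, 347, 587, 2459, 2819, 3299, 4547, 4787, 6659, 10667, 12227, 14281, 15299, 17027, 17681, 18059, 18481, 18947\}$, $X=\{59, 83, 107, 163, 487, 677, 727, 1187, 1459, 2663, 3779, 4259, 7523, 8837, 10883, 11699, 12659, 12899, 13043, 13183, 13523, 14243, 14387, 14723, 14867, 16547, 17939, 19379\}$. If either (i) $p\notin R\cup U\cup X$, or (ii) the generalized Riemann hypothesis (GRH) holds and $p\notin R\cup U$, then $\mathbb{Q}(C_p)$ is not stably rational over $\mathbb{Q}$.
   Context: For a field $k$ and a finite group $G$, let $G$ act on the rational function field $k(x_g\mid g\in G)$ (in indeterminates indexed by the elements of $G$) by $k$-automorphisms $h(x_g)=x_{hg}$ for all $g,h\in G$, and let $k(G)=k(x_g\mid g\in G)^G$ be the fixed field. $C_p$ denotes the cyclic group of order $p$. A field extension $K/k$ is rational if $K$ is purely transcendental over $k$, and stably rational if $K(t_1,\ldots,t_n)$ is rational over $k$ for some elements $t_1,\ldots,t_n$ algebraically independent over $K$. *)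

(* Defs.v *)
From HB Require Import structures.
From mathcomp Require Import all_boot all_order all_algebra.
From mathcomp Require mpoly.

Set Implicit Arguments.
Unset Strict Implicit.
Unset Printing Implicit Defensive.

Import Order.TTheory GRing.Theory Num.Theory.
Local Open Scope ring_scope.

Module NoetherDefs.
Import mpoly.

(* Part 1: Noether's problem for C_p over Q, stated inside an ambient  *)
(* field M of characteristic 0 (so Q embeds via ratr).                 *)

Definition ratQ (M : fieldType) (z : M) : Prop := exists q : rat, z = ratr q.

Definition poly_over (M : fieldType) (n : nat) (S : M -> Prop)
  (P : mpoly.mpoly n M) : Prop :=
  forall m : mpoly.multinom n, S (mpoly.mcoeff m P).

Definition alg_indep (M : fieldType) (n : nat) (S : M -> Prop)
  (t : 'I_n -> M) : Prop :=
  forall P : mpoly.mpoly n M, poly_over S P -> mpoly.meval t P = 0 -> P = 0.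

Definition gen_field (M : fieldType) (n : nat) (S : M -> Prop)
  (t : 'I_n -> M) : M -> Prop :=
  fun z => exists A B : mpoly.mpoly n M,
    [/\ poly_over S A, poly_over S B, mpoly.meval t B != 0 &
        z = mpoly.meval t A / mpoly.meval t B].

(* Given x = (x_g)_{g in C_p} (C_p = Z/pZ realised as 'I_p, generator
   acting by g |-> g+1, i.e. ordS), the fixed field Q(x_g | g)^{C_p}:
   the elements f(x) of Q(x) with f(x_{g+1}) = f(x_g).                 *)
Definition cyclic_invariants (M : fieldType) (p : nat) (x : 'I_p -> M)
  : M -> Prop :=
  fun z => exists A B : mpoly.mpoly p M,
    [/\ poly_over (@ratQ M) A, poly_over (@ratQ M) B,
        mpoly.meval x B != 0,
        z = mpoly.meval x A / mpoly.meval x B &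
        z = mpoly.meval (x \o (@ordS p)) A / mpoly.meval (x \o (@ordS p)) B].

(* Q(C_p) is stably rational over Q: some (equivalently every) model
   Q(x_g | g in C_p) with the x_g algebraically independent over Q,
   inside a field M of characteristic 0, has elements t_1..t_n
   algebraically independent over K = Q(C_p) and y_1..y_m algebraically
   independent over Q with K(t_1,..,t_n) = Q(y_1,..,y_m).              *)
Definition stably_rational_QCp (p : nat) : Prop :=
  exists M : fieldType, [pchar M] =i pred0 /\
  exists x : 'I_p -> M, alg_indep (@ratQ M) x /\
  exists (n : nat) (t : 'I_n -> M), alg_indep (cyclic_invariants x) t /\
  exists (m : nat) (y : 'I_m -> M), alg_indep (@ratQ M) y /\
  forall z : M, gen_field (cyclic_invariants x) t z <-> gen_field (@ratQ M) y z.

End NoetherDefs.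
Export NoetherDefs.

From mathcomp Require Import complex.
From mathcomp Require Import all_classical all_reals.
From mathcomp Require Import topology normedtype sequences exp trigo.
From mathcomp Require Import Rstruct Rstruct_topology.

Local Open Scope complex_scope.

Notation CR := (Rdefinitions.R[i]).

(* n^{-s} for n >= 1 and s = a + i b : exp(-a ln n) (cos(b ln n) - i sin(b ln n)) *)
Definition npow_neg (n : nat) (s : CR) : CR :=
  let r := expR (- Re s * ln (n%:R : Rdefinitions.R)) in
  let th := Im s * ln (n%:R : Rdefinitions.R) in
  (r * cos th) +i* (- (r * sin th)).

Definition dirichlet_character (q : nat) (chi : nat -> CR) : Prop :=
  [/\ (0 < q)%N,
      forall m n, chi (m * n)%N = chi m * chi n,
      forall n, chi (n + q)%N = chi n &
      forall n, (chi n != 0) = coprime n q].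

Definition principal_character (q : nat) (chi : nat -> CR) : Prop :=
  forall n, coprime n q -> chi n = 1.

Definition dir_partial (a : nat -> CR) (s : CR) (N : nat) : CR :=
  \sum_(k < N) a k.+1 * npow_neg k.+1 s.

Definition dir_series_zero (a : nat -> CR) (s : CR) : Prop :=
  ((fun N => Re (dir_partial a s N)) @ \oo --> (0 : Rdefinitions.R))%classic /\
  ((fun N => Im (dir_partial a s N)) @ \oo --> (0 : Rdefinitions.R))%classic.

Definition in_critical_strip (s : CR) : Prop := 0 < Re s < 1.

(* GRH for Dirichlet L-functions.  In the open critical strip:
   - zeros of zeta(s) = zeros of eta(s) = sum (-1)^{k-1} k^{-s}
     (convergent for Re s > 0; 1 - 2^{1-s} has no zero there), which
     also covers principal characters (L(s,chi_0) = zeta(s) * finite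
     product of factors without zeros in the open strip);
   - for nonprincipal chi, L(s,chi) = sum chi(k) k^{-s} (convergent for
     Re s > 0).                                                         *)
Definition GRH : Prop :=
  (forall s : CR, in_critical_strip s ->
     dir_series_zero (fun k => (- 1) ^+ k.-1) s -> Re s = 2^-1) /\
  (forall (q : nat) (chi : nat -> CR), dirichlet_character q chi ->
     ~ principal_character q chi ->
     forall s : CR, in_critical_strip s ->
       dir_series_zero chi s -> Re s = 2^-1).

Definition excR : seq nat :=
  [:: 2; 3; 5; 7; 11; 13; 17; 19; 23; 29; 31; 37; 41; 43; 61; 67; 71]%N.

Definition excU : seq nat :=
  [:: 251; 347; 587; 2459; 2819; 3299; 4547; 4787; 6659; 10667; 12227;
      14281; 15299; 17027; 17681; 18059; 18481; 18947]%N.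

Definition excX : seq nat :=
  [:: 59; 83; 107; 163; 487; 677; 727; 1187; 1459; 2663; 3779; 4259; 7523;
      8837; 10883; 11699; 12659; 12899; 13043; 13183; 13523; 14243; 14387;
      14723; 14867; 16547; 17939; 19379]%N.

(* Main.v *)
(* Let n = p - 1, xi a primitive n-th root of unity and g an automorphism of the
   complex numbers with g(zeta_p) = zeta_p^c, c a primitive root modulo p. The
   discrete Fourier transform Z_k of the x_j diagonalises C_p, and the invariants
   become the function field of a torus with coordinates W_k = Z_k Z_1^(p-k), on
   which g permutes the Z_k. If this field is stably rational, the Laurent ring of
   the W_k and a polynomial ring with g-fixed variables have a common
   localisation. Both are factorial, so the unit groups express the character
   lattice of the torus through two permutation lattices, spanned by the primes
   that are inverted on either side. Comparing determinants at xi gives a, D in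
   Z[x] with a(xi) D(xi) = p such that a(xi) generates the prime ideal (p, xi - c) of Z[xi].

   A generator a(xi), of norm p, can be ruled out without class numbers. For a
   prime l not dividing n, a(xi)^l / a(xi^l) is congruent to 1 modulo l, as is its
   complex conjugate; the difference of the cross products is a nonzero multiple
   of l with all conjugates small, which gives l^d <= 2^d p^(l+1) with
   d = totient n. For p < 20000 some l in {5, 7, 11, 13} violates this, except for
   the primes in R and 47, 53, 73, 79. A similar inequality, available when 4
   divides n, excludes 53 and 73. For 47 and 79 the norm of a(xi) to an imaginary
   quadratic subfield of Q(xi) would have an integral trace u with u^2 <= 4p and
   u^2 - 4p a square modulo every prime split in that subfield. *)

Require Import Defs.
From Stdlib Require Import NArith.
From HB Require Import structures.
From mathcomp Require Import all_boot all_order all_fingroup all_algebra all_field.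
From mathcomp Require Import cyclic boolp ring zify.
From mathcomp Require Import mpoly.

Set Implicit Arguments.
Unset Strict Implicit.
Unset Printing Implicit Defensive.

Import Order.TTheory GRing.Theory Num.Theory.
Local Open Scope ring_scope.

(** * Factorial rings *)

(** Scalars are extended to the complex numbers because diagonalising C_p needs zeta_p; the
    arithmetic of the rationals survives only through the semilinear map g. Since g fixes the
    generators of the rational model, that side has a polynomial ring with only constant units,
    while the units of the torus ring modulo constants form the ideal (p, x - c) of Z[x]/(x^n - 1).
    Comparing inverted primes gives an exact sequence 0 -> ideal -> permutation lattice ->
    permutation lattice -> 0. It splits equivariantly by a vanishing of H^1, and the splitting
    supplies the two matrices whose determinants are D and a. The polynomial D is what makes a(xi) a
    generator: modulo p it vanishes at every n-th root of unity other than c, so a(xi) avoids the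
    conjugate primes above p. Turning this into norm exactly p needs congruences modulo p^2, hence c
    is chosen with p^2 dividing Phi_n(c). Elements of Z[xi] are represented throughout by integer
    polynomials, so that one expression can be evaluated both at xi and at c. *)

Definition rdvd (R : comPzRingType) (x y : R) : Prop := exists q, y = q * x.

Definition rprime (R : idomainType) (x : R) : Prop :=
  [/\ x != 0, x \isn't a GRing.unit &
      forall a b, rdvd x (a * b) -> rdvd x a \/ rdvd x b].

(** The factors are prime and not merely irreducible, so existence of a factorisation already
    carries its uniqueness. *)
Definition factorial_ring (R : idomainType) : Prop :=
  forall x : R, x != 0 -> exists (u : R) (s : seq R),
    [/\ u \is a GRing.unit, (forall q, q \in s -> rprime q) &
        x = u * \prod_(q <- s) q].

Section Divisibility.
Variable R : idomainType.
Implicit Types x y q : R.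

Lemma rdvd_mull x y z : rdvd x y -> rdvd x (z * y).
Proof. by case=> q ->; exists (z * q); rewrite mulrA. Qed.

Lemma rdvd_mulr x y z : rdvd x y -> rdvd x (y * z).
Proof. by rewrite mulrC; apply: rdvd_mull. Qed.

Lemma rdvdD x y z : rdvd x y -> rdvd x z -> rdvd x (y + z).
Proof. by case=> a -> [b ->]; exists (a + b); rewrite mulrDl. Qed.

Lemma rdvd_sum (I : Type) (r : seq I) (P : pred I) F x :
  (forall i, P i -> rdvd x (F i)) -> rdvd x (\sum_(i <- r | P i) F i).
Proof.
by move=> H; elim/big_ind: _ => //; [exists 0; rewrite mul0r | exact: rdvdD].
Qed.

Lemma rprime_dvd_unit x u : rprime x -> u \is a GRing.unit -> ~ rdvd x u.
Proof.
case=> _ /negP xNu _ uu [q Du]; apply: xNu.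
by move: uu; rewrite Du unitrM => /andP[].
Qed.

Lemma rprime_dvd_prod x (s : seq R) :
  rprime x -> rdvd x (\prod_(q <- s) q) -> exists2 q, q \in s & rdvd x q.
Proof.
move=> px; elim: s => [|a s IHs].
  by rewrite big_nil => /(rprime_dvd_unit px (unitr1 _)).
rewrite big_cons; case: (px) => _ _ H /H[xa | /IHs[q qs xq]].
  by exists a; rewrite ?mem_head.
by exists q; rewrite // inE qs orbT.
Qed.

Lemma rprime_dvd_exp x y k : rprime x -> rdvd x (y ^+ k) -> rdvd x y.
Proof.
move=> px; elim: k => [/(rprime_dvd_unit px (unitr1 _))//|k IHk].
by rewrite exprS; case: (px) => _ _ H /H[|/IHk].
Qed.

Lemma rprime_dvd_rprime x y :
  rprime x -> rprime y -> rdvd x y -> exists2 v, v \is a GRing.unit & y = v * x.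
Proof.
move=> [x0 xNu px] [y0 yNu py] [v Dy]; exists v => //.
have /py[[w Dw]|[w Dx]]: rdvd y (v * x) by exists 1; rewrite mul1r.
  case/negP: xNu; apply/unitrPr; exists w; apply: (mulIf y0).
  by rewrite mul1r [in RHS]Dy Dw; ring.
apply/unitrPr; exists w; apply: (mulIf x0); rewrite mul1r [in RHS]Dx Dy.
by ring.
Qed.

(** Removing a prime shortens the factorisation; the number of factors serves as the induction
    measure in [prime_free_part]. *)
Lemma prime_factor_cancel (u x p : R) (s : seq R) :
    u \is a GRing.unit -> (forall q, q \in s -> rprime q) -> rprime p ->
    x * p = u * \prod_(q <- s) q ->
  exists (u' : R) (s' : seq R), [/\ u' \is a GRing.unit,
    (forall q, q \in s' -> rprime q), (size s' < size s)%N &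
    x = u' * \prod_(q <- s') q].
Proof.
move=> uu ps pp Dx.
have [q qs pq]: exists2 q, q \in s & rdvd p q.
  have: rdvd p (u * \prod_(q <- s) q) by rewrite -Dx; exists x.
  by case: (pp) => _ _ H /H[/(rprime_dvd_unit pp uu)//|/(rprime_dvd_prod pp)].
have [v uv Dq] := rprime_dvd_rprime pp (ps q qs) pq.
exists (u * v), (rem q s); split.
- by rewrite unitrM uu.
- by move=> a /mem_rem/ps.
- by rewrite size_rem // prednK //; case: (s) qs.
have p0: p != 0 by case: pp.
apply: (mulIf p0); rewrite Dx (perm_big _ (perm_to_rem qs)) big_cons {1}Dq /=.
by ring.
Qed.

End Divisibility.

(** * Gauss's lemma and factoriality of polynomial rings *)

Section PolyFactorial.
Variable R : idomainType.
Implicit Types (f g : {poly R}).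

Lemma rdvd_polyC (c : R) f : rdvd c%:P f <-> forall i, rdvd c f`_i.
Proof.
split=> [[q ->] i|H]; first by exists q`_i; rewrite coefMC.
have [q Dq] := choice H.
exists (\poly_(i < size f) q i); apply/polyP=> i.
rewrite coefMC coef_poly; case: ltnP => [_|le_fi]; first exact: Dq.
by rewrite mul0r nth_default.
Qed.

(** Gauss's argument: if a_i and b_j are the lowest coefficients not divisible by c, every other
    term of the coefficient of index i + j in the product is divisible by c. *)
Lemma rprime_polyC (c : R) : rprime c -> rprime c%:P.
Proof.
move=> pc; have [c0 cNu cP] := pc; split.
- by rewrite polyC_eq0.
- by rewrite poly_unitE coefC eqxx (negPf cNu) andbF.
move=> a b cab; apply: contrapT => /not_orP[].
have ex f : ~ rdvd c%:P f -> exists i, `[< ~ rdvd c f`_i >].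
  move=> H; apply: contrapT => /forallNP H'; apply/H/rdvd_polyC => i.
  by apply: contrapT => /asboolP; apply: H'.
move=> /ex Ha /ex Hb.
case: (ex_minnP Ha) => i /asboolP Nai mini.
case: (ex_minnP Hb) => j /asboolP Nbj minj.
have lti k : (k < i)%N -> rdvd c a`_k.
  by move=> lt_ki; apply: contrapT => /asboolP/mini; rewrite leqNgt lt_ki.
have ltj k : (k < j)%N -> rdvd c b`_k.
  by move=> lt_kj; apply: contrapT => /asboolP/minj; rewrite leqNgt lt_kj.
have /rdvd_polyC/(_ (i + j)%N) := cab.
rewrite coefM (bigD1 (inord i)) //= inordK ?ltnS ?leq_addr // addKn => -[q Dq].
suff: rdvd c (a`_i * b`_j) by case/cP.
have [q' Dq']: rdvd c (\sum_(k < (i + j).+1 | k != inord i) a`_k * b`_(i + j - k)).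
  apply: rdvd_sum => k; rewrite -val_eqE /= inordK ?ltnS ?leq_addr // => ne_ki.
  have [/lti/rdvd_mulr//|le_ik] := ltnP k i.
  by apply/rdvd_mull/ltj; have := ltn_ord k; lia.
by exists (q - q'); rewrite mulrBl -Dq -Dq' addrK.
Qed.

Definition prime_free f := forall c : R, rprime c -> ~ rdvd c%:P f.

Hypothesis facR : factorial_ring R.

(** The content is extracted prime by prime; this stops because each prime also divides the leading
    coefficient. *)
Lemma prime_free_part f : f != 0 ->
  exists (r : R) f0, [/\ r != 0, f = r *: f0 & prime_free f0].
Proof.
move=> fn0; have lf0: lead_coef f != 0 by rewrite lead_coef_eq0.
have [u [s [uu ps Dl]]] := facR lf0.
move: {2}(size s).+1 (ltnSn (size s)) => m.
elim: m f fn0 lf0 u s uu ps Dl => // m IHm f fn0 lf0 u s uu ps Dl lt_sm.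
have [Pf|] := pselect (prime_free f).
  by exists 1, f; rewrite oner_neq0 scale1r.
move/existsNP=> [c /not_implyP[pc /contrapT[q Dq]]].
have qn0: q != 0 by apply: contraNneq fn0 => q0; rewrite Dq q0 mul0r.
have lq0: lead_coef q != 0 by rewrite lead_coef_eq0.
have Dlq: lead_coef q * c = u * \prod_(a <- s) a.
  by rewrite -Dl Dq lead_coefM lead_coefC.
have [u' [s' [uu' ps' lt_s' Dq']]] := prime_factor_cancel uu ps pc Dlq.
have [r [f0 [r0 Df0 Pf0]]] := IHm q qn0 lq0 u' s' uu' ps' Dq' (leq_trans lt_s' lt_sm).
exists (c * r), f0; split=> //; first by rewrite mulf_neq0 //; case: pc.
by rewrite Dq Df0 mulrC mul_polyC scalerA.
Qed.

(* Gauss: a scalar denominator in front of a multiple of a prime-free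
   polynomial can be cancelled one prime factor at a time. *)
Lemma prime_free_dvd (c : R) f a q : c != 0 -> prime_free f ->
  c *: a = q * f -> rdvd f a.
Proof.
move=> c0 Pf; have [u [s [uu ps ->]]] := facR c0 => {c c0}.
elim: s ps q => [|p s IHs] ps q.
  rewrite big_nil mulr1 => Da; exists (u^-1 *: q).
  by rewrite -scalerAl -Da scalerA mulVr // scale1r.
have pp : rprime p by apply: ps; rewrite mem_head.
have ps' x : x \in s -> rprime x by move=> xs; apply: ps; rewrite inE xs orbT.
rewrite big_cons mulrCA -scalerA -mul_polyC => Da.
have: rdvd p%:P (q * f) by rewrite -Da; exists ((u * \prod_(j <- s) j) *: a); rewrite mulrC.
case: (rprime_polyC pp) => p0 _ H /H[[q' Dq]|/(Pf _ pp)//].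
by apply: (IHs ps' q'); apply: (mulfI p0); rewrite Da Dq mulrAC mulrC.
Qed.

(** Here [%|] is pseudo-divisibility, that is, divisibility over the fraction field, where the gcd
    argument applies; prime-freeness brings the quotient back to R. *)
Lemma rprime_irredp f : prime_free f -> irreducible_poly f -> rprime f.
Proof.
move=> Pf [sf irf]; have fn0: f != 0 by rewrite -size_poly_gt0 ltnW.
split=> //.
  by rewrite poly_unitE; case: eqP sf => // ->.
have pdvd a : (f %| a)%R -> rdvd f a.
  move=> fa; have [[c q] /= c0 Dq] := Pdiv.Idomain.dvdpP _ _ fa.
  exact: (prime_free_dvd c0 Pf Dq).
move=> a b [q Dab]; have fab: (f %| a * b)%R by rewrite Dab dvdp_mulIr.
have [cfa|] := boolP (coprimep f a).
  by right; apply: pdvd; rewrite -(Gauss_dvdpr _ cfa).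
rewrite coprimep_def => sg; left; apply: pdvd.
have: gcdp f a %= f by apply: irf => //; apply: dvdp_gcdl.
by case/andP => _ /dvdp_trans; apply; apply: dvdp_gcdr.
Qed.

Lemma irredp_divisor f : (1 < size f)%N ->
  exists2 g, irreducible_poly g & (g %| f)%R.
Proof.
move: {2}(size f).+1 (ltnSn (size f)) => m.
elim: m f => // m IHm f lt_fm sf.
have [irf|] := pselect (irreducible_poly f); first by exists f.
move/not_andP=> [//|/existsNP[q /not_implyP[sq /not_implyP[qf /negP nqf]]]].
have fn0: f != 0 by rewrite -size_poly_gt0 ltnW.
have ltqf: (size q < size f)%N.
  by rewrite ltn_neqAle dvdp_leq // dvdp_size_eqp // nqf.
have qn0 : q != 0 by apply: dvdpN0 qf fn0.
have [||g irg gq] := IHm q; first exact: leq_trans ltqf _.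
  by rewrite ltn_neqAle eq_sym sq size_poly_gt0.
by exists g => //; apply: dvdp_trans gq qf.
Qed.

Theorem poly_factorial : factorial_ring {poly R}.
Proof.
move=> f; move: {2}(size f).+1 (ltnSn (size f)) => m.
elim: m f => // m IHm f lt_fm fn0.
have [sf|sf] := leqP (size f) 1.
  have Df := size1_polyC sf; have c0: f`_0 != 0.
    by apply: contraNneq fn0 => c0; rewrite Df c0.
  have [u [s [uu ps Dc]]] := facR c0.
  exists u%:P, (map polyC s); split.
  - by rewrite poly_unitE coefC eqxx size_polyC uu (memPn _ u uu) ?unitr0.
  - by move=> q /mapP[c /ps pc ->]; apply: rprime_polyC.
  by rewrite Df Dc polyCM big_map rmorph_prod.
have [g irg gf] := irredp_divisor sf.
have gn0 : g != 0 by apply: dvdpN0 gf fn0.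
have [r [g0 [r0 Dg Pg]]] := prime_free_part gn0.
have eqg : g0 %= g by rewrite Dg eqp_sym eqp_scale.
have irg0 : irreducible_poly g0.
  split=> [|q sq]; first by rewrite (eqp_size eqg); case: irg.
  by rewrite (eqp_dvdr _ eqg) (eqp_rtrans eqg); case: irg => _; apply.
have pg0 := rprime_irredp Pg irg0.
have [q Dq]: rdvd g0 f.
  have g0f: (g0 %| f)%R by rewrite (eqp_dvdl _ eqg).
  have [[c q] /= c0 Dq] := Pdiv.Idomain.dvdpP _ _ g0f.
  exact: (prime_free_dvd c0 Pg Dq).
have qn0: q != 0 by apply: contraNneq fn0 => q0; rewrite Dq q0 mul0r.
have g0n0 : g0 != 0 by case: pg0.
have ltq: (size q < size f)%N.
  rewrite Dq size_mul // -ltnS prednK ?addn_gt0 ?size_poly_gt0 ?qn0 //.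
  by rewrite -[X in (X < _)%N]addn1 ltn_add2l; case: irg0.
have [u [s [uu ps Ds]]] := IHm q (leq_trans ltq lt_fm) qn0.
exists u, (g0 :: s); split=> //.
  by move=> x; rewrite inE => /orP[/eqP->|/ps].
by rewrite big_cons Dq Ds; ring.
Qed.

End PolyFactorial.

Lemma factorial_can (R S : idomainType) (f : {rmorphism R -> S})
    (g : {rmorphism S -> R}) :
  cancel f g -> cancel g f -> factorial_ring R -> factorial_ring S.
Proof.
move=> fK gK facR x x0; have gx0 : g x != 0 by rewrite (can2_eq gK fK) rmorph0.
have [u [s [uu ps Dx]]] := facR _ gx0.
exists (f u), (map f s); split; first exact: rmorph_unit.
  move=> q /mapP[c /ps[c0 cNu cP] ->]; split.
  - by rewrite (can2_eq fK gK) rmorph0.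
  - by apply: contra cNu => /(rmorph_unit g); rewrite fK.
  move=> a b [d Dab]; have: rdvd c (g a * g b).
    by exists (g d); rewrite -rmorphM Dab rmorphM fK.
  by case/cP=> [[e De]|[e De]]; [left|right]; exists (f e); rewrite -rmorphM -De gK.
by rewrite big_map -rmorph_prod -rmorphM -Dx gK.
Qed.

Lemma mpoly_rmorph_eq (n : nat) (R : nzRingType) (S : pzRingType)
    (f g : {rmorphism {mpoly R[n]} -> S}) :
  (forall c, f c%:MP = g c%:MP) -> (forall i, f 'X_i = g 'X_i) -> f =1 g.
Proof.
move=> fgC fgX p; rewrite (mpolyE p) !rmorph_sum; apply: eq_bigr => m _.
rewrite -mul_mpolyC !rmorphM fgC; congr (_ * _).
rewrite mpolyXE_id !rmorph_prod; apply: eq_bigr => i _.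
by rewrite !rmorphXn fgX.
Qed.

Theorem mpoly_factorial (F : fieldType) (n : nat) : factorial_ring {mpoly F[n]}.
Proof.
elim: n => [|n IHn].
  move=> x x0; exists x, [::]; split=> //; last by rewrite big_nil mulr1.
  have Dx : x = (x@_0%MM)%:MP.
    apply/mpolyP=> m; rewrite mcoeffC; have ->: m = 0%MM by apply/mnmP=> -[].
    by rewrite eqxx mulr1.
  rewrite Dx; apply: (rmorph_unit (@mpolyC 0 F)); rewrite unitfE.
  by apply: contraNneq x0 => x0; rewrite Dx x0.
have cX : commr_rmorph (@mwiden n F) ('X_ord_max) by move=> x; apply: mulrC.
have muniX i : muni ('X_i : {mpoly F[n.+1]}) =
    if unlift ord_max i is Some j then ('X_j)%:P else 'X.
  rewrite /muni mmapX mmap1U; case: splitP => [j Dj|j].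
    have -> : i = lift ord_max j by apply: ord_inj; rewrite lift_max.
    by rewrite liftK.
  by rewrite ord1 addn0 => Di; rewrite (_ : i = ord_max) ?unlift_none //; apply/val_inj.
(* Polynomials in n + 1 variables are polynomials in the last variable over those in the first n;
   [muni] and [horner_morph cX] are the two directions of this isomorphism. *)
have phiK : cancel (horner_morph cX) (@muni n F).
  elim/poly_ind=> [|q c IHq]; first by rewrite !rmorph0.
  rewrite !rmorphD !rmorphM /= IHq horner_morphX horner_morphC; congr (_ * _ + _).
    by rewrite muniX unlift_none.
  apply: (mpoly_rmorph_eq (f := @muni n F \o @mwiden n F) (g := polyC)) c => [c|i] /=.
    by rewrite mwidenC muniC.
  rewrite mwidenX mnmwiden1 muniX (_ : widen_ord _ _ = lift ord_max i) ?liftK //.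
  by apply: ord_inj; rewrite lift_max.
have muniK : cancel (@muni n F) (horner_morph cX).
  apply: (mpoly_rmorph_eq (f := horner_morph cX \o @muni n F) (g := idfun)) => [c|i] /=.
    by rewrite muniC horner_morphC; apply: mwidenC.
  rewrite muniX; case: unliftP => [j ->|->]; last by rewrite horner_morphX.
  rewrite horner_morphC /= mwidenX mnmwiden1; congr (mpolyX _ U_(_)%MM); apply: ord_inj.
  by rewrite lift_max.
exact: (factorial_can phiK muniK (poly_factorial IHn)).
Qed.

(** * Factorial subrings of a field and their localisations *)

Section SubringPredicates.
Variable E : fieldType.
Implicit Types (D : E -> Prop) (x y t : E).

(** Rings are predicates on one ambient field, so that two rings sharing a localisation can be
    compared element by element; x divides a in D when [D (a / x)]. *)
Definition is_subring D : Prop :=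
  [/\ D 1, (forall x y, D x -> D y -> D (x - y)) &
      (forall x y, D x -> D y -> D (x * y))].

Definition unit_in D x : Prop := [/\ x != 0, D x & D x^-1].

Definition prime_in D x : Prop :=
  [/\ x != 0, D x, ~ D x^-1 &
      forall a b, D (a * b / x) -> D a -> D b -> D (a / x) \/ D (b / x)].

Definition factorial_in D : Prop :=
  forall x, D x -> x != 0 -> exists (u : E) (s : seq E),
    [/\ unit_in D u, (forall q, q \in s -> prime_in D q) &
        x = u * \prod_(q <- s) q].

Definition loc D t x : Prop := exists k, D (x * t ^+ k).

(** Laurent monomials turn exponent vectors into elements of E; this is the passage between lattices
    and units. *)
Definition lmon r (P : 'I_r -> E) (v : {ffun 'I_r -> int}) : E :=
  \prod_i P i ^ v i.

Section Closure.
Variable D : E -> Prop.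
Hypothesis sD : is_subring D.

Lemma sub_in1 : D 1. Proof. by case: sD. Qed.
Lemma sub_inB x y : D x -> D y -> D (x - y). Proof. by case: sD => _ H _; apply: H. Qed.
Lemma sub_inM x y : D x -> D y -> D (x * y). Proof. by case: sD => _ _ H; apply: H. Qed.
Lemma sub_in0 : D 0. Proof. by rewrite -(subrr 1); apply: sub_inB; apply: sub_in1. Qed.
Lemma sub_inN x : D x -> D (- x).
Proof. by rewrite -sub0r; apply: sub_inB; apply: sub_in0. Qed.
Lemma sub_inD x y : D x -> D y -> D (x + y).
Proof. by move=> Dx Dy; rewrite -[y]opprK; apply/sub_inB/sub_inN. Qed.
Lemma sub_inX x k : D x -> D (x ^+ k).
Proof. by move=> Dx; elim: k => [|k IHk]; [apply: sub_in1 | rewrite exprS; apply: sub_inM]. Qed.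
Lemma sub_in_prod (I : Type) (r : seq I) (P : pred I) F :
  (forall i, P i -> D (F i)) -> D (\prod_(i <- r | P i) F i).
Proof. by move=> H; elim/big_ind: _ => //; [apply: sub_in1 | apply: sub_inM]. Qed.
Lemma sub_in_sum (I : Type) (r : seq I) (P : pred I) F :
  (forall i, P i -> D (F i)) -> D (\sum_(i <- r | P i) F i).
Proof. by move=> H; elim/big_ind: _ => //; [apply: sub_in0 | apply: sub_inD]. Qed.

Lemma unit_in1 : unit_in D 1.
Proof. by split; rewrite ?oner_eq0 ?invr1 //; apply: sub_in1. Qed.

Lemma unit_inM x y : unit_in D x -> unit_in D y -> unit_in D (x * y).
Proof.
move=> [x0 Dx Dx'] [y0 Dy Dy']; split; first by rewrite mulf_neq0.
  exact: sub_inM.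
by rewrite invfM; apply: sub_inM.
Qed.

Lemma unit_inV x : unit_in D x -> unit_in D x^-1.
Proof. by move=> [x0 Dx Dx']; split; rewrite ?invr_eq0 // invrK. Qed.

Lemma unit_in_div x y : unit_in D x -> unit_in D y -> unit_in D (x / y).
Proof. by move=> ux uy; apply/unit_inM/unit_inV. Qed.

Lemma unit_inVC x y : unit_in D (x / y) -> unit_in D (y / x).
Proof. by move/unit_inV; rewrite invf_div. Qed.

Lemma unit_in_trans y x z : y != 0 ->
  unit_in D (x / y) -> unit_in D (y / z) -> unit_in D (x / z).
Proof. by move=> y0 uxy /(unit_inM uxy); rewrite mulrA mulfVK. Qed.

Lemma unit_in_exp x (k : int) : unit_in D x -> unit_in D (x ^ k).
Proof.
move=> ux; have uX n : unit_in D (x ^+ n).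
  by elim: n => [|n IHn]; [exact: unit_in1 | rewrite exprS; apply: unit_inM].
by case: k => n; [exact: uX | apply/unit_inV/uX].
Qed.

Lemma unit_in_prod (I : Type) (r : seq I) (P : pred I) F :
  (forall i, P i -> unit_in D (F i)) -> unit_in D (\prod_(i <- r | P i) F i).
Proof. by move=> H; elim/big_ind: _ => //; [exact: unit_in1 | exact: unit_inM]. Qed.

Lemma prime_in_dvd_unit x u : prime_in D x -> unit_in D u -> ~ D (u / x).
Proof.
move=> [x0 Dx xNu _] [u0 Du Du'] Dux; apply: xNu.
by rewrite -[_^-1](mulKf u0); apply: sub_inM.
Qed.

Lemma prime_in_dvd_prod (I : Type) (r : seq I) (P : pred I) F x :
    prime_in D x -> (forall i, P i -> D (F i)) ->
    D ((\prod_(i <- r | P i) F i) / x) ->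
  exists2 i, P i & D (F i / x).
Proof.
move=> px DF; elim: r => [|i r IHr].
  by rewrite big_nil => /(prime_in_dvd_unit px unit_in1).
rewrite big_cons; case: ifP => // Pi; case: (px) => _ _ _ H /H[||Dx|/IHr//].
- exact: DF.
- exact: sub_in_prod.
by exists i.
Qed.

Lemma prime_in_dvd_exp x y k : prime_in D x -> D y -> D (y ^+ k / x) -> D (y / x).
Proof.
move=> px Dy; rewrite -[in y ^+ k](card_ord k) -prodr_const.
by case/(prime_in_dvd_prod px) => // i _.
Qed.

Lemma prime_in_dvd_prime x y :
  prime_in D x -> prime_in D y -> D (y / x) -> unit_in D (y / x).
Proof.
move=> [x0 Dx xNu px] [y0 Dy yNu py] Dyx.
split=> //; first by rewrite mulf_neq0 ?invr_eq0.
have: D (y / x * x / y) by rewrite mulfVK // divff //; apply: sub_in1.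
case/py=> // [|Dxy]; last by rewrite invf_div.
by rewrite mulrAC divff // mul1r.
Qed.

Lemma sub_loc t x : D x -> loc D t x.
Proof. by move=> Dx; exists 0; rewrite mulr1. Qed.

Lemma loc_subring t : D t -> is_subring (loc D t).
Proof.
move=> Dt; split; first exact/sub_loc/sub_in1.
  move=> x y [k Dx] [l Dy]; exists (k + l)%N.
  rewrite mulrBl {2}addnC !exprD !mulrA.
  by apply: sub_inB; apply: sub_inM => //; apply: sub_inX.
move=> x y [k Dx] [l Dy]; exists (k + l)%N.
by rewrite exprD mulrACA; apply: sub_inM.
Qed.

Lemma loc_inv t : t != 0 -> loc D t t^-1.
Proof. by move=> t0; exists 1; rewrite mulVf //; apply: sub_in1. Qed.

Lemma lmon_neq0 r (P : 'I_r -> E) v : (forall i, P i != 0) -> lmon P v != 0.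
Proof. by move=> P0; apply/prodf_neq0 => i _; rewrite expfz_neq0. Qed.

Lemma lmonD r (P : 'I_r -> E) v w : (forall i, P i != 0) ->
  lmon P (v + w) = lmon P v * lmon P w.
Proof.
by move=> P0; rewrite -big_split; apply: eq_bigr => i _; rewrite ffunE expfzDr.
Qed.

Lemma lmon0 r (P : 'I_r -> E) : lmon P 0 = 1.
Proof. by apply: big1 => i _; rewrite ffunE. Qed.

Lemma lmonN r (P : 'I_r -> E) v : (forall i, P i != 0) ->
  lmon P (- v) = (lmon P v)^-1.
Proof.
move=> P0; apply: (mulIf (lmon_neq0 v P0)).
by rewrite -lmonD // addNr lmon0 mulVf // lmon_neq0.
Qed.

Lemma lmon_delta r (P : 'I_r -> E) i :
  lmon P [ffun j => (j == i)%:R] = P i.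
Proof.
rewrite /lmon (bigD1 i) //= ffunE eqxx big1 ?mulr1 // => j /negPf ji.
by rewrite ffunE ji.
Qed.

Lemma nonassoc_reps (l : seq E) : (forall q, q \in l -> q != 0) ->
  exists l' : seq E, [/\ {subset l' <= l},
    (forall q, q \in l -> exists2 a, a \in l' & unit_in D (q / a)) &
    forall i j, (i < size l')%N -> (j < size l')%N ->
      unit_in D (nth 0 l' i / nth 0 l' j) -> i = j].
Proof.
elim: l => [|q l IHl] l0; first by exists [::].
have [|l' [sl' al' ul']] := IHl.
  by move=> a al; apply: l0; rewrite inE al orbT.
have q0 : q != 0 by apply: l0; rewrite mem_head.
have [[a al qa]|nq] := pselect (exists2 a, a \in l' & unit_in D (q / a)).
  exists l'; split=> // [b /sl'|b]; first by rewrite inE orbC => ->.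
  by rewrite inE => /orP[/eqP->|/al'//]; exists a.
exists (q :: l'); split.
- by move=> b; rewrite !inE => /orP[->//|/sl'->]; rewrite orbT.
- move=> b; rewrite inE => /orP[/eqP->|/al'[a al ba]].
    by exists q; rewrite ?mem_head // divff //; apply: unit_in1.
  by exists a; rewrite // inE al orbT.
case=> [|i] [|j] //=; rewrite !ltnS.
- move=> _ lj uj; case: nq; exists (nth 0 l' j) => //; exact: mem_nth.
- move=> li _ /unit_inVC ui; case: nq; exists (nth 0 l' i) => //; exact: mem_nth.
by move=> li lj /ul'->.
Qed.

Variable t : E.
Hypotheses (facD : factorial_in D) (Dt : D t) (t0 : t != 0).

(** A prime inverted in D[1/t] divides a power of t, hence is associate to one of the finitely many
    prime factors of t. *)
Lemma prime_representatives : exists r (P : 'I_r -> E),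
  [/\ forall i, prime_in D (P i), forall i, D (t / P i),
      forall q, prime_in D q -> loc D t q^-1 -> exists i, unit_in D (q / P i) &
      forall i j, unit_in D (P i / P j) -> i = j].
Proof.
have [u [l [uu pl Dl]]] := facD Dt t0.
have l0 q : q \in l -> q != 0 by case/pl.
have [l' [sl' al' ul']] := nonassoc_reps l0.
exists (size l'), (fun i => nth 0 l' i); split.
- by move=> i; apply/pl/sl'/mem_nth.
- move=> i; have /sl' il : nth 0 l' i \in l' by apply: mem_nth.
  rewrite Dl (perm_big _ (perm_to_rem il)) big_cons /= mulrCA mulrAC divff ?l0 //.
  rewrite mul1r; apply: sub_inM; first by case: uu.
  rewrite big_seq; apply: sub_in_prod => q /mem_rem/pl; by case.
- move=> q pq [k]; rewrite mulrC => /(prime_in_dvd_exp pq Dt).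
  rewrite Dl; case: (pq) => q0 _ _ H /H[||/(prime_in_dvd_unit pq uu)//|].
  + by case: uu.
  + by rewrite big_seq; apply: sub_in_prod => a /pl[].
  rewrite big_seq => /(prime_in_dvd_prod pq)[a /pl[]//|a al Daq].
  have [b bl' uab] := al' a al; exists (Ordinal (etrans (index_mem b l') bl')) => /=.
  rewrite nth_index //; apply: unit_in_trans uab; first exact: l0.
  by apply/unit_inVC/prime_in_dvd_prime => //; apply: pl.
by move=> i j uij; apply/val_inj; apply: ul' uij; apply: ltn_ord.
Qed.

Section Independence.
Variables (r : nat) (P : 'I_r -> E).
Hypotheses (pP : forall i, prime_in D (P i))
  (nP : forall i j, unit_in D (P i / P j) -> i = j).

(** A positive exponent makes P_i divide the numerator, hence the denominator, hence some P_j with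
    v_j < 0; then i = j, which is absurd. *)
Lemma prime_family_le0 v i : unit_in D (lmon P v) -> (v i <= 0)%R.
Proof.
(* The positive part of an integer, so that a Laurent monomial is a quotient of two genuine
   products. *)
pose pos (k : int) := if k is Posz m then m else 0%N.
have posE x (k : int) : x != 0 -> x ^ k = x ^+ pos k / x ^+ pos (- k).
  move=> x0; case: k => k /=; last by rewrite div1r.
  by case: k => [|k] /=; rewrite invr1 mulr1.
have P0 j : P j != 0 by case: (pP j).
have DP j : D (P j) by case: (pP j).
move=> uv; rewrite leNgt; apply/negP => vi.
have Dlv : lmon P v * \prod_j P j ^+ pos (- v j) = \prod_j P j ^+ pos (v j).
  rewrite -big_split; apply: eq_bigr => j _ /=.
  by rewrite posE // mulfVK // expf_neq0.
have: D ((\prod_j P j ^+ pos (v j)) / P i).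
  rewrite (bigD1 i) //= mulrAC; apply: sub_inM.
    case: (v i) vi => [[|k]|k] //= _; rewrite exprS mulrAC divff // mul1r.
    exact: sub_inX.
  by apply: sub_in_prod => j _; apply: sub_inX.
rewrite -Dlv; case: (pP i) => _ _ _ H /H[||/(prime_in_dvd_unit (pP i) uv)//|].
- by case: uv.
- by apply: sub_in_prod => j _; apply: sub_inX.
case/(prime_in_dvd_prod (pP i)) => [j _|j _ Dji]; first exact: sub_inX.
have vj : (v j < 0)%R.
  case: (v j) Dji => // k Dji; case: (prime_in_dvd_unit (pP i) unit_in1).
  by case: k Dji.
have Dij := prime_in_dvd_exp (pP i) (DP j) Dji.
have eij := nP (prime_in_dvd_prime (pP i) (pP j) Dij).
by move: vi; rewrite -eij ltNge ltW.
Qed.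

Lemma prime_family_free v : unit_in D (lmon P v) -> v = 0.
Proof.
have P0 j : P j != 0 by case: (pP j).
move=> uv; apply/ffunP => i; apply/eqP; rewrite ffunE eq_le prime_family_le0 //=.
have /(prime_family_le0 i) : unit_in D (lmon P (- v)) by rewrite lmonN //; apply: unit_inV.
by rewrite ffunE oppr_le0.
Qed.

End Independence.

End Closure.

(* An automorphism stabilising D and D[1/t] permutes the finitely many primes
   that divide t. *)
Theorem prime_family D t (g g' : {rmorphism E -> E}) :
    is_subring D -> factorial_in D -> D t -> t != 0 ->
    cancel g g' -> cancel g' g ->
    (forall x, D x -> D (g x)) -> (forall x, D x -> D (g' x)) ->
    (forall x, loc D t x -> loc D t (g x)) ->
  exists r (P : 'I_r -> E) (s : {perm 'I_r}),
  [/\ forall i, P i != 0,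
      forall f, unit_in (loc D t) f <-> exists v, unit_in D (f / lmon P v),
      forall v, unit_in D (lmon P v) -> v = 0 &
      forall i, unit_in D (g (P i) / P (s i))].
Proof.
move=> sD facD Dt t0 gK g'K gD g'D gloc.
have [r [P [pP tP repP nP]]] := prime_representatives sD facD Dt t0.
have P0 i : P i != 0 by case: (pP i).
have DP i : D (P i) by case: (pP i).
have sL := loc_subring sD Dt.
have ulP i : loc D t (P i)^-1.
  by exists 1; rewrite mulrC; apply: tP.
have u_g x : unit_in D x -> unit_in D (g x).
  by case=> x0 Dx Dx'; split; rewrite ?fmorph_eq0 -?fmorphV //; apply: gD.
have u_g' x : unit_in D x -> unit_in D (g' x).
  by case=> x0 Dx Dx'; split; rewrite ?fmorph_eq0 -?fmorphV //; apply: g'D.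
have prime_g i : prime_in D (g (P i)).
  case: (pP i) => p0 Dp Np Hp; split; rewrite ?fmorph_eq0 //; first exact: gD.
    by move/g'D; rewrite fmorphV gK.
  move=> a b /g'D; rewrite fmorph_div rmorphM gK => /Hp H /g'D/H{}H /g'D/H[] /gD;
    rewrite fmorph_div g'K; [by left|by right].
have /choice[s0 Hs] i : exists j, unit_in D (g (P i) / P j).
  by apply: repP => //; rewrite -fmorphV; apply: gloc.
have inj_s : injective s0.
  move=> i j eij; apply: nP; rewrite -[_ / _]gK; apply: u_g'.
  rewrite fmorph_div; apply: (unit_in_trans sD _ (Hs i)) => //.
  by rewrite eij; apply/unit_inVC/Hs.
exists r, P, (perm inj_s); split=> //; last by move=> i; rewrite permE.
(* G is the group generated by the units of D and the P_i. A unit of D[1/t] is a quotient of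
   elements of D all of whose prime factors are inverted, so it lies in G. *)
- pose G f := exists v, unit_in D (f / lmon P v).
  have GM x y : G x -> G y -> G (x * y).
    move=> [v uv] [w uw]; exists (v + w).
    by rewrite lmonD // invfM mulrACA; apply: (unit_inM sD).
  have GV x : G x -> G x^-1.
    move=> [v uv]; exists (- v); rewrite lmonN //.
    by rewrite -invfM; apply: unit_inV.
  have Gu x : unit_in D x -> G x.
    by move=> ux; exists 0; rewrite lmon0 divr1.
  have GX x k : G x -> G (x ^+ k).
    move=> Gx; elim: k => [|k IHk]; first exact/Gu/(unit_in1 sD).
    by rewrite exprS; apply: GM.
  have Gdiv a : D a -> a != 0 -> loc D t a^-1 -> G a.
    move=> Da a0 la; have [u [l [uu pl Dl]]] := facD _ Da a0; rewrite Dl.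
    apply: (GM _ _ (Gu _ uu)); rewrite big_seq; elim/big_ind: _ => //.
      exact/Gu/(unit_in1 sD).
    move=> q ql; have pq := pl q ql; case: (pq) => q0 Dq _ _.
    have [|i ui] := repP q pq.
      have -> : q^-1 = u * \prod_(b <- rem q l) b / a.
        apply: (mulIf q0); apply: (mulIf a0).
        rewrite mulVf // mul1r [RHS]mulrAC mulfVK // Dl -mulrA; congr (_ * _).
        by rewrite (perm_big _ (perm_to_rem ql)) big_cons mulrC.
      apply: (sub_inM sL _ la); apply/sub_loc/(sub_inM sD); first by case: uu.
      by rewrite big_seq; apply: (sub_in_prod sD) => b /mem_rem/pl[].
    by exists [ffun j => (j == i)%:R]; rewrite lmon_delta.
  have Gt : G t by apply: Gdiv => //; apply: (loc_inv sD).
  move=> f; split=> [[f0 [k Da] lf]|[v uf]].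
    have tk0 : t ^+ k != 0 by rewrite expf_neq0.
    rewrite -[f](mulfK tk0); apply: GM; last exact/GV/GX.
    apply: Gdiv => //; first by rewrite mulf_neq0.
    rewrite invfM; apply: (sub_inM sL) => //.
    by rewrite -exprVn; apply/(sub_inX sL)/(loc_inv sD).
  have uloc x : unit_in D x -> unit_in (loc D t) x.
    by case=> x0 Dx Dx'; split=> //; apply: sub_loc.
  rewrite -[f](mulfVK (lmon_neq0 v P0)); apply: (unit_inM sL); first exact: uloc.
  apply: (unit_in_prod sL) => i _; apply: (unit_in_exp sL).
  by split=> //; apply: sub_loc.
exact: (prime_family_free sD pP nP).
Qed.

(* Two subrings, each contained in a localisation of the other, have a common
   localisation. *)
Lemma loc_exchange D1 D2 alpha beta j k :
    is_subring D1 -> is_subring D2 -> D2 alpha -> D1 beta ->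
    alpha != 0 -> beta != 0 ->
    (forall x, D1 x -> loc D2 alpha x) -> D2 (beta * alpha ^+ j) ->
  forall x, loc D1 (beta * (alpha * beta ^+ k)) x ->
            loc D2 (alpha * (beta * alpha ^+ j)) x.
Proof.
move=> s1 s2 Da Db a0 b0 l12 Dj x [m Dx].
(* [beta] itself need not lie in D2, but beta alpha^j does; inverting s inverts both alpha and
   beta. *)
set s := alpha * _; have Ds : D2 s by apply: (sub_inM s2).
have s0 : s != 0 by rewrite !mulf_neq0 ?expf_neq0.
have sL := loc_subring s2 Ds.
have is' : loc D2 s s^-1 by apply: (loc_inv s2).
have ia : loc D2 s alpha^-1.
  rewrite (_ : alpha^-1 = (beta * alpha ^+ j) * s^-1).
    by apply: (sub_inM sL) => //; apply: sub_loc.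
  by rewrite /s [alpha * _]mulrC invfM mulVKf // mulf_neq0 ?expf_neq0.
have ib : loc D2 s beta^-1.
  rewrite (_ : beta^-1 = (alpha * alpha ^+ j) * s^-1).
    by apply: (sub_inM sL) => //; apply: sub_loc; rewrite -exprS; apply: (sub_inX s2).
  by rewrite /s mulrCA [beta * _]mulrC invfM mulVKf // mulf_neq0 ?expf_neq0.
have lx1 y : loc D2 alpha y -> loc D2 s y.
  move=> [l Dy]; rewrite -(mulfK (expf_neq0 l a0) y); apply: (sub_inM sL).
    exact: sub_loc.
  by rewrite -exprVn; apply: (sub_inX sL).
set t := beta * _ in Dx.
have t0 : t != 0 by rewrite !mulf_neq0 ?expf_neq0.
rewrite -(mulfK (expf_neq0 m t0) x); apply: (sub_inM sL); first exact/lx1/l12.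
rewrite -exprVn; apply: (sub_inX sL); rewrite /t !invfM -exprVn.
by apply: (sub_inM sL) => //; apply: (sub_inM sL) => //; apply: (sub_inX sL).
Qed.

End SubringPredicates.

(** * Images of factorial rings in a field, localised at one element *)

Section FactorialImage.
Variables (E : fieldType) (R : idomainType) (f : {rmorphism R -> E}) (w : R).
Hypotheses (inj_f : injective f) (facR : factorial_ring R) (w0 : w != 0).

(** The ring f(R)[1/f(w)]; taking w = 1 gives f(R) itself, so one factoriality proof serves both the
    polynomial and the Laurent ring. *)
Definition loc_image (x : E) : Prop := loc (fun y => exists a, y = f a) (f w) x.

Lemma image_subring : is_subring (fun y : E => exists a, y = f a).
Proof.
split; first by exists 1; rewrite rmorph1.
  by move=> x y [a ->] [b ->]; exists (a - b); rewrite rmorphB.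
by move=> x y [a ->] [b ->]; exists (a * b); rewrite rmorphM.
Qed.

Lemma loc_image_subring : is_subring loc_image.
Proof. by apply: (loc_subring image_subring); exists w. Qed.

Let fw0 : f w != 0. Proof. by rewrite -(rmorph0 f) (inj_eq inj_f). Qed.

Lemma loc_imageE x : loc_image x -> exists a k, x = f a / f w ^+ k.
Proof.
by case=> k [a Da]; exists a, k; rewrite -Da mulfK // expf_neq0.
Qed.

Lemma image_loc a : loc_image (f a).
Proof. by apply: sub_loc; exists a. Qed.

Lemma loc_image_inv : loc_image (f w)^-1.
Proof. exact: (loc_inv image_subring). Qed.

Lemma unit_in_image u : u \is a GRing.unit -> unit_in loc_image (f u).
Proof.
move=> uu; split; last by rewrite -rmorphV //; apply: image_loc.
  by rewrite -(rmorph0 f) (inj_eq inj_f); apply: contraTneq uu => ->; rewrite unitr0.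
exact: image_loc.
Qed.

Lemma prime_in_image q : rprime q -> ~ rdvd q w -> prime_in loc_image (f q).
Proof.
move=> pq nqw; have [q0 _ Hq] := pq.
have fq0 : f q != 0 by rewrite -(rmorph0 f) (inj_eq inj_f).
have ndvd k : ~ rdvd q (w ^+ k) by move/(rprime_dvd_exp pq).
have dvdE a k : loc_image (f a / f w ^+ k / f q) -> rdvd q a.
  case/loc_imageE=> b [l Db].
  have: a * w ^+ l = b * w ^+ k * q.
    apply: inj_f; rewrite !rmorphM !rmorphXn.
    have wl0 : f w ^+ l != 0 by rewrite expf_neq0.
    have wk0 : f w ^+ k != 0 by rewrite expf_neq0.
    have -> : f a = f b / f w ^+ l * f q * f w ^+ k by rewrite -Db !mulfVK.
    by move: (f w ^+ l) (f w ^+ k) wl0 => x y x0; field.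
  move=> Dab; have: rdvd q (a * w ^+ l) by rewrite Dab; exists (b * w ^+ k).
  by case/Hq=> // /ndvd.
split=> //; first exact: image_loc.
  move=> Dq; apply: (ndvd 0%N); rewrite expr0; apply: (dvdE 1 0%N).
  by rewrite rmorph1 expr0 divr1 mul1r.
have dvdL a k : rdvd q a -> loc_image (f a / f w ^+ k / f q).
  case=> b ->; rewrite rmorphM mulrAC mulfK //.
  apply: (sub_inM loc_image_subring); first exact: image_loc.
  by rewrite -exprVn; apply/(sub_inX loc_image_subring)/loc_image_inv.
move=> x y Dxy /loc_imageE[a [k Dx]] /loc_imageE[b [l Dy]].
move: Dxy; rewrite {}Dx {}Dy mulrACA -invfM -exprD -rmorphM => /dvdE/Hq[]=> /dvdL H.
  by left; apply: H.
by right; apply: H.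
Qed.

(** Prime factors that divide w become units and are absorbed into the unit part; the others stay
    prime. *)
Lemma loc_image_factorial : factorial_in loc_image.
Proof.
move=> x /loc_imageE[a [k ->]] x0.
have a0 : a != 0 by apply: contraNneq x0 => ->; rewrite rmorph0 mul0r.
have sL := loc_image_subring.
have uw : unit_in loc_image (f w).
  by split=> //; [exact: image_loc | exact: loc_image_inv].
suff [u [s [uu ps Da]]] : exists (u : E) (s : seq E),
    [/\ unit_in loc_image u, (forall q, q \in s -> prime_in loc_image q) &
        f a = u * \prod_(q <- s) q].
  exists (u / f w ^+ k), s; split=> //; last by rewrite Da mulrAC.
  by apply: (unit_in_div sL) => //; apply: (unit_in_exp sL (Posz k)).
have [u [s [uu ps ->]]] := facR a0; rewrite rmorphM.
elim: s ps => [|q s IHs] ps.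
  by exists (f u), [::]; split=> //; rewrite ?big_nil ?rmorph1 //; apply: unit_in_image.
have [|v [s' [uv ps' Ds]]] := IHs.
  by move=> b bs; apply: ps; rewrite inE bs orbT.
have pq : rprime q by apply: ps; rewrite mem_head.
rewrite big_cons rmorphM mulrCA Ds.
have [[b Dw]|nqw] := pselect (rdvd q w); last first.
  exists v, (f q :: s'); split=> //; last by rewrite big_cons mulrCA.
  by move=> y; rewrite inE => /orP[/eqP->|/ps'//]; apply: prime_in_image.
exists (f q * v), s'; split=> //; last by rewrite mulrA.
have fq0 : f q != 0 by rewrite -(rmorph0 f) (inj_eq inj_f); case: pq.
apply: (unit_inM sL) => //; split=> //; first exact: image_loc.
rewrite (_ : _^-1 = f b / f w).
  by apply: (sub_inM sL); [exact: image_loc | exact: loc_image_inv].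
by apply: (mulIf fq0); rewrite mulVf // mulrAC -rmorphM -Dw divff.
Qed.

End FactorialImage.

(** * Permutation lattices *)

Definition ieval (S : comNzRingType) (z : S) : {poly int} -> S :=
  horner_eval z \o map_poly intr.

HB.instance Definition _ (S : comNzRingType) (z : S) :=
  GRing.RMorphism.copy (@ieval S z) (horner_eval z \o map_poly intr).

Lemma ievalX (S : comNzRingType) (z : S) : ieval z 'X = z.
Proof. by rewrite /ieval /= map_polyX /horner_eval hornerX. Qed.

Lemma ievalC (S : comNzRingType) (z : S) c : ieval z c%:P = c%:~R.
Proof. by rewrite /ieval /= map_polyC /horner_eval hornerC. Qed.

Section PolynomialAction.
Variables (V : zmodType) (x : {additive V -> V}).
Implicit Types (e f : {poly int}) (u v : V).

(** The Z[X]-module structure on V in which ['X] acts as x. *)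
Definition zact (e : {poly int}) (v : V) : V :=
  \sum_(i < size e) iter i x v *~ e`_i.

Lemma zact_wide m e v : (size e <= m)%N ->
  zact e v = \sum_(i < m) iter i x v *~ e`_i.
Proof.
move=> le_em; rewrite /zact (big_ord_widen m (fun i => iter i x v *~ e`_i) le_em).
rewrite big_mkcond; apply: eq_bigr => i _; case: ltnP => // le_ei.
by rewrite nth_default ?mulr0z.
Qed.

Lemma iter_zmod_morphism i : zmod_morphism (iter i x).
Proof. by elim: i => // i IHi u v; rewrite /= IHi raddfB. Qed.

HB.instance Definition _ i :=
  GRing.isZmodMorphism.Build V V (iter i x) (iter_zmod_morphism i).

Lemma zact_is_zmod_morphism e : zmod_morphism (zact e).
Proof.
move=> u v; rewrite /zact -sumrB; apply: eq_bigr => i _.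
by rewrite raddfB /= mulrzBl.
Qed.

HB.instance Definition _ e :=
  GRing.isZmodMorphism.Build V V (zact e) (zact_is_zmod_morphism e).

Lemma zact0 v : zact 0 v = 0.
Proof. by rewrite /zact size_poly0 big_ord0. Qed.

Lemma zactD e f v : zact (e + f) v = zact e v + zact f v.
Proof.
pose m := maxn (size e) (size f).
rewrite (zact_wide (m := m) v (size_polyD _ _)).
rewrite (zact_wide (m := m) v (leq_maxl _ _)) (zact_wide (m := m) v (leq_maxr _ _)).
by rewrite -big_split; apply: eq_bigr => i _; rewrite coefD mulrzDr.
Qed.

Lemma zactB e f v : zact (e - f) v = zact e v - zact f v.
Proof. by apply/eqP; rewrite eq_sym subr_eq -zactD subrK. Qed.

Lemma zactC c v : zact c%:P v = v *~ c.
Proof.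
by rewrite (zact_wide v (size_polyC_leq1 c)) big_ord1 coefC.
Qed.

Lemma zactMX e v : zact (e * 'X) v = x (zact e v).
Proof.
have sz : (size (e * 'X)%R <= (size e).+1)%N.
  by have [->|e0] := eqVneq e 0; rewrite ?mul0r ?size_poly0 ?size_mulX.
rewrite (zact_wide v sz) big_ord_recl coefMX eqxx mulr0z add0r raddf_sum.
by apply: eq_bigr => i _; rewrite raddfMz coefMX.
Qed.

Lemma zactM e f v : zact (e * f) v = zact e (zact f v).
Proof.
elim/poly_ind: e => [|e c IHe]; first by rewrite mul0r !zact0.
rewrite mulrDl mulrAC !zactD !zactMX IHe; congr (_ + _).
rewrite zactC; elim/poly_ind: f {IHe} => [|f d IHf].
  by rewrite mulr0 !zact0 mul0rz.
rewrite mulrDr mulrA !zactD !zactMX IHf -polyCM !zactC mulrzDl -mulrzA mulrC.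
by rewrite raddfMz.
Qed.

Lemma zactXn k v : zact 'X^k v = iter k x v.
Proof.
elim: k => [|k IHk]; first by rewrite expr0 -[1]/(1%:P) zactC.
by rewrite exprSr zactMX IHk.
Qed.

End PolynomialAction.

Lemma zact_morph (V W : zmodType) (x : {additive V -> V}) (y : {additive W -> W})
    (f : {additive V -> W}) (e : {poly int}) v :
  (forall u, f (x u) = y (f u)) -> f (zact x e v) = zact y e (f v).
Proof.
move=> fx; rewrite raddf_sum; apply: eq_bigr => i _; rewrite raddfMz; congr (_ *~ _).
by elim: (i : nat) => //= k <-.
Qed.

Lemma zact_eval (V : zmodType) (x : {additive V -> V}) (S : comNzRingType) (z : S)
    (f : {additive V -> S}) (e : {poly int}) v :
  (forall u, f (x u) = z * f u) -> f (zact x e v) = ieval z e * f v.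
Proof.
move=> fx; elim/poly_ind: e => [|e c IHe]; first by rewrite zact0 rmorph0 mul0r raddf0.
rewrite zactD zactMX zactC raddfD /= fx IHe raddfMz rmorphD rmorphM /=.
by rewrite ievalX ievalC mulrDl mulrzl mulrCA mulrA.
Qed.

Section PermutationLattice.
Variables (r : nat) (s : {perm 'I_r}).
Local Notation P := {ffun 'I_r -> int}.
Implicit Types (v : P) (i : 'I_r).

Definition pshift v : P := [ffun i => v ((s^-1)%g i)].

Lemma pshift_is_zmod_morphism : zmod_morphism pshift.
Proof. by move=> u v; apply/ffunP => i; rewrite !ffunE. Qed.

HB.instance Definition _ := GRing.isZmodMorphism.Build P P pshift pshift_is_zmod_morphism.

Definition pdelta i : P := [ffun j => (j == i)%:R].

Lemma pshift_delta i : pshift (pdelta i) = pdelta (s i).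
Proof.
by apply/ffunP => j; rewrite !ffunE (can2_eq (permKV s) (permK s)).
Qed.

Lemma iter_pshift_delta k i : iter k pshift (pdelta i) = pdelta (iter k s i).
Proof. by elim: k => //= k ->; rewrite pshift_delta. Qed.

Lemma pdelta_sum v : v = \sum_i pdelta i *~ v i.
Proof.
apply/ffunP => j; rewrite sum_ffunE (bigD1 j) //= big1 => [|i /negPf ij].
  by rewrite ffunMzE ffunE eqxx intz addr0.
by rewrite ffunMzE ffunE eq_sym ij mul0rz.
Qed.

Lemma iter_pshift_order v : iter #[s]%g pshift v = v.
Proof.
suff H k : iter k pshift v = [ffun i => v ((s ^- k)%g i)].
  by apply/ffunP=> i; rewrite H ffunE expg_order invg1 perm1.
elim: k => [|k IHk]; first by apply/ffunP=> i; rewrite ffunE expg0 invg1 perm1.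
by apply/ffunP=> i; rewrite /= IHk !ffunE expgSr invMg permM.
Qed.

Let f : 'I_r -> 'I_r := s.
Let injf : injective f. Proof. exact: perm_inj. Qed.

(** Coordinates along the cycles of s: a canonical representative, the position counted from it, and
    the cycle length. *)
Definition orep i : 'I_r := froot f i.
Definition opos i : nat := findex f (orep i) i.
Definition olen i : nat := fingraph.order f i.

Lemma orep_connect i : fconnect f (orep i) i.
Proof. by rewrite fconnect_sym // connect_root. Qed.

Lemma iter_opos i : iter (opos i) f (orep i) = i.
Proof. exact/iter_findex/orep_connect. Qed.

Lemma orep_id i : orep (orep i) = orep i.
Proof. by rewrite /orep root_root //; apply: fconnect_sym. Qed.

Lemma orep_step i : orep (f i) = orep i.
Proof.
apply/esym/eqP; rewrite /orep (root_connect (fconnect_sym injf)); exact: fconnect1.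
Qed.

Lemma opos_rep i : orep i = i -> opos i = 0%N.
Proof. by rewrite /opos => ->; apply: findex0. Qed.

Lemma opos_step i :
  opos (f i) = (opos i).+1 \/
  [/\ opos (f i) = 0%N, (opos i).+1 = olen (orep i) & f i = orep i].
Proof.
have := findex_max (orep_connect i); rewrite -/(opos i) leq_eqVlt => /orP[/eqP e|lt].
  right; have fi : f i = orep i.
    by rewrite -{1}(iter_opos i) -iterS e; apply: iter_order.
  by split=> //; apply: opos_rep; rewrite !fi // orep_id.
left; rewrite /opos orep_step -{2}(iter_opos i) -iterS.
exact: findex_iter.
Qed.

Variable n : nat.

(** One index per cycle of length divisible by n: only these cycles carry functionals that the shift
    multiplies by a primitive n-th root of unity. *)
Definition full_rep i : bool := (orep i == i) && (n %| olen i)%N.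

(** The part of v supported on the cycle of i, read as an element of Z[X]/(X^L - 1), L being the
    cycle length. *)
Definition ocoord i v : {poly int} :=
  \sum_(j | orep j == i) v j *: 'X^(opos j).

Lemma ocoord_is_zmod_morphism i : zmod_morphism (ocoord i).
Proof.
move=> u v; rewrite /ocoord -sumrB; apply: eq_bigr => j _.
by rewrite !ffunE scalerBl.
Qed.

HB.instance Definition _ i :=
  GRing.isZmodMorphism.Build P {poly int} (ocoord i) (ocoord_is_zmod_morphism i).

Lemma ieval_ocoord (S : comNzRingType) (z : S) i v :
  ieval z (ocoord i v) = \sum_(j | orep j == i) (v j)%:~R * z ^+ opos j.
Proof.
rewrite rmorph_sum; apply: eq_bigr => j _.
by rewrite -mul_polyC rmorphM rmorphXn /= ievalC ievalX.
Qed.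

(** The only position that does not simply increase wraps around from the end of the cycle, which
    costs z^L = 1 because n divides the length L. *)
Lemma ocoord_shift (S : comNzRingType) (z : S) i v :
  z ^+ n = 1 -> full_rep i ->
  ieval z (ocoord i (pshift v)) = z * ieval z (ocoord i v).
Proof.
move=> zn /andP[/eqP ri /dvdnP[m Dm]].
rewrite !ieval_ocoord (reindex_inj (@perm_inj _ s)) mulr_sumr.
apply: eq_big => [j|j rj]; first by rewrite [orep _]orep_step.
rewrite ffunE permK mulrCA -exprS; congr (_ * _).
have [->//|[-> -> _]] := opos_step j.
by rewrite -orep_step (eqP rj) Dm mulnC exprM zn expr1n.
Qed.

Lemma ocoord_delta i j : orep j = j -> ocoord i (pdelta j) = (i == j)%:R.
Proof.
move=> rj; rewrite /ocoord; have [->|nij] := eqVneq i j.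
  rewrite (bigD1 j) ?rj //= ffunE eqxx opos_rep // expr0 scale1r.
  by rewrite big1 ?addr0 // => k /andP[_ /negPf kj]; rewrite ffunE kj scale0r.
rewrite big1 // => k /eqP rk; rewrite ffunE; case: eqP => [Dk|]; last by rewrite scale0r.
by rewrite -rk Dk rj eqxx in nij.
Qed.

(** On a cycle of length L the value at the representative is multiplied by z^L, so it vanishes
    unless n divides L; along the remaining cycles phi is determined by that value. *)
Lemma equivariant_expansion (z : algC) (phi : {additive P -> algC}) v :
    n.-primitive_root z -> (forall u, phi (pshift u) = z * phi u) ->
  phi v = \sum_(i | full_rep i) ieval z (ocoord i v) * phi (pdelta i).
Proof.
move=> prz phix.
have phiX k u : phi (iter k pshift u) = z ^+ k * phi u.
  by elim: k => [|k IHk]; rewrite ?mul1r // iterS phix IHk exprS mulrA.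
have phi0 i : ~~ (n %| olen i)%N -> phi (pdelta i) = 0.
  move=> nd; have := phiX (olen i) (pdelta i).
  rewrite iter_pshift_delta [iter _ _ _]iter_order // => /eqP.
  rewrite -subr_eq0 -{1}[phi _]mul1r -mulrBl mulf_eq0 subr_eq0 eq_sym.
  by rewrite -(prim_order_dvd prz) (negPf nd) => /eqP.
rewrite {1}(pdelta_sum v) raddf_sum.
rewrite (partition_big orep (fun i => orep i == i)) /= => [|i _]; last by rewrite orep_id.
rewrite /full_rep big_mkcondr /=; apply: eq_bigr => i /eqP ri.
have Dphi j : orep j == i -> phi (pdelta j *~ v j) = (v j)%:~R * z ^+ opos j * phi (pdelta i).
  move=> /eqP rj; rewrite raddfMz -{1}(iter_opos j) rj -iter_pshift_delta phiX.
  by rewrite -mulrzl mulrA.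
rewrite (eq_bigr _ Dphi) -mulr_suml -ieval_ocoord.
by case: ifPn => // /phi0->; rewrite mulr0.
Qed.

End PermutationLattice.

Lemma Xn_sub1_dvd d m : (d %| m)%N -> ('X^d - 1 : {poly int}) %| 'X^m - 1.
Proof. by case/dvdnP=> k ->; rewrite mulnC exprM (subrX1 'X^d) dvdp_mulr. Qed.

Lemma Xn_sub1_factor d (e : {poly int}) : (0 < d)%N ->
  'X^d - 1 %| e -> exists q, e = q * ('X^d - 1).
Proof.
by move=> d0; apply/Pdiv.IdomainMonic.dvdpP; apply: (monicXnsubC (1 : int) d0).
Qed.

Lemma Xn_sub1_neq0 d : (0 < d)%N -> ('X^d - 1 : {poly int}) != 0.
Proof. by move=> d0; rewrite -size_poly_gt0 (size_XnsubC (1 : int)). Qed.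

(* The vanishing of H^1(<x^m>, Z[x]/(x^n - 1)). *)
Lemma cyclic_coboundary (e : {poly int}) m M n :
    (0 < m)%N -> (0 < M)%N -> (0 < n)%N -> (n %| M)%N ->
    'X^n - 1 %| e * \sum_(i < M) 'X^m ^+ i ->
  exists f1 f2, e = ('X^m - 1) * f1 + ('X^n - 1) * f2.
Proof.
move=> m0 M0 n0 /dvdnP[tau DM] /(Xn_sub1_factor n0)[q Dq].
pose T : {poly int} := \sum_(i < tau * m) 'X^n ^+ i.
have DT : e * T = q * ('X^m - 1).
  apply: (mulIf (Xn_sub1_neq0 n0)); rewrite -mulrA [T * _]mulrC -subrX1 -exprM.
  rewrite mulrAC -Dq -mulrA [_ * ('X^m - 1)]mulrC -subrX1 -exprM DM.
  by congr (_ * ('X^_ - 1)); lia.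
(* Modulo X^d - 1 the sum T is the constant tau m, while e T is a multiple of X^m - 1;
   pseudo-divisibility by a monic polynomial lets the constant be dropped. *)
pose d := gcdn m n; have d0 : (0 < d)%N by rewrite gcdn_gt0 m0.
have de : 'X^d - 1 %| e.
  have tm0 : (tau * m)%:Z != 0.
    by rewrite eqz_nat -lt0n muln_gt0 m0 andbT; case: tau DM M0 {T DT} => // ->.
  rewrite -(dvdpZr _ _ tm0) -mul_polyC mulrC.
  have -> : (tau * m)%:Z%:P = T - \sum_(i < tau * m) ('X^n ^+ i - 1) :> {poly int}.
    rewrite sumrB opprB addrCA subrr addr0 sumr_const card_ord.
    by rewrite -[X in X%:P]natz rmorph_nat.
  rewrite mulrBr dvdp_sub //.
    by rewrite DT dvdp_mull // Xn_sub1_dvd // dvdn_gcdl.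
  rewrite dvdp_mull //; elim/big_ind: _ => [|x y|i _]; first exact: dvdp0.
    exact: dvdp_add.
  by rewrite -exprM Xn_sub1_dvd // dvdn_mulr // dvdn_gcdr.
have [q' ->] := Xn_sub1_factor d0 de.
(* Bezout in the exponents writes X^d - 1 as a combination of X^m - 1 and X^n - 1. *)
have [a b Dab _] := egcdnP n m0.
have -> : 'X^d - 1 = ('X^m ^+ a - 1) - 'X^d * ('X^n ^+ b - 1) :> {poly int}.
  rewrite -!exprM [(m * a)%N]mulnC Dab exprD [(b * n)%N]mulnC -/d.
  by move: ('X^(n * b)) ('X^d) => x y; ring.
rewrite (subrX1 'X^m) (subrX1 'X^n).
move: ('X^m - 1) ('X^n - 1) (\sum_(i < a) _) (\sum_(i < b) _) 'X^d => x y A B X.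
by exists (A * q'), (- (X * B * q')); ring.
Qed.

Lemma pmulrn_inj r p (u v : {ffun 'I_r -> int}) : (0 < p)%N -> u *+ p = v *+ p -> u = v.
Proof.
move=> p0 /ffunP uv; apply/ffunP => i; have := uv i; rewrite !ffunMnE.
exact: pmulrnI.
Qed.

(** Here a = det B and D = det A. The sizes agree only by a proved equation, so the determinants are
    hidden behind existentials to keep casts out of the statement. *)
Lemma rect_det_certificate m k (A : 'M[{poly int}]_(m, k)) (B : 'M[{poly int}]_(k, m)) :
  k = m -> exists a D : {poly int}, [/\ a * D = \det (A *m B),
    forall (S : comNzRingType) (h : {rmorphism {poly int} -> S}),
      (exists j, forall i, h (B i j) = 0) -> h a = 0 &
    forall (S : comNzRingType) (h : {rmorphism {poly int} -> S}),
      (exists i, forall j, h (A i j) = 0) -> h D = 0].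
Proof.
move=> km; case: m / km in A B *; exists (\det B), (\det A).
split=> [|S h [j hB]|S h [i hA]]; first by rewrite det_mulmx mulrC.
  rewrite -det_map_mx (expand_det_col _ j) big1 // => i _.
  by rewrite mxE hB mul0r.
rewrite -det_map_mx (expand_det_row _ i) big1 // => j _.
by rewrite mxE hA mul0r.
Qed.

(** * Splitting the lattice sequence and taking determinants; J plays the role of p in the ideal (p,
    X - c), identified with the kernel of rho by u p = e J *)

Section Certificate.
Variables (p n : nat) (F : fieldType) (z0 : F) (c : int) (zeta : algC).
Hypotheses (p_gt0 : (0 < p)%N) (pF : p%:R = 0 :> F).
Hypotheses (prz0 : n.-primitive_root z0) (Dz0 : c%:~R = z0).
Hypothesis (prz : n.-primitive_root zeta).
Variables (r1 r2 : nat) (s1 : {perm 'I_r1}) (s2 : {perm 'I_r2}).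
Local Notation P1 := {ffun 'I_r1 -> int}.
Local Notation P2 := {ffun 'I_r2 -> int}.
Local Notation act1 := (zact (pshift s1)).
Local Notation act2 := (zact (pshift s2)).
Variables (rho : {additive P1 -> P2}) (J : P1).
Hypothesis rho_shift : forall v, rho (pshift s1 v) = pshift s2 (rho v).
Hypothesis rho_surj : forall w, exists v, rho v = w.
Hypothesis rho_ker : forall u, rho u = 0 ->
  exists2 e, ieval z0 e = 0 & u *+ p = act1 e J.
Hypothesis J_div : forall e, ieval z0 e = 0 -> exists u, act1 e J = u *+ p.
Hypothesis J_ann : forall e, act1 e J = 0 <-> 'X^n - 1 %| e.
Hypothesis rhoJ : rho J = 0.

Let n_gt0 : (0 < n)%N. Proof. exact: prim_order_gt0 prz. Qed.

Lemma ieval_Xn_sub1 (S : comNzRingType) (z : S) e :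
  z ^+ n = 1 -> 'X^n - 1 %| e -> ieval z e = 0.
Proof.
move=> zn /(Xn_sub1_factor n_gt0)[q ->].
by rewrite rmorphM rmorphB rmorph1 rmorphXn /= ievalX zn subrr mulr0.
Qed.

Lemma rho_iter m v : rho (iter m (pshift s1) v) = iter m (pshift s2) (rho v).
Proof. by elim: m => //= m <-. Qed.

(** The obstruction to a lift fixed by the m-th power of the shift, m being the cycle length of w,
    is a cocycle with values in the ideal; [cyclic_coboundary] trivialises it. *)
Lemma invariant_lift w :
  exists2 u, rho u = pdelta w & iter (olen s2 w) (pshift s1) u = u.
Proof.
pose m := olen s2 w; have m0 : (0 < m)%N by apply: fingraph.order_gt0.
have [u Du] := rho_surj (pdelta w).
pose del := iter m (pshift s1) u - u.
have rdel : rho del = 0.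
  rewrite raddfB rho_iter Du iter_pshift_delta [iter _ _ _]iter_order ?subrr //.
  exact: perm_inj.
have [e e0 De] := rho_ker rdel.
(* The order of s1 makes the sum of M shifted copies of [del] telescope to 0; the factor n is what
   [cyclic_coboundary] asks for. *)
pose M := (#[s1]%g * n)%N.
have M0 : (0 < M)%N by rewrite muln_gt0 n_gt0 order_gt0.
have /J_ann eG : act1 (e * \sum_(i < M) 'X^m ^+ i) J = 0.
  rewrite mulrC zactM -De raddfMn /=.
  suff -> : act1 (\sum_(i < M) 'X^m ^+ i) del = 0 by rewrite mul0rn.
  have -> : del = act1 ('X^m - 1) u by rewrite zactB zactXn -[1]/('X^0) zactXn.
  rewrite -zactM mulrC -subrX1 -exprM.
  rewrite zactB zactXn -[1]/('X^0) zactXn /= /M mulnCA mulnC iterM.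
  rewrite (_ : iter _ _ u = u) ?subrr //.
  by elim: (m * n)%N => //= k ->; apply: iter_pshift_order.
have [f1 [f2 Df]] := cyclic_coboundary m0 M0 n_gt0 (dvdn_mull _ (dvdnn n)) eG.
have De1 : act1 e J = act1 (('X^m - 1) * f1) J.
  rewrite Df zactD [X in _ + X](_ : _ = 0) ?addr0 //.
  by apply/J_ann; rewrite dvdp_mulr.
have [nm|nm] := boolP (n %| m)%N.
  have del0 : del = 0.
    apply: (pmulrn_inj p_gt0); rewrite De De1 mul0rn; apply/J_ann.
    by rewrite dvdp_mulr // Xn_sub1_dvd.
  by exists u => //; apply/eqP; rewrite -subr_eq0 -/m -/del del0.
(* Since z0^m is not 1, e(z0) = 0 forces f1(z0) = 0. So f1 J / p is a kernel vector k with
   coboundary [del], and u - k is invariant. *)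
have f10 : ieval z0 f1 = 0.
  have := e0; rewrite Df rmorphD !rmorphM /= (ieval_Xn_sub1 (prim_expr_order prz0) (dvdpp _)).
  rewrite mul0r addr0 rmorphB rmorph1 rmorphXn /= ievalX => /eqP.
  by rewrite mulf_eq0 subr_eq0 -(prim_order_dvd prz0) (negPf nm) => /eqP.
have [k Dk] := J_div f10.
have rk : rho k = 0.
  apply: (pmulrn_inj p_gt0); rewrite -raddfMn -Dk mul0rn.
  by rewrite (zact_morph (y := pshift s2)) // rhoJ raddf0.
exists (u - k); first by rewrite raddfB Du /= rk subr0.
have Ek : iter m (pshift s1) k = iter m (pshift s1) u - u + k.
  apply/eqP; rewrite -subr_eq; apply/eqP/(pmulrn_inj p_gt0).
  rewrite -/del De De1 zactM Dk raddfMn /=; congr (_ *+ _).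
  by rewrite zactB zactXn -[1]/('X^0) zactXn.
by rewrite raddfB /= -/m Ek opprD opprB addrA addrCA subrr addr0.
Qed.

(** Lifts are chosen at cycle representatives and transported by the shift; invariance under the
    full cycle makes the last step close up. *)
Lemma equivariant_lift : exists u : 'I_r2 -> P1,
  (forall i, rho (u i) = pdelta i) /\ (forall i, pshift s1 (u i) = u (s2 i)).
Proof.
have /choice[u0 Hu0] w : exists u, rho u = pdelta w /\ iter (olen s2 w) (pshift s1) u = u.
  by have [u] := invariant_lift w; exists u.
exists (fun i => iter (opos s2 i) (pshift s1) (u0 (orep s2 i))); split=> i.
  by rewrite rho_iter (Hu0 _).1 iter_pshift_delta [iter _ _ _]iter_opos.
rewrite -iterS [orep s2 (s2 i)]orep_step; have [->//|[-> -> _]] := opos_step s2 i.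
by rewrite (Hu0 _).2.
Qed.

Theorem lattice_certificate : exists a D : {poly int},
  [/\ ieval zeta (a * D) = p%:R, ieval z0 a = 0 &
      forall z : F, z ^+ n = 1 -> z != z0 -> ieval z D = 0].
Proof.
have [u [rhou ushift]] := equivariant_lift.
have zn : zeta ^+ n = 1 by apply: prim_expr_order.
pose sigma (w : P2) : P1 := \sum_i u i *~ w i.
have sigB : zmod_morphism sigma.
  by move=> v w; rewrite -sumrB; apply: eq_bigr => i _; rewrite !ffunE mulrzBr.
have sigS w : sigma (pshift s2 w) = pshift s1 (sigma w).
  rewrite /sigma raddf_sum (reindex_inj (@perm_inj _ s2)); apply: eq_bigr => i _.
  by rewrite raddfMz /= ffunE permK ushift.
have rhosig w : rho (sigma w) = w.
  rewrite raddf_sum [RHS]pdelta_sum; apply: eq_bigr => i _.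
  by rewrite raddfMz rhou.
have sigdelta i : sigma (pdelta i) = u i.
  rewrite /sigma (bigD1 i) //= ffunE eqxx big1 ?addr0 // => j /negPf ji.
  by rewrite ffunE ji mulr0z.
(* The kernel component of v as an ideal element. The polynomial e v is a mere choice, but it is
   determined modulo X^n - 1, so its value at zeta is additive and equivariant in v. *)
have /choice[e He] v : exists e, ieval z0 e = 0 /\ (v - sigma (rho v)) *+ p = act1 e J.
  have [|e] := @rho_ker (v - sigma (rho v)); first by rewrite raddfB /= rhosig subrr.
  by exists e.
pose E v := ieval zeta (e v).
have eqE e1 e2 : act1 e1 J = act1 e2 J -> ieval zeta e1 = ieval zeta e2.
  move=> e12; apply/eqP; rewrite -subr_eq0 -rmorphB /=; apply/eqP.
  by apply: ieval_Xn_sub1 => //; apply/J_ann; rewrite zactB e12 subrr.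
have EB : zmod_morphism E.
  move=> v w; rewrite /E -rmorphB; apply: eqE.
  rewrite zactB -!(He _).2 -mulrnBl raddfB sigB; congr (_ *+ _).
  by rewrite !opprB addrACA [RHS]addrACA [- w - _]addrC.
have ES v : E (pshift s1 v) = zeta * E v.
  have -> : zeta * E v = ieval zeta (e v * 'X) by rewrite rmorphM /= ievalX mulrC.
  apply: eqE.
  by rewrite zactMX -!(He _).2 rho_shift sigS -raddfB /= raddfMn.
pose Em : {additive P1 -> algC} := HB.pack_for {additive P1 -> algC} E
  (GRing.isZmodMorphism.Build P1 algC E EB).
have EJ : E J = p%:R.
  rewrite -[RHS](ievalC zeta p%:Z); apply: eqE; rewrite -(He _).2 zactC rhoJ.
  by have := sigB 0 0; rewrite !subrr => ->; rewrite subr0.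
pose K := [pred k | full_rep s1 n k]; pose W := [pred w | full_rep s2 n w].
pose kk (i : 'I_#|K|) : 'I_r1 := enum_val i.
pose ww (i : 'I_#|W|) : 'I_r2 := enum_val i.
have fk i : full_rep s1 n (kk i) by have := enum_valP i.
have fw i : full_rep s2 n (ww i) by have := enum_valP i.
have rk i : orep s1 (kk i) = kk i by have /andP[/eqP] := fk i.
have rw i : orep s2 (ww i) = ww i by have /andP[/eqP] := fw i.
have exp1 (phi : {additive P1 -> algC}) v : (forall u, phi (pshift s1 u) = zeta * phi u) ->
    phi v = \sum_i ieval zeta (ocoord s1 (kk i) v) * phi (pdelta (kk i)).
  move=> phiS; rewrite (equivariant_expansion v prz phiS).
  rewrite -(big_enum_val (A := K) (fun k => ieval zeta (ocoord s1 k v) * phi (pdelta k))).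
  exact: eq_bigl.
have exp2 (phi : {additive P2 -> algC}) v : (forall u, phi (pshift s2 u) = zeta * phi u) ->
    phi v = \sum_i ieval zeta (ocoord s2 (ww i) v) * phi (pdelta (ww i)).
  move=> phiS; rewrite (equivariant_expansion v prz phiS).
  rewrite -(big_enum_val (A := W) (fun k => ieval zeta (ocoord s2 k v) * phi (pdelta k))).
  exact: eq_bigl.
(* At zeta only the full cycles count: A writes J and the lifts of the basis of P2 in the basis of
   P1, and B records the kernel component and the image under rho of the basis of P1. *)
pose A : 'M[{poly int}]_(1 + #|W|, #|K|) :=
  col_mx (\row_k ocoord s1 (kk k) J) (\matrix_(w, k) ocoord s1 (kk k) (u (ww w))).
pose B : 'M[{poly int}]_(#|K|, 1 + #|W|) :=
  row_mx (\col_k e (pdelta (kk k)))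
    (\matrix_(k, w) ocoord s2 (ww w) (rho (pdelta (kk k)))).
have tau w : exists phi : {additive P1 -> algC},
    phi =1 (fun v => ieval zeta (ocoord s2 (ww w) (rho v))).
  by exists (ieval zeta \o ocoord s2 (ww w) \o rho).
have tauE w v : ieval zeta (ocoord s2 (ww w) (rho v)) =
    \sum_i ieval zeta (ocoord s1 (kk i) v) *
      ieval zeta (ocoord s2 (ww w) (rho (pdelta (kk i)))).
  have [phi Dphi] := tau w; rewrite -Dphi (exp1 phi) => [|x].
    by apply: eq_bigr => i _; rewrite Dphi.
  by rewrite !Dphi rho_shift (ocoord_shift _ zn (fw w)).
have AB : map_mx (ieval zeta) (A *m B) = block_mx (p%:R)%:M 0 0 1%:M.
  rewrite mul_col_row map_block_mx; congr block_mx; apply/matrixP => i j;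
    rewrite !mxE rmorph_sum; under eq_bigr do rewrite !mxE rmorphM /=.
  - rewrite (ord1 i) (ord1 j) eqxx -(exp1 Em J ES); exact: EJ.
  - by rewrite -tauE rhoJ raddf0 rmorph0.
  - rewrite -(exp1 Em (u (ww i)) ES) /= /E; rewrite -[RHS](rmorph0 (ieval zeta)).
    apply: eqE; rewrite zact0 -(He _).2 rhou sigdelta subrr mul0rn //.
  by rewrite -tauE rhou ocoord_delta // rmorph_nat (inj_eq enum_val_inj) eq_sym.
(* This is p v = e(v) J + p sigma(rho(v)) in coordinates. With AB it bounds ranks from both sides,
   so A and B are square. *)
have BA : map_mx (ieval zeta) B *m block_mx 1%:M 0 0 (p%:R)%:M *m map_mx (ieval zeta) A
    = (p%:R)%:M.
  rewrite map_row_mx map_col_mx mul_row_block mul_row_col !mulmx0 addr0 add0r.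
  rewrite mulmx1 mul_mx_scalar -scalemxAl; apply/matrixP => i j; rewrite !mxE big_ord1 !mxE.
  have [phi Dphi] : exists phi : {additive P1 -> algC},
      phi =1 (fun v => ieval zeta (ocoord s1 (kk j) v)).
    by exists (ieval zeta \o ocoord s1 (kk j)).
  have phiS x : phi (pshift s1 x) = zeta * phi x by rewrite !Dphi (ocoord_shift _ zn (fk j)).
  have [psi Dpsi] : exists psi : {additive P2 -> algC}, psi =1 phi \o sigma.
    have H : zmod_morphism (phi \o sigma) by move=> v w; rewrite /= sigB raddfB.
    by exists (HB.pack_for {additive P2 -> algC} (phi \o sigma)
      (GRing.isZmodMorphism.Build P2 algC _ H)).
  have psiS x : psi (pshift s2 x) = zeta * psi x by rewrite !Dpsi /= sigS phiS.
  have := congr1 phi (He (pdelta (kk i))).2.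
  rewrite (zact_eval _ _ phiS) raddfMn raddfB /= -[phi (sigma _)]/((phi \o sigma) _) -Dpsi.
  rewrite (exp2 psi) // => H.
  have -> : (p%:R *+ (i == j) : algC) = phi (pdelta (kk i)) *+ p.
    rewrite Dphi ocoord_delta // rmorph_nat (inj_eq enum_val_inj) eq_sym.
    by rewrite -mulrnA mulnC mulrnA.
  rewrite -[in RHS](subrK (\sum_i0 ieval zeta (ocoord s2 (ww i0) (rho (pdelta (kk i))))
    * psi (pdelta (ww i0))) (phi (pdelta (kk i)))) mulrnDl H Dphi; congr (_ + _).
  rewrite mulr_natl; congr (_ *+ _); apply: eq_bigr => w _.
  by rewrite !mxE Dpsi /= sigdelta Dphi.
have p0 : (p%:R : algC) != 0 by rewrite pnatr_eq0 -lt0n.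
have KW : #|K| = (1 + #|W|)%N.
  apply/eqP; rewrite eqn_leq; apply/andP; split.
    have := mxrankM_maxl (map_mx (ieval zeta) B *m block_mx 1%:M 0 0 (p%:R)%:M)
       (map_mx (ieval zeta) A).
    rewrite BA mxrank_unit ?unitmxE ?det_scalar ?unitfE ?expf_neq0 //.
    by move=> /leq_trans; apply; exact: rank_leq_col.
  have := mxrankM_maxl (map_mx (ieval zeta) A) (map_mx (ieval zeta) B).
  rewrite -map_mxM AB mxrank_unit.
    by move=> /leq_trans; apply; exact: rank_leq_col.
  by rewrite unitmxE det_ublock det_scalar1 det1 mulr1 unitfE.
have [a [D [aD aP DP]]] := rect_det_certificate A B KW.
exists a, D; split.
- by rewrite aD -det_map_mx AB det_ublock det_scalar1 det1 mulr1.
(* The first column of B consists of elements of the ideal, which vanish at z0. *)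
- apply: (aP _ (ieval z0)); exists (lshift _ ord0) => i.
  by rewrite row_mxEl mxE /= (He _).1.
move=> z zn1 zz0; apply: (DP _ (ieval z)); exists (lshift _ ord0) => k.
(* X - c lies in the ideal, so (X - c) J is p times a vector; a coordinate of J at z is thus killed
   by z - z0, and the first row of A vanishes. *)
rewrite col_mxEu mxE /=; have [v Dv] : exists v, act1 ('X - c%:P) J = v *+ p.
  by apply: J_div; rewrite rmorphB /= ievalX ievalC Dz0 subrr.
have := congr1 (fun v => ieval z (ocoord s1 (kk k) v)) Dv.
rewrite zactB zactC -{1}['X]expr1 zactXn /= raddfB raddfMz raddfMn /=.
rewrite rmorphB rmorphMz rmorphMn /= (ocoord_shift _ zn1 (fk k)) -mulr_natl pF mul0r.
rewrite -mulrzl Dz0 -mulrBl => /eqP.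
by rewrite mulf_eq0 subr_eq0 (negPf zz0) => /eqP.
Qed.

End Certificate.

(** * Units of a common localisation *)

Section MultiplicativeAction.
Variables (E : fieldType) (g : {rmorphism E -> E}).
Implicit Types (e : {poly int}) (x y : E).

(** The multiplicative form of [zact]: the power x^e with e in Z[g], acting on nonzero elements of
    E. *)
Definition mact e x : E := \prod_(i < size e) iter i g x ^ e`_i.

Lemma iter_rmorphM i x y : iter i g (x * y) = iter i g x * iter i g y.
Proof. by elim: i => //= i ->; rewrite rmorphM. Qed.

Lemma iter_rmorphV i x : iter i g x^-1 = (iter i g x)^-1.
Proof. by elim: i => //= i ->; rewrite fmorphV. Qed.

Lemma iter_rmorph_eq0 i x : (iter i g x == 0) = (x == 0).
Proof. by elim: i => //= i <-; rewrite fmorph_eq0. Qed.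

Lemma mact_wide m e x : (size e <= m)%N -> mact e x = \prod_(i < m) iter i g x ^ e`_i.
Proof.
move=> le_em; rewrite /mact (big_ord_widen m (fun i => iter i g x ^ e`_i) le_em).
rewrite big_mkcond; apply: eq_bigr => i _; case: ltnP => // le_ei.
by rewrite nth_default ?expr0z.
Qed.

Lemma mactC c x : mact c%:P x = x ^ c.
Proof. by rewrite (mact_wide x (size_polyC_leq1 c)) big_ord1 coefC. Qed.

Lemma mactM e x y : mact e (x * y) = mact e x * mact e y.
Proof.
by rewrite -big_split; apply: eq_bigr => i _; rewrite iter_rmorphM expfzMl.
Qed.

Lemma mactV e x : mact e x^-1 = (mact e x)^-1.
Proof.
rewrite /mact -prodfV; apply: eq_bigr => i _.
by rewrite iter_rmorphV exprz_inv invr_expz.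
Qed.

Lemma mact_neq0 e x : x != 0 -> mact e x != 0.
Proof.
by move=> x0; apply/prodf_neq0 => i _; rewrite expfz_neq0 ?iter_rmorph_eq0.
Qed.

Lemma mactX e x k : mact e (x ^+ k) = mact e x ^+ k.
Proof.
elim: k => [|k IHk]; last by rewrite !exprS mactM IHk.
rewrite /mact big1 // => i _; rewrite (_ : iter i g 1 = 1) ?exp1rz //.
by elim: (i : nat) => //= j ->; rewrite rmorph1.
Qed.

Lemma mact_scale e x (k : int) : mact (k *: e) x = mact e x ^ k.
Proof.
rewrite (mact_wide x (size_scale_leq _ _)).
rewrite [RHS](big_morph (fun y => y ^ k) (fun y z => expfzMl y z k) (exp1rz E k)).
by apply: eq_bigr => i _; rewrite coefZ mulrC -exprz_exp.
Qed.

Lemma mactD e1 e2 x : x != 0 -> mact (e1 + e2) x = mact e1 x * mact e2 x.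
Proof.
move=> x0; pose m := maxn (size e1) (size e2).
rewrite (mact_wide (m := m) x (size_polyD _ _)).
rewrite (mact_wide (m := m) x (leq_maxl _ _)) (mact_wide (m := m) x (leq_maxr _ _)).
rewrite -big_split; apply: eq_bigr => i _.
by rewrite coefD expfzDr // iter_rmorph_eq0.
Qed.

Lemma mact0 x : mact 0 x = 1.
Proof. by rewrite /mact size_poly0 big_ord0. Qed.

Lemma mactN e x : x != 0 -> mact (- e) x = (mact e x)^-1.
Proof.
move=> x0; apply: (mulIf (mact_neq0 e x0)).
by rewrite -mactD // addNr mact0 mulVf // mact_neq0.
Qed.

Lemma mactMX e x : mact (e * 'X) x = g (mact e x).
Proof.
have sz : (size (e * 'X)%R <= (size e).+1)%N.
  by have [->|e0] := eqVneq e 0; rewrite ?mul0r ?size_poly0 ?size_mulX.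
rewrite (mact_wide x sz) big_ord_recl coefMX eqxx expr0z mul1r rmorph_prod.
by apply: eq_bigr => i _; rewrite fmorphXz coefMX.
Qed.

Lemma mactMXn e x k : mact (e * 'X^k) x = iter k g (mact e x).
Proof. by elim: k => [|k IHk]; rewrite ?mulr1 // exprSr mulrA mactMX IHk. Qed.

Lemma mactXn x k : mact 'X^k x = iter k g x.
Proof. by rewrite -[X in mact X]mul1r mactMXn -[1]/(1%:P) mactC expr1z. Qed.

Lemma mact_iter e x k : mact e (iter k g x) = iter k g (mact e x).
Proof.
elim: k => //= k <-; rewrite rmorph_prod; apply: eq_bigr => i _.
by rewrite fmorphXz -iterS -iterSr.
Qed.

End MultiplicativeAction.

Section TwoRings.
Variables (p n : nat) (F : fieldType) (z0 : F) (c : int) (zeta : algC).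
Hypotheses (p_gt0 : (0 < p)%N) (pF : p%:R = 0 :> F).
Hypotheses (prz0 : n.-primitive_root z0) (Dz0 : c%:~R = z0).
Hypothesis (prz : n.-primitive_root zeta).
Variables (E : fieldType) (g g' : {rmorphism E -> E}) (D1 D2 : E -> Prop) (s t z1 : E).
Hypotheses (gK : cancel g g') (g'K : cancel g' g).
Hypotheses (sD1 : is_subring D1) (sD2 : is_subring D2).
Hypotheses (fD1 : factorial_in D1) (fD2 : factorial_in D2).
Hypotheses (gD1 : forall x, D1 x -> D1 (g x)) (gD1' : forall x, D1 x -> D1 (g' x)).
Hypotheses (gD2 : forall x, D2 x -> D2 (g x)) (gD2' : forall x, D2 x -> D2 (g' x)).
Hypotheses (D1t : D1 t) (t0 : t != 0) (gt : g t = t).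
Hypotheses (D2s : D2 s) (s0 : s != 0) (gs : g s = s).
Hypothesis loc12 : forall x, loc D1 t x <-> loc D2 s x.
Hypothesis unit12 : forall x, unit_in D1 x -> unit_in D2 x.
Hypothesis z10 : z1 != 0.
Hypothesis unit2 : forall f, unit_in D2 f ->
  exists2 e, ieval z0 e = 0 & unit_in D1 (f / mact g e z1).
Hypothesis mact2 : forall e, ieval z0 e = 0 -> unit_in D2 (mact g e z1).
Hypothesis mact1 : forall e, unit_in D1 (mact g e z1) <-> 'X^n - 1 %| e.

(** Both prime lattices describe the units of the common localisation, modulo units of D1 and of D2
    respectively. As units of D1 are units of D2, one lattice maps onto the other, with kernel the
    D2-units modulo D1-units. *)
Theorem two_ring_certificate : exists a D : {poly int},
  [/\ ieval zeta (a * D) = p%:R, ieval z0 a = 0 &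
      forall z : F, z ^+ n = 1 -> z != z0 -> ieval z D = 0].
Proof.
have gl1 x : loc D1 t x -> loc D1 t (g x).
  by case=> k Dx; exists k; rewrite -gt -rmorphXn -rmorphM; apply: gD1.
have gl2 x : loc D2 s x -> loc D2 s (g x).
  by case=> k Dx; exists k; rewrite -gs -rmorphXn -rmorphM; apply: gD2.
have [r1 [P1 [s1 [P10 U1 F1 G1]]]] := prime_family sD1 fD1 D1t t0 gK g'K gD1 gD1' gl1.
have [r2 [P2 [s2 [P20 U2 F2 G2]]]] := prime_family sD2 fD2 D2s s0 gK g'K gD2 gD2' gl2.
have L10 v : lmon P1 v != 0 by apply: lmon_neq0.
have L20 v : lmon P2 v != 0 by apply: lmon_neq0.
have UU x : unit_in (loc D1 t) x <-> unit_in (loc D2 s) x.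
  by split=> -[x0 ? ?]; split=> //; apply/loc12.
have tr1 := unit_in_trans sD1; have tr2 := unit_in_trans sD2.
have uD1 x : unit_in D1 x -> unit_in (loc D1 t) x.
  by case=> x0 Dx Dx'; split=> //; apply: sub_loc.
have uD2 x : unit_in D2 x -> unit_in (loc D1 t) x.
  by case=> x0 Dx Dx'; apply/UU; split=> //; apply: sub_loc.
have refl1 x : x != 0 -> unit_in D1 (x / x) by move=> x0; rewrite divff //; apply: unit_in1.
have refl2 x : x != 0 -> unit_in D2 (x / x) by move=> x0; rewrite divff //; apply: unit_in1.
have inj1 v w : unit_in D1 (lmon P1 v / lmon P1 w) -> v = w.
  by rewrite -lmonN // -lmonD // => /F1/eqP; rewrite subr_eq0 => /eqP.
have inj2 v w : unit_in D2 (lmon P2 v / lmon P2 w) -> v = w.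
  by rewrite -lmonN // -lmonD // => /F2/eqP; rewrite subr_eq0 => /eqP.
have unitg1 x : unit_in D1 x -> unit_in D1 (g x).
  by case=> x0 Dx Dx'; split; rewrite ?fmorph_eq0 -?fmorphV //; apply: gD1.
have unitg2 x : unit_in D2 x -> unit_in D2 (g x).
  by case=> x0 Dx Dx'; split; rewrite ?fmorph_eq0 -?fmorphV //; apply: gD2.
have shiftE D r (P : 'I_r -> E) (s' : {perm 'I_r}) : is_subring D ->
    (forall i, P i != 0) -> (forall i, unit_in D (g (P i) / P (s' i))) ->
    forall v, unit_in D (g (lmon P v) / lmon P (pshift s' v)).
  move=> sD P0 GP v; rewrite /lmon [X in _ / X](reindex_inj (@perm_inj _ s')) rmorph_prod.
  rewrite -prodfV -big_split; apply: (unit_in_prod sD) => i _ /=.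
  by rewrite ffunE permK fmorphXz invr_expz -exprz_inv -expfzMl; apply: (unit_in_exp sD).
have {}shift1 := shiftE D1 r1 P1 s1 sD1 P10 G1.
have {}shift2 := shiftE D2 r2 P2 s2 sD2 P20 G2.
have /choice[rho0 Hrho] v : exists w, unit_in D2 (lmon P1 v / lmon P2 w).
  by apply/U2/UU/U1; exists v; apply: refl1.
have rhoP v w : unit_in D2 (lmon P1 v / lmon P2 w) -> rho0 v = w.
  by move=> H; apply: inj2; apply: (tr2 (lmon P1 v)) => //; apply/unit_inVC.
have rhoB : zmod_morphism rho0.
  move=> v w; apply: rhoP; rewrite !lmonD // !lmonN // invfM invrK mulrACA.
  rewrite -[(lmon P1 w)^-1 * _]mulrC; apply: (unit_inM sD2) => //.
  exact/unit_inVC.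
pose rho : {additive {ffun 'I_r1 -> int} -> {ffun 'I_r2 -> int}} :=
  HB.pack_for {additive {ffun 'I_r1 -> int} -> {ffun 'I_r2 -> int}} rho0
    (GRing.isZmodMorphism.Build _ _ rho0 rhoB).
have rho_shift v : rho (pshift s1 v) = pshift s2 (rho v).
  apply: rhoP; apply: (tr2 (g (lmon P1 v))); first by rewrite fmorph_eq0.
    exact/unit12/unit_inVC.
  apply: (tr2 (g (lmon P2 (rho v)))); rewrite ?fmorph_eq0 //.
  by rewrite -fmorph_div; apply/unitg2/Hrho.
have rho_surj w : exists v, rho v = w.
  have /U1[v Hv] : unit_in (loc D1 t) (lmon P2 w).
    by apply/UU/U2; exists w; apply: refl2.
  by exists v; apply: rhoP; apply/unit_inVC/unit12.
(* [z1] need not be a unit, but z1^p is, since the constant p vanishes at z0; J is its exponent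
   vector in the primes of D1. *)
have z1p2 : unit_in D2 (z1 ^+ p).
  rewrite -[_ ^+ _](mactC g p%:Z); apply: mact2.
  by rewrite ievalC.
have /U1[J HJ] := uD2 _ z1p2.
have z1p0 : z1 ^+ p != 0 by rewrite expf_neq0.
have iter1 i v : unit_in D1 (iter i g (lmon P1 v) / lmon P1 (iter i (pshift s1) v)).
  elim: i => [|i IHi] /=; first exact: refl1.
  apply: (tr1 (g (lmon P1 (iter i (pshift s1) v)))); rewrite ?fmorph_eq0 //.
  by rewrite -fmorph_div; apply: unitg1.
have lmonz v (k : int) : lmon P1 (v *~ k) = lmon P1 v ^ k.
  rewrite [RHS](big_morph (fun x => x ^ k) (fun x y => expfzMl x y k) (exp1rz E k)).
  by apply: eq_bigr => i _; rewrite ffunMzE -mulrzr intz exprz_exp.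
have lmons m (V : 'I_m -> {ffun 'I_r1 -> int}) :
    lmon P1 (\sum_i V i) = \prod_i lmon P1 (V i).
  by apply: (big_morph (lmon P1)) => [v w|]; rewrite ?lmonD ?lmon0.
have macteq e x y : y != 0 -> unit_in D1 (x / y) -> unit_in D1 (mact g e x / mact g e y).
  move=> y0 uxy; rewrite -mactV -mactM; apply: (unit_in_prod sD1) => i _.
  apply: (unit_in_exp sD1); elim: (i : nat) => //= j IHj; exact: unitg1.
have actE e v : unit_in D1 (lmon P1 (zact (pshift s1) e v) / mact g e (lmon P1 v)).
  rewrite /zact lmons /mact -prodfV -big_split; apply: (unit_in_prod sD1) => i _ /=.
  rewrite lmonz invr_expz -exprz_inv -expfzMl; apply: (unit_in_exp sD1).
  exact/unit_inVC.
have actJ e : unit_in D1 (lmon P1 (zact (pshift s1) e J) / mact g e z1 ^+ p).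
  apply: tr1 (actE e J) _; first exact: mact_neq0.
  by rewrite -mactX; apply: macteq => //; apply/unit_inVC.
have expU e u : unit_in D1 (lmon P1 u / mact g e z1) -> u *+ p = zact (pshift s1) e J.
  move=> uu; apply: inj1; apply: tr1 (unit_inVC (actJ e)); rewrite ?expf_neq0 ?mact_neq0 //.
  rewrite -[_ *+ _]/(u *~ p) lmonz -exprnP -expr_div_n; exact: (unit_in_exp sD1 p%:Z).
apply: (@lattice_certificate p n F z0 c zeta p_gt0 pF prz0 Dz0 prz r1 r2 s1 s2 rho J
   rho_shift rho_surj).
- move=> u ru; have := Hrho u; rewrite -[rho0 u]/(rho u) ru lmon0 divr1 => /unit2[e e0 ue].
  by exists e => //; apply: expU.
- move=> e e0; have /uD2/U1[u uu] := mact2 e0; exists u; apply/esym/expU.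
  exact/unit_inVC.
- move=> e; have p0 : p%:Z != 0 by rewrite eqz_nat -lt0n.
  rewrite -(dvdpZr _ _ p0) -mact1 mact_scale -exprnP; split=> [eJ|ue].
    by have /unit_inV := actJ e; rewrite eJ lmon0 mul1r invrK.
  by apply: F1; rewrite -(mulfVK (expf_neq0 p (mact_neq0 g e z10)) (lmon _ _)); apply: unit_inM.
apply: rhoP; rewrite lmon0 divr1 -(mulfVK z1p0 (lmon P1 J)); apply: (unit_inM sD2) => //.
exact/unit12/unit_inVC.
Qed.

End TwoRings.

(** * The torus of Noether's problem *)

Section FractionLift.
Variable R : idomainType.

Lemma tofrac_inj : injective (@tofrac R).
Proof. by move=> x y /eqP; rewrite tofrac_eq => /eqP. Qed.

Lemma fraction_num_den (x : {fraction R}) :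
  exists a b : R, b != 0 /\ x = tofrac a / tofrac b.
Proof.
elim/quotW: x => -[[a b] /= b0]; exists a, b; split=> //.
have fb0 : tofrac b != 0 by rewrite tofrac_eq0.
apply: (canRL (mulfK fb0)); unlock tofrac; rewrite -[LHS]FracField.pi_mul.
apply/eqmodP; rewrite /= FracField.equivfE /FracField.mulf /=.
by rewrite !numden_Ratio ?(oner_neq0, mul1r, mulr1, mulf_neq0) //= mulrC.
Qed.

Lemma fraction_lift (F : fieldType) (f : {rmorphism R -> F}) : injective f ->
  exists f' : {rmorphism {fraction R} -> F}, forall a, f' (tofrac a) = f a.
Proof.
move=> injf.
have f0 a : (f a == 0) = (a == 0) by rewrite -(rmorph0 f) (inj_eq injf).
have /choice[ab Hab] x : exists ab : R * R, ab.2 != 0 /\ x = tofrac ab.1 / tofrac ab.2.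
  by have [a [b H]] := fraction_num_den x; exists (a, b).
pose f' x := f (ab x).1 / f (ab x).2.
have f'E x a b : b != 0 -> x = tofrac a / tofrac b -> f' x = f a / f b.
  move=> b0 Dx; have [d0 Dx'] := Hab x; apply/eqP.
  rewrite eqr_div ?f0 // -!rmorphM (inj_eq injf) -tofrac_eq !tofracM.
  by rewrite -eqr_div ?tofrac_eq0 // -Dx'; apply/eqP.
have f'B : zmod_morphism f'.
  move=> x y; have [bx0 Dx] := Hab x; have [by0 Dy] := Hab y.
  set ax := (ab x).1 in Dx *; set bx := (ab x).2 in Dx bx0 *.
  set ay := (ab y).1 in Dy *; set by' := (ab y).2 in Dy by0 *.
  rewrite (f'E (x - y) (ax * by' - ay * bx) (bx * by')) ?mulf_neq0 //.
    rewrite (f'E x ax bx) // (f'E y ay by') // -[in RHS]mulNr addf_div ?f0 //.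
    by rewrite rmorphB !rmorphM mulNr.
  by rewrite {1}Dx {1}Dy -[in LHS]mulNr addf_div ?tofrac_eq0 // tofracB !tofracM mulNr.
have f'M : monoid_morphism f'.
  split=> [|x y].
    by rewrite (f'E 1 1 1) ?oner_neq0 // ?rmorph1 divr1.
  have [bx0 Dx] := Hab x; have [by0 Dy] := Hab y.
  rewrite (f'E (x * y) ((ab x).1 * (ab y).1) ((ab x).2 * (ab y).2)) ?mulf_neq0 //.
    by rewrite !rmorphM invfM mulrACA.
  by rewrite {1}Dx {1}Dy !tofracM invfM mulrACA.
pose f'm : {rmorphism {fraction R} -> F} :=
  HB.pack_for {rmorphism {fraction R} -> F} f'
    (GRing.isZmodMorphism.Build _ _ f' f'B) (GRing.isMonoidMorphism.Build _ _ f' f'M).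
exists f'm => a; rewrite -[LHS]/(f' _) (f'E _ a 1) ?oner_neq0 ?rmorph1 ?divr1 //.
Qed.

Lemma fraction_rmorph_eq (S : pzRingType) (f g : {rmorphism {fraction R} -> S}) :
  (forall a, f (tofrac a) = g (tofrac a)) -> f =1 g.
Proof.
move=> fg x; have [a [b [b0 ->]]] := fraction_num_den x.
have fb0 : tofrac b != 0 by rewrite tofrac_eq0.
rewrite !rmorphM fg; congr (_ * _).
have Hf : f (tofrac b) * f (tofrac b)^-1 = 1 by rewrite -rmorphM divff ?rmorph1.
have Hg : g (tofrac b)^-1 * g (tofrac b) = 1 by rewrite -rmorphM mulVf ?rmorph1.
by rewrite -[LHS]mul1r -Hg -mulrA -fg Hf mulr1.
Qed.

End FractionLift.

Lemma char0_ratr (M : fieldType) : [pchar M] =i pred0 ->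
  exists f : {rmorphism rat -> M}, f =1 ratr.
Proof.
move=> chM.
have i0 (k : int) : (k%:~R == 0 :> M) = (k == 0).
  have n0 (m : nat) : (m%:R == 0 :> M) = (m == 0%N) by rewrite pcharf0P in chM.
  by case: k => m; rewrite ?NegzE ?mulrNz ?oppr_eq0 n0.
have rE x (a b : int) : b != 0 -> x = a%:~R / b%:~R -> ratr x = a%:~R / b%:~R :> M.
  move=> b0 Dx; rewrite /ratr; apply/eqP; rewrite eqr_div ?i0 ?denq_neq0 //.
  rewrite -!intrM; apply/eqP; congr _%:~R; apply: (intr_inj (R := rat)).
  rewrite !intrM; apply/eqP; rewrite -eqr_div ?intr_eq0 ?denq_neq0 //.
  by rewrite divq_num_den Dx.
have Dnum x : x = (numq x)%:~R / (denq x)%:~R by rewrite divq_num_den.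
have d0 x : denq x != 0 by apply: denq_neq0.
have fB : zmod_morphism (ratr : rat -> M).
  move=> x y.
  rewrite (rE (x - y) (numq x * denq y - numq y * denq x) (denq x * denq y)) ?mulf_neq0 //.
    rewrite /ratr -[in RHS]mulNr addf_div ?i0 // rmorphB !rmorphM /= mulNr //.
  rewrite {1}(Dnum x) {1}(Dnum y) -[in LHS]mulNr addf_div ?intr_eq0 //.
  by rewrite rmorphB !rmorphM /= mulNr.
have fM : monoid_morphism (ratr : rat -> M).
  split=> [|x y]; first by rewrite (rE 1 1 1) // divr1.
  rewrite (rE (x * y) (numq x * numq y) (denq x * denq y)) ?mulf_neq0 //.
    by rewrite /ratr !rmorphM /= invfM mulrACA.
  by rewrite {1}(Dnum x) {1}(Dnum y) !rmorphM /= invfM mulrACA.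
by exists (HB.pack_for {rmorphism rat -> M} (ratr : rat -> M)
  (GRing.isZmodMorphism.Build _ _ _ fB) (GRing.isMonoidMorphism.Build _ _ _ fM)).
Qed.

(* A Q-basis of a number field containing the coefficients of P. *)
Lemma mpoly_rat_coords n (P : {mpoly algC[n]}) :
  exists (r : nat) (b : 'I_r -> algC) (Q : 'I_r -> {mpoly rat[n]}),
  [/\ forall q : 'I_r -> rat, \sum_i ratr (q i) * b i = 0 -> forall i, q i = 0,
      P = \sum_i b i *: map_mpoly ratr (Q i) &
      forall m m', P@_m = P@_m' -> forall i, (Q i)@_m = (Q i)@_m'].
Proof.
(* The extra 0 gives the coefficients outside the support a preimage in K as well. *)
have [K [KC [s1 Ds _]]] := num_field_exists (0 :: [seq P@_m | m <- msupp P]).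
have /choice[pre Hpre] m : exists x : K, KC x = P@_m.
  have: P@_m \in map KC s1.
    rewrite Ds inE; case: eqVneq => //= Pm; apply: map_f.
    by rewrite mcoeff_msupp.
  by case/mapP=> x _ ->; exists x.
have injKC : injective KC := fmorph_inj KC.
pose b := vbasis {:K}; have bb : basis_of {:K} b := vbasisP _.
exists (\dim {:K}), (fun i => KC b`_i),
  (fun i => \sum_(m <- msupp P) coord b i (pre m) *: 'X_[m]).
have cQ i m : (\sum_(m <- msupp P) coord b i (pre m) *: 'X_[m])@_m = coord b i (pre m).
  rewrite raddf_sum /=; have [mP|mP] := boolP (m \in msupp P).
    rewrite (bigD1_seq m) ?msupp_uniq //= mcoeffZ mcoeffX eqxx mulr1.
    by rewrite big1 ?addr0 // => k /negPf km; rewrite mcoeffZ mcoeffX km mulr0.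
  rewrite big_seq big1 => [|k kP].
    have -> : pre m = 0 by apply: injKC; rewrite Hpre rmorph0; apply/eqP; rewrite mcoeff_eq0.
    by rewrite raddf0.
  rewrite mcoeffZ mcoeffX; case: eqP kP => [->|]; last by rewrite mulr0.
  by rewrite (negPf mP).
split.
- move=> q Hq; have: \sum_i q i *: b`_i = 0.
    apply: injKC; rewrite rmorph0 -[RHS]Hq rmorph_sum; apply: eq_bigr => i _.
    by rewrite rmorphZ_num.
  by have /freeP H := basis_free bb => /H.
- apply/mpolyP => m; rewrite raddf_sum /= -Hpre {1}(coord_basis bb (memvf (pre m))).
  rewrite rmorph_sum; apply: eq_bigr => i _.
  by rewrite rmorphZ_num mcoeffZ mcoeff_map_mpoly cQ mulrC.
move=> m m' Pmm i; rewrite !cQ; congr (coord _ _ _); apply: injKC.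
by rewrite !Hpre.
Qed.

Section MpolyVariables.
Variables (F : fieldType) (n : nat).
Implicit Types (P : {mpoly F[n]}) (i : 'I_n).

Lemma mpoly_unitC P : P \is a GRing.unit -> exists2 c, c != 0 & P = c%:MP.
Proof.
by case/andP=> /eqP DP; rewrite unitfE => c0; exists (P@_0%MM).
Qed.

Lemma mpolyC_unit (c : F) : c != 0 -> (c%:MP : {mpoly F[n]}) \is a GRing.unit.
Proof. by move=> c0; apply: (rmorph_unit (@mpolyC n F)); rewrite unitfE. Qed.

(** Substitution of 0 for X_i: its kernel is the ideal of X_i, and its target is a domain, so X_i is
    prime. *)
Let kill i : {mpoly F[n]} -> {mpoly F[n]} :=
  mmap (@mpolyC n F) (fun j => if j == i then 0 else 'X_j).

Lemma mpolyX_rdvd i P : rdvd 'X_i P <-> kill i P = 0.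
Proof.
split=> [[q ->]|].
  by rewrite /kill rmorphM /= mmapX mmap1U eqxx mulr0.
suff [q Dq] : rdvd 'X_i (P - kill i P) by move=> k0; exists q; rewrite -Dq k0 subr0.
have -> : P - kill i P = \sum_(m <- msupp P) (P@_m *: 'X_[m] - kill i (P@_m *: 'X_[m])).
  by rewrite sumrB /kill -rmorph_sum -mpolyE.
apply: rdvd_sum => m _; rewrite /kill -mul_mpolyC rmorphM /= mmapC mmapX -mulrBr.
apply: rdvd_mull; rewrite (mpolyXE_id _ m) /mmap1.
have [mi|mi] := posnP (m i).
  exists 0; rewrite mul0r; apply/eqP; rewrite subr_eq0; apply/eqP; apply: eq_bigr => j _.
  by case: eqP => // ->; rewrite mi !expr0.
have -> : \prod_(j < n) (if j == i then 0 else 'X_j) ^+ m j = 0 :> {mpoly F[n]}.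
  by rewrite (bigD1 i) //= eqxx expr0n gtn_eqF // mul0r.
rewrite subr0 (bigD1 i) //=; apply: rdvd_mulr.
by exists ('X_i ^+ (m i).-1); rewrite -exprSr prednK.
Qed.

Lemma rprime_mpolyX i : rprime ('X_i : {mpoly F[n]}).
Proof.
have Xn0 : ('X_i : {mpoly F[n]}) != 0.
  by apply/eqP => /(congr1 (mcoeff U_(i)))/eqP; rewrite mcoeffX eqxx mcoeff0 oner_eq0.
split=> //.
  apply/negP => /mpoly_unitC[c _] /(congr1 (mcoeff U_(i)))/eqP.
  by rewrite mcoeffX eqxx mcoeffC mnm1_eq0 mulr0 oner_eq0.
move=> a b /mpolyX_rdvd; rewrite /kill rmorphM => /eqP.
by rewrite mulf_eq0 => /orP[]/eqP H; [left|right]; apply/mpolyX_rdvd.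
Qed.

Lemma mpolyX_neq i j : rdvd ('X_i : {mpoly F[n]}) 'X_j -> i = j.
Proof.
move/mpolyX_rdvd; rewrite /kill mmapX mmap1U; case: eqP => // _ /eqP.
by case: (rprime_mpolyX j) => /negPf->.
Qed.

End MpolyVariables.

Lemma Fp_int_eq0 p (k : int) : prime p -> (k%:~R == 0 :> 'F_p) = (p %| k)%Z.
Proof.
move=> pr; have nat0 (m : nat) : (m%:R == 0 :> 'F_p) = (p %| m)%N.
  by rewrite -(dvdn_pcharf (pchar_Fp pr)).
case: k => m; first by rewrite -[_%:~R]/(m%:R) nat0.
by rewrite NegzE mulrNz oppr_eq0 nat0 dvdzE abszN.
Qed.

Lemma prim_root_sum p (w : algC) i j : p.-primitive_root w -> (i < p)%N -> (j < p)%N ->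
  \sum_(k < p) (w^-1 ^+ i * w ^+ j) ^+ k = (i == j)%:R * p%:R.
Proof.
move=> prw ip jp; have w0 : w != 0 by rewrite (prim_root_eq0 prw) -lt0n (prim_order_gt0 prw).
have [->|ij] := eqVneq i j.
  rewrite mul1r exprVn mulVf ?expf_neq0 // (eq_bigr (fun=> 1)) => [|k _].
    by rewrite sumr_const card_ord.
  by rewrite expr1n.
rewrite mul0r; set x := _ * _.
have x1 : x != 1.
  apply: contra ij => /eqP/(congr1 (fun y => w ^+ i * y)).
  rewrite /x exprVn mulVKf ?expf_neq0 // mulr1 => /eqP.
  by rewrite (eq_prim_root_expr prw) eq_sym !modn_small.
have /eqP : (x - 1) * \sum_(k < p) x ^+ k = 0.
  rewrite -subrX1 /x exprMn -!exprM mulnC exprM exprVn (prim_expr_order prw).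
  by rewrite invr1 expr1n mul1r mulnC exprM (prim_expr_order prw) expr1n subrr.
by rewrite mulf_eq0 subr_eq0 (negPf x1) => /eqP.
Qed.

Lemma mpoly_rmorphE (n : nat) (R : nzRingType) (S : pzRingType)
    (f : {rmorphism {mpoly R[n]} -> S}) P :
  f P = \sum_(m <- msupp P) f (P@_m)%:MP * f 'X_[m].
Proof.
rewrite {1}(mpolyE P) rmorph_sum; apply: eq_bigr => m _.
by rewrite -mul_mpolyC rmorphM.
Qed.

Lemma rprime_dvd_bigprod (R : idomainType) (I : Type) (r : seq I) (P : pred I) F (x : R) :
  rprime x -> rdvd x (\prod_(i <- r | P i) F i) -> exists2 i, P i & rdvd x (F i).
Proof.
move=> px; elim: r => [|i r IHr].
  by rewrite big_nil => /(rprime_dvd_unit px (unitr1 _)).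
rewrite big_cons; case: ifP => // Pi; case: (px) => _ _ H /H[xi|/IHr//].
by exists i.
Qed.

(** * The Fourier transform on the first p variables, fixing the nt auxiliary ones *)

Section DiscreteFourier.
Variables (p nt : nat).
Local Notation A := {mpoly algC[p + nt]}.

Definition dft_var (w a : algC) (i : 'I_(p + nt)) : A :=
  match split i with
  | inl k => a *: \sum_(j < p) (w ^+ k) ^+ j *: 'X_(lshift nt j)
  | inr j => 'X_(rshift p j)
  end.

Definition dft w a : A -> A := mmap (@mpolyC _ _) (dft_var w a).

HB.instance Definition _ w a := GRing.RMorphism.copy (dft w a)
  (mmap (@mpolyC _ _) (dft_var w a)).

Lemma dftL w a (k : 'I_p) :
  dft w a 'X_(lshift nt k) = a *: \sum_(j < p) (w ^+ k) ^+ j *: 'X_(lshift nt j).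
Proof. by rewrite /dft mmapX mmap1U /dft_var (unsplitK (inl k)). Qed.

Lemma dftR w a (k : 'I_nt) : dft w a 'X_(rshift p k) = 'X_(rshift p k).
Proof. by rewrite /dft mmapX mmap1U /dft_var (unsplitK (inr k)). Qed.

Lemma dftC w a c : dft w a c%:MP = c%:MP.
Proof. exact: mmapC. Qed.

Lemma dftZ w a c P : dft w a (c *: P) = c *: dft w a P.
Proof. by rewrite -!mul_mpolyC rmorphM /= dftC. Qed.

Lemma dftK w a b : p.-primitive_root w -> a * b * p%:R = 1 ->
  cancel (dft w^-1 b) (dft w a).
Proof.
move=> prw ab.
apply: (mpoly_rmorph_eq (f := dft w a \o dft w^-1 b) (g := idfun)) => [c|i] /=.
  by rewrite !dftC.
case: (split_ordP i) => k ->; last by rewrite !dftR.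
rewrite dftL dftZ rmorph_sum /=.
under eq_bigr do rewrite dftZ dftL scalerA mulrC -scalerA.
rewrite -scaler_sumr scalerA mulrC.
under eq_bigr => j _ do rewrite scaler_sumr.
rewrite exchange_big /= (bigD1 k) //= [X in _ + X]big1 => [|i0 i0k].
  rewrite addr0 (eq_bigr (fun j : 'I_p => (w^-1 ^+ k * w ^+ k) ^+ j *: 'X_(lshift nt k))).
    by rewrite -scaler_suml prim_root_sum // eqxx mul1r scalerA ab scale1r.
  by move=> j _; rewrite scalerA exprMn -!exprM [(k * j)%N]mulnC.
rewrite (eq_bigr (fun j : 'I_p => (w^-1 ^+ k * w ^+ i0) ^+ j *: 'X_(lshift nt i0))).
  rewrite -scaler_suml prim_root_sum //.
  by have /negPf-> : (k != i0 :> nat)%N; rewrite ?mul0r ?scale0r // eq_sym.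
by move=> j _; rewrite scalerA exprMn -!exprM [(i0 * j)%N]mulnC.
Qed.

End DiscreteFourier.

(** * The Laurent ring of the W_k and the invariants of C_p *)

Section TorusRing.
Variables (p nt c : nat) (zeta : algC) (u : {rmorphism algC -> algC}).
Hypotheses (p_pr : prime p) (prz : p.-primitive_root zeta) (uzeta : u zeta = zeta ^+ c).
Local Notation n := p.-1.
Hypothesis prc : n.-primitive_root (c%:R : 'F_p).
Local Notation A := {mpoly algC[p + nt]}.
Local Notation E := {fraction A}.
Local Notation theta := (@dft p nt zeta 1).
Local Notation theta' := (@dft p nt zeta^-1 p%:R^-1).
Local Notation iota c := (tofrac (c%:MP : A)).

Let p_gt0 : (0 < p)%N. Proof. exact: prime_gt0. Qed.
Let p_gt1 : (1 < p)%N. Proof. exact: prime_gt1. Qed.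
Let p0 : (p%:R : algC) != 0. Proof. by rewrite pnatr_eq0 -lt0n. Qed.
Let zeta0 : zeta != 0. Proof. by rewrite (prim_root_eq0 prz) -lt0n. Qed.

Lemma prim_inv : p.-primitive_root zeta^-1.
Proof.
have -> : zeta^-1 = zeta ^+ p.-1.
  by apply: (mulIf zeta0); rewrite -exprSr prednK // mulVf // prim_expr_order.
by rewrite (prim_root_exp_coprime _ prz) coprime_sym coprimenP.
Qed.

Lemma theta'K : cancel theta' theta.
Proof. by apply: dftK => //; rewrite mul1r mulVf. Qed.

Lemma thetaK : cancel theta theta'.
Proof.
rewrite -{1}[zeta]invrK; apply: dftK; first exact: prim_inv.
by rewrite mulr1 mulVf.
Qed.

Lemma shift_var_inj : injective (fun i : 'I_(p + nt) =>
  unsplit (match split i with inl j => inl (ordS j) | inr j => inr j end)).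
Proof.
move=> i j /(can_inj (@unsplitK p nt)) /=.
case: (split_ordP i) => a ->; case: (split_ordP j) => b -> //.
  by move=> [e]; rewrite (@ordS_inj p a b) //; apply: val_inj.
by move=> [->].
Qed.

Definition shift_var : {perm 'I_(p + nt)} := perm shift_var_inj.

Lemma shift_varL j : shift_var (lshift nt j) = lshift nt (ordS j).
Proof. by rewrite permE (unsplitK (inl j)). Qed.

Lemma shift_varR j : shift_var (rshift p j) = rshift p j.
Proof. by rewrite permE (unsplitK (inr j)). Qed.

Local Notation h := (@msym (p + nt) algC shift_var).

Lemma hX i : h 'X_i = 'X_(shift_var i).
Proof. by rewrite /msym mmapX mmap1U. Qed.

Lemma hC a : h a%:MP = a%:MP.
Proof. exact: mmapC. Qed.

Lemma hZ a P : h (a *: P) = a *: h P.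
Proof. by rewrite -!mul_mpolyC rmorphM /= hC. Qed.

Definition wt (i : 'I_(p + nt)) : nat := if (i < p)%N then nat_of_ord i else 0%N.

Definition scale_var : A -> A :=
  mmap (@mpolyC _ _) (fun i => (zeta^-1 ^+ wt i) *: 'X_i).

HB.instance Definition _ := GRing.RMorphism.copy scale_var
  (mmap (@mpolyC _ _) (fun i => (zeta^-1 ^+ wt i) *: 'X_i)).

(** In Fourier coordinates the generator of C_p is diagonal, multiplying Z_k by zeta^(-k). *)
Lemma h_theta P : h (theta P) = theta (scale_var P).
Proof.
apply: (mpoly_rmorph_eq (f := h \o theta) (g := theta \o scale_var)) P => [a|i] /=.
  by rewrite /scale_var dftC mmapC dftC hC.
rewrite /scale_var mmapX mmap1U dftZ /wt; case: (split_ordP i) => k ->; last first.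
  by rewrite dftR hX shift_varR expr0 scale1r.
rewrite /= dftL !scale1r rmorph_sum /= [in RHS](reindex_inj (@ordS_inj p)).
rewrite scaler_sumr; apply: eq_bigr => j _; rewrite hZ hX shift_varL scalerA /=.
congr (_ *: _); rewrite expr_mod; last by rewrite exprAC (prim_expr_order prz) expr1n.
by rewrite exprS mulrA exprVn mulVf ?expf_neq0 // mul1r.
Qed.

Lemma prod_scaleX (R : comNzRingType) k (a : 'I_k -> R) (m : 'X_{1..k}) :
  \prod_i (a i *: 'X_i) ^+ m i = (\prod_i a i ^+ m i) *: 'X_[m] :> {mpoly R[k]}.
Proof.
rewrite (mpolyXE_id _ m) -mul_mpolyC rmorph_prod -big_split; apply: eq_bigr => i _ /=.
by rewrite -mul_mpolyC exprMn rmorphXn.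
Qed.

Lemma scale_var_coeff P m :
  (scale_var P)@_m = zeta^-1 ^+ (\sum_i wt i * m i)%N * P@_m.
Proof.
rewrite /scale_var /mmap raddf_sum /=.
have DX k : mmap1 (fun i => zeta^-1 ^+ wt i *: 'X_i) k
    = zeta^-1 ^+ (\sum_i wt i * k i)%N *: 'X_[k] :> A.
  rewrite /mmap1 prod_scaleX; congr (_ *: _); rewrite -prodrXr.
  by apply: eq_bigr => i _; rewrite exprM.
under eq_bigr do rewrite DX mul_mpolyC scalerA mcoeffZ mcoeffX.
have [mP|mP] := boolP (m \in msupp P).
  rewrite (bigD1_seq m) ?msupp_uniq //= eqxx mulr1 mulrC [X in _ + X]big1 ?addr0 // => k /negPf km.
  by rewrite km mulr0.
rewrite (memN_msupp_eq0 mP) mulr0 big_seq [LHS]big1 // => k kP.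
by case: eqP kP mP => [->->|]; rewrite ?mulr0.
Qed.

Definition ind1 : 'I_(p + nt) := lshift nt (Ordinal p_gt1).
(** The power of Z_1 that brings the weight of Z_i to p; Z_0 and the auxiliary variables already
    have weight 0. *)
Definition cwt (i : 'I_(p + nt)) : nat := if (0 < i < p)%N then (p - i)%N else 0%N.

Definition W0 (i : 'I_(p + nt)) : A := 'X_i * 'X_ind1 ^+ cwt i.
Definition mono : A -> A := mmap (@mpolyC _ _) W0.

HB.instance Definition _ := GRing.RMorphism.copy mono (mmap (@mpolyC _ _) W0).

Lemma monoX i : mono 'X_i = W0 i.
Proof. by rewrite /mono mmapX mmap1U. Qed.

Definition cdeg (m : 'X_{1..p + nt}) : nat := (\sum_i cwt i * m i)%N.

Lemma mono_mono m : mono 'X_[m] = 'X_[m] * 'X_ind1 ^+ cdeg m.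
Proof.
rewrite /mono mmapX /mmap1 (mpolyXE_id _ m) /cdeg -prodrXr -big_split.
by apply: eq_bigr => i _; rewrite exprMn exprM.
Qed.

(** On exponents the substitution fixes every entry except that of Z_1, which becomes p times itself
    plus a function of the others; so distinct monomials stay distinct. *)
Lemma mono_inj : injective mono.
Proof.
suff H P : mono P = 0 -> P = 0.
  by move=> P Q /eqP; rewrite -subr_eq0 -rmorphB => /eqP/H/eqP; rewrite subr_eq0 => /eqP.
move=> MP; apply/mpolyP => m0; rewrite mcoeff0.
pose phi m := (m + U_(ind1) *+ cdeg m)%MM.
have phi_inj : injective phi.
  move=> m1 m2 /mnmP e12.
  have eq_ne i : i != ind1 -> m1 i = m2 i.
    move=> ni; have := e12 i; rewrite !mnmDE !mulmnE !mnm1E eq_sym (negPf ni).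
    by rewrite !mul0n !addn0.
  apply/mnmP => i; have [->|/eq_ne//] := eqVneq i ind1.
  have := e12 ind1; rewrite !mnmDE !mulmnE !mnm1E eqxx !mul1n /cdeg.
  rewrite (bigD1 ind1) //= [in RHS](bigD1 ind1) //=.
  have -> : \sum_(j | j != ind1) cwt j * m1 j = \sum_(j | j != ind1) cwt j * m2 j.
    by apply: eq_bigr => j /eq_ne->.
  by rewrite !addnA => /addIn; rewrite -!mulSn => /eqP; rewrite eqn_pmul2l // => /eqP.
have := congr1 (mcoeff (phi m0)) MP; rewrite mcoeff0 /mono /mmap raddf_sum /=.
have DX k : mmap1 W0 k = 'X_[phi k].
  by have := mono_mono k; rewrite /mono mmapX => ->; rewrite /phi mpolyXD mpolyXn.
under eq_bigr do rewrite DX mul_mpolyC mcoeffZ mcoeffX (inj_eq phi_inj).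
have [mP|mP] := boolP (m0 \in msupp P); last by rewrite (memN_msupp_eq0 mP).
rewrite (bigD1_seq m0) ?msupp_uniq //= eqxx mulr1 big1 ?addr0 // => k /negPf km.
by rewrite km mulr0.
Qed.

Definition phiW : A -> E := @tofrac A \o theta \o mono.
HB.instance Definition _ := GRing.RMorphism.copy phiW (@tofrac A \o theta \o mono).

Lemma phiW_inj : injective phiW.
Proof. by move=> x y /tofrac_inj/(can_inj thetaK)/mono_inj. Qed.

Definition inner (i : 'I_(p + nt)) : bool := (0 < i < p)%N.
Definition omega : A := \prod_(i | inner i) 'X_i.

Lemma omega_neq0 : omega != 0.
Proof. by apply/prodf_neq0 => i _; case: (rprime_mpolyX algC i). Qed.

(** Laurent polynomials in W_1, ..., W_(p-1), polynomial in Z_0 and in the auxiliary variables. *)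
Definition D2 : E -> Prop := loc_image phiW omega.

Lemma D2_subring : is_subring D2.
Proof. exact: loc_image_subring. Qed.

Lemma D2_factorial : factorial_in D2.
Proof.
apply: (@loc_image_factorial E A phiW omega phiW_inj _ omega_neq0).
exact: mpoly_factorial.
Qed.

Lemma phiWC a : phiW a%:MP = iota a.
Proof. by rewrite /phiW /= /mono mmapC dftC. Qed.

Lemma iota_unit a : a != 0 -> unit_in D2 (iota a).
Proof.
move=> a0; rewrite -phiWC; apply: unit_in_image; first exact: phiW_inj.
exact: mpolyC_unit.
Qed.

Lemma W_unit i : inner i -> unit_in D2 (phiW 'X_i).
Proof.
move=> ii; have Xn0 : phiW 'X_i != 0.
  by rewrite -(rmorph0 phiW) (inj_eq phiW_inj); case: (rprime_mpolyX algC i).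
split=> //; first exact: image_loc.
pose P : A := \prod_(j | inner j && (j != i)) 'X_j.
have Dom : omega = 'X_i * P by rewrite /omega (bigD1 i).
have P0 : phiW P != 0.
  rewrite -(rmorph0 phiW) (inj_eq phiW_inj); have := omega_neq0.
  by rewrite Dom mulf_eq0 negb_or => /andP[].
have -> : (phiW 'X_i)^-1 = phiW P / phiW omega.
  by rewrite Dom rmorphM invfM mulrCA divff // mulr1.
apply: (sub_inM D2_subring); first exact: image_loc.
exact: (loc_image_inv phiW_inj omega_neq0).
Qed.

Definition zn (m : nat) : E := tofrac (theta 'X_(lshift nt (Ordinal (ltn_pmod m p_gt0)))).
Local Notation z1 := (zn 1).

Lemma phiW_inner (i : 'I_(p + nt)) : inner i ->
  phiW 'X_i = zn i * z1 ^+ (p - i)%N.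
Proof.
move=> ii; rewrite /phiW /= monoX /W0 /cwt -/(inner i) ii rmorphM rmorphXn /=.
rewrite tofracM tofracXn; congr (tofrac (theta 'X__) * tofrac (theta 'X__) ^+ _).
  by apply: val_inj; rewrite /= modn_small //; case/andP: ii.
by apply: val_inj; rewrite /= modn_small.
Qed.

Lemma zn_neq0 m : zn m != 0.
Proof.
rewrite tofrac_eq0 -(rmorph0 theta) (inj_eq (can_inj thetaK)).
by case: (rprime_mpolyX algC (lshift nt (Ordinal (ltn_pmod m p_gt0)))).
Qed.

Lemma z1p_unit : unit_in D2 (z1 ^+ p).
Proof.
have i1 : inner ind1 by rewrite /inner /= p_gt1.
have := W_unit i1; rewrite phiW_inner //= -exprS subn1 prednK //.
Qed.

Lemma zn_unit m : ~~ (p %| m)%N -> unit_in D2 (zn m * z1 ^+ (p - m %% p)).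
Proof.
move=> pm; pose i := lshift nt (Ordinal (ltn_pmod m p_gt0)).
have ii : inner i by rewrite /inner /= ltn_pmod // andbT lt0n.
have := W_unit ii; rewrite phiW_inner //= (_ : zn _ = zn m) //.
by rewrite /zn; congr (tofrac (theta 'X__)); apply: val_inj; rewrite /= modn_mod.
Qed.

(** An invariant polynomial contains only monomials of weight divisible by p, and each of these is a
    monomial in the W_i divided by a power of W_1 = Z_1^p. *)
Lemma h_inv_D2 f : h f = f -> D2 (tofrac f).
Proof.
rewrite -{1 2 3}[f]theta'K h_theta => /(can_inj thetaK); set f' := theta' f => hf.
rewrite -[tofrac _]/((@tofrac A \o theta) f') mpoly_rmorphE big_seq.
apply: (sub_in_sum D2_subring) => m mf; rewrite [X in X * _]/= dftC.
apply: (sub_inM D2_subring); first by rewrite -phiWC; apply: image_loc.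
have wtm : (p %| \sum_i wt i * m i)%N.
  have := scale_var_coeff f' m; rewrite hf => /eqP.
  rewrite -{1}[f'@_m]mul1r -subr_eq0 -mulrBl mulf_eq0 mcoeff_eq0 mf orbF subr_eq0 eq_sym.
  by rewrite -(prim_order_dvd prim_inv).
have cdm : (p %| cdeg m)%N.
  rewrite -(dvdn_addr _ wtm) /cdeg -big_split /=; elim/big_ind: _ => // [a b|i _].
    exact: dvdn_add.
  rewrite -mulnDl dvdn_mulr // /wt /cwt; case: ltnP => ip; last by rewrite andbF.
  by rewrite andbT; case: posnP => [->//|_]; rewrite subnKC // ltnW.
have z1k : tofrac (theta ('X_ind1 ^+ cdeg m)) = (z1 ^+ p) ^+ (cdeg m %/ p).
  rewrite -exprM mulnC divnK // rmorphXn tofracXn; congr (tofrac (theta 'X__) ^+ _).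
  by apply: val_inj; rewrite /= modn_small.
have u1 : unit_in D2 ((z1 ^+ p) ^+ (cdeg m %/ p)).
  exact: (unit_in_exp D2_subring (Posz _) z1p_unit).
have Dx : tofrac (theta 'X_[m]) = phiW 'X_[m] / (z1 ^+ p) ^+ (cdeg m %/ p).
  apply: (canRL (mulfK _)); first by case: u1.
  by rewrite -z1k /phiW /= mono_mono !rmorphM.
rewrite -[X in D2 X]/(tofrac (theta 'X_[m])) Dx.
apply: (sub_inM D2_subring); first exact: image_loc.
by case: u1.
Qed.

Lemma zn_mod m : zn (m %% p) = zn m.
Proof. by rewrite /zn; congr (tofrac (theta 'X__)); apply: val_inj; rewrite /= modn_mod. Qed.

Lemma Fp_nat_eq (a b : nat) : (a%:R == b%:R :> 'F_p) = (a == b %[mod p]).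
Proof.
by rewrite -val_eqE /= !val_Fp_nat.
Qed.

Lemma c_ndvd i : ~~ (p %| c ^ i)%N.
Proof.
rewrite (dvdn_pcharf (pchar_Fp p_pr)) natrX expf_neq0 //.
rewrite (prim_root_eq0 prc) -lt0n; exact: prim_order_gt0 prc.
Qed.

(** * The semilinear automorphism g and the units of the torus ring *)

Section Semilinear.
Variables (g g' : {rmorphism E -> E}).
Hypotheses (gE : forall P, g (tofrac P) = tofrac (map_mpoly u P)).
Hypotheses (gK : cancel g g') (g'K : cancel g' g).

Lemma g_iota a : g (iota a) = iota (u a).
Proof. by rewrite gE map_mpolyC. Qed.

Lemma g'_iota a : g' (iota a) = iota (algC_invaut u a).
Proof. by rewrite -{1}[a](algC_invautK u) -g_iota gK. Qed.

Lemma g_zn m : g (zn m) = zn (c * m).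
Proof.
rewrite gE /zn; congr (tofrac _); rewrite !dftL !scale1r rmorph_sum /=; apply: eq_bigr => j _.
rewrite map_mpolyZ /= map_mpolyX !rmorphXn /= uzeta; congr (_ ^+ _ *: _).
by rewrite -exprM -[in RHS](prim_expr_mod prz) -(prim_expr_mod prz) modn_mod modnMmr.
Qed.

Lemma g_iter i : iter i g z1 = zn (c ^ i).
Proof. by elim: i => [|i IHi] //=; rewrite IHi g_zn expnS. Qed.

Lemma g_itern : iter n g z1 = z1.
Proof.
rewrite g_iter -zn_mod -[in RHS]zn_mod; congr (zn _); apply/eqP.
by rewrite -Fp_nat_eq natrX (prim_expr_order prc).
Qed.

Lemma ieval_sum (S : comNzRingType) (z : S) (e : {poly int}) :
  ieval z e = \sum_(i < size e) (e`_i)%:~R * z ^+ i.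
Proof.
rewrite -[e in LHS]coefK poly_def rmorph_sum; apply: eq_bigr => i _.
by rewrite -mul_polyC rmorphM rmorphXn /= ievalC ievalX.
Qed.

Lemma prod_expz (R : fieldType) (x : R) m (k : 'I_m -> int) : x != 0 ->
  \prod_i x ^ k i = x ^ (\sum_i k i).
Proof.
move=> x0; rewrite (big_morph (fun k : int => x ^ k) (id1 := 1) (op1 := *%R)) //.
by move=> a b; rewrite expfzDr.
Qed.

(** Completing each Z_(c^i) to the corresponding W costs d_i factors Z_1. The total surplus, the sum
    of the d_i e_i, is -e(c) = 0 modulo p, so it is a power of the unit Z_1^p. *)
Lemma mact_unit e : ieval (c%:R : 'F_p) e = 0 -> unit_in D2 (mact g e z1).
Proof.
move=> e0; have z10 : z1 != 0 by apply: zn_neq0.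
pose d i : nat := (p - c ^ i %% p)%N.
have Dm : mact g e z1 = \prod_(i < size e) (zn (c ^ i) * z1 ^+ d i) ^ e`_i
    * z1 ^ (- \sum_(i < size e) (d i)%:Z * e`_i).
  rewrite -sumrN -(prod_expz _ z10) -big_split; apply: eq_bigr => i _ /=.
  rewrite g_iter expfzMl -mulrA exprnP exprz_exp -expfzDr // subrr mulr1 //.
have : (p %| \sum_(i < size e) (d i)%:Z * e`_i)%Z.
  rewrite -(Fp_int_eq0 _ p_pr) rmorph_sum /= -oppr_eq0 -[X in _ == X]e0 ieval_sum.
  rewrite -sumrN; apply/eqP; apply: eq_bigr => i _; rewrite rmorphM /= -mulNr mulrC.
  congr (_ * _); rewrite /d -subzn ?rmorphB /=; last by rewrite ltnW // ltn_pmod.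
  have -> : (p%:Z%:~R : 'F_p) = 0 by apply/eqP; rewrite Fp_int_eq0 // dvdzz.
  by rewrite sub0r opprK -natrX -[LHS]/((c ^ i %% p)%:R) Fp_nat_mod.
case/dvdzP=> q Dq; rewrite Dm Dq; apply: (unit_inM D2_subring).
  apply: (unit_in_prod D2_subring) => i _; apply: (unit_in_exp D2_subring).
  exact/zn_unit/c_ndvd.
rewrite -mulNr mulrC -exprz_exp; apply: (unit_in_exp D2_subring).
exact: z1p_unit.
Qed.

(** The explicit form of the unit group of D2: constants times Z_1^e with e in the ideal (p, X -
    c). *)
Definition Gp (f : E) : Prop := exists e a,
  [/\ ieval (c%:R : 'F_p) e = 0, a != 0 & f = iota a * mact g e z1].

Lemma GpM x y : Gp x -> Gp y -> Gp (x * y).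
Proof.
move=> [e [a [e0 a0 ->]]] [f [b [f0 b0 ->]]]; exists (e + f), (a * b); split.
- by rewrite rmorphD /= e0 f0 addr0.
- by rewrite mulf_neq0.
by rewrite mactD ?zn_neq0 // mpolyCM tofracM mulrACA.
Qed.

Lemma GpV x : Gp x -> Gp x^-1.
Proof.
move=> [e [a [e0 a0 ->]]]; exists (- e), a^-1; split.
- by rewrite rmorphN /= e0 oppr0.
- by rewrite invr_eq0.
rewrite mactN ?zn_neq0 // invfM; congr (_ * _).
have ia0 : iota a != 0 by rewrite tofrac_eq0 mpolyC_eq0.
by apply: (mulIf ia0); rewrite mulVf // -tofracM -mpolyCM mulVf.
Qed.

Lemma Gp_iota a : a != 0 -> Gp (iota a).
Proof. by move=> a0; exists 0, a; rewrite rmorph0 mact0 mulr1. Qed.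

Lemma Gp_W i : inner i -> Gp (phiW 'X_i).
Proof.
move=> ii; have [i0 ip] := andP ii; rewrite phiW_inner //.
have /(prim_rootP prc)[l Dl] : (i%:R : 'F_p) ^+ n = 1.
  have i0F : (i%:R : 'F_p) != 0.
    by rewrite -(dvdn_pcharf (pchar_Fp p_pr)) gtnNdvd.
  apply: (mulfI i0F); rewrite -exprS prednK // mulr1.
  by have := expf_card (i%:R : 'F_p); rewrite card_Fp.
(* With i = c^l modulo p, W_i = Z_i Z_1^(p-i) is Z_1 to this exponent, whose value at c is i + (p -
   i) = 0. *)
exists ('X^l + (p - i)%:Z%:P), 1; split.
- rewrite rmorphD rmorphXn /= ievalX ievalC -Dl -[(p - i)%:Z%:~R]/((p - i)%:R) -natrD.
  by rewrite subnKC ?(ltnW ip) // pchar_Fp_0.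
- exact: oner_neq0.
rewrite mpolyC1 tofrac1 mul1r mactD ?zn_neq0 // mactXn mactC -exprnP g_iter.
congr (_ * _); rewrite -zn_mod -[in RHS]zn_mod; congr (zn _); apply/eqP.
by rewrite -Fp_nat_eq natrX Dl.
Qed.

Lemma Gp_prod (I : Type) (r : seq I) (P : pred I) F :
  (forall i, P i -> Gp (F i)) -> Gp (\prod_(i <- r | P i) F i).
Proof.
move=> H; elim/big_ind: _ => //; last exact: GpM.
by rewrite -tofrac1 -mpolyC1; apply: Gp_iota; apply: oner_neq0.
Qed.

(** Writing f over a power of omega, its numerator divides a power of omega, so by factoriality it
    is a constant times a product of inner variables. *)
Lemma D2_unit_Gp f : unit_in D2 f -> Gp f.
Proof.
move=> [f0 Df Df'].
have [k [a Da]] := Df; have [l [b Db]] := Df'.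
have w0 : phiW omega != 0 by rewrite -(rmorph0 phiW) (inj_eq phiW_inj) omega_neq0.
have ab : a * b = omega ^+ (k + l).
  apply: phiW_inj; rewrite rmorphM rmorphXn exprD /= -Da -Db mulrACA (divff f0).
  exact: mul1r.
have {Da} Da : f = phiW a / phiW omega ^+ k.
  by rewrite -Da (mulfK (expf_neq0 k w0)).
have Gw : Gp (phiW omega).
  by rewrite rmorph_prod; apply: Gp_prod => i ii; apply: Gp_W.
have a0 : a != 0.
  by apply: contraNneq f0 => a0; rewrite Da a0 rmorph0 mul0r.
rewrite Da; apply: GpM; last first.
  rewrite -exprVn -[k]card_ord -prodr_const; apply: Gp_prod => _ _; exact: GpV.
have [v [s [uv ps Ds]]] := mpoly_factorial a0.
have [d d0 Dv] := mpoly_unitC uv.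
rewrite Ds rmorphM Dv /= phiWC; apply: GpM; first exact: Gp_iota.
rewrite rmorph_prod big_seq; apply: Gp_prod => q qs /=.
have pq := ps q qs.
have: rdvd q (omega ^+ (k + l)).
  rewrite -ab Ds -mulrA; apply: rdvd_mull; apply: rdvd_mulr.
  by rewrite (perm_big _ (perm_to_rem qs)) big_cons; exists (\prod_(j <- rem q s) j); rewrite mulrC.
case/(rprime_dvd_exp pq)/(rprime_dvd_bigprod pq) => i ii qi.
have [w uw Dw] := rprime_dvd_rprime pq (rprime_mpolyX algC i) qi.
have [e e0 De] := mpoly_unitC uw.
have ie0 : iota e != 0 by rewrite tofrac_eq0 mpolyC_eq0.
have -> : phiW q = (iota e)^-1 * phiW 'X_i.
  by apply: (mulfI ie0); rewrite (mulVKf ie0) Dw De rmorphM /= phiWC.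
by apply: GpM; [apply/GpV/Gp_iota | apply: Gp_W].
Qed.

Lemma Gp_unit f : Gp f -> unit_in D2 f.
Proof.
move=> [e [a [e0 a0 ->]]]; apply: (unit_inM D2_subring); first exact: iota_unit.
exact: mact_unit.
Qed.

Lemma Gp_g f : Gp f -> Gp (g f).
Proof.
move=> [e [a [e0 a0 ->]]]; exists (e * 'X), (u a).
by rewrite rmorphM /= e0 mul0r fmorph_eq0 mactMX rmorphM /= g_iota.
Qed.

Lemma n_gt0 : (0 < n)%N. Proof. exact: prim_order_gt0 prc. Qed.

Lemma Gp_g' f : Gp f -> Gp (g' f).
Proof.
(* g^n fixes Z_1, so the inverse of g acts on exponents as X^(n-1). *)
move=> [e [a [e0 a0 ->]]]; exists (e * 'X^(n.-1)), (algC_invaut u a).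
rewrite rmorphM /= e0 mul0r fmorph_eq0 mactMXn rmorphM /= g'_iota; split=> //.
congr (_ * _); rewrite -{1}g_itern mact_iter -{1}(prednK n_gt0) iterS gK //.
Qed.

Lemma g_outer i : ~~ inner i -> g (phiW 'X_i) = phiW 'X_i.
Proof.
move=> ii; have -> : phiW 'X_i = tofrac (theta 'X_i).
  by rewrite /phiW /= monoX /W0 /cwt -/(inner i) (negPf ii) mulr1.
case: (split_ordP i) ii => k -> ii; last first.
  by rewrite dftR gE map_mpolyX.
have := g_zn 0; rewrite muln0; suff -> : zn 0 = tofrac (theta 'X_(lshift nt k)) by [].
rewrite /zn; congr (tofrac (theta 'X__)); apply: val_inj; rewrite /= mod0n.
by apply/esym/eqP; move: ii; rewrite /inner /= ltn_ord andbT -eqn0Ngt.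
Qed.

Lemma D2_stable (gam : {rmorphism E -> E}) :
    (forall a, exists b, gam (iota a) = iota b) ->
    (forall i, ~~ inner i -> gam (phiW 'X_i) = phiW 'X_i) ->
    (forall f, Gp f -> Gp (gam f)) ->
  forall x, D2 x -> D2 (gam x).
Proof.
move=> gam_iota gam_out gam_in.
have sD := D2_subring.
have DW i : D2 (gam (phiW 'X_i)).
  have [ii|/gam_out->] := boolP (inner i); last exact: image_loc.
  by case: (Gp_unit (gam_in _ (Gp_W ii))).
have DW' : D2 (gam (phiW omega)^-1).
  suff /gam_in/Gp_unit[_ //] : Gp (phiW omega)^-1.
  by apply: GpV; rewrite rmorph_prod; apply: Gp_prod => i ii; apply: Gp_W.
move=> x /(loc_imageE phiW_inj omega_neq0)[a [k ->]].
rewrite rmorphM /=; apply: (sub_inM sD); last first.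
  by rewrite -exprVn rmorphXn; apply: sub_inX.
rewrite -[gam _]/((gam \o phiW) a) mpoly_rmorphE; apply: (sub_in_sum sD) => m _.
apply: (sub_inM sD).
  rewrite /= phiWC; have [b ->] := gam_iota a@_m; rewrite -phiWC; exact: image_loc.
rewrite (mpolyXE_id _ m) rmorph_prod; apply: (sub_in_prod sD) => i _.
by rewrite rmorphXn; apply: sub_inX => //; apply: DW.
Qed.

Lemma D2_g x : D2 x -> D2 (g x).
Proof.
apply: D2_stable; [|exact: g_outer | exact: Gp_g].
by move=> a; exists (u a); rewrite g_iota.
Qed.

Lemma D2_g' x : D2 x -> D2 (g' x).
Proof.
apply: D2_stable; [|by move=> i /g_outer{1}<-; rewrite gK | exact: Gp_g'].
by move=> a; exists (algC_invaut u a); rewrite g'_iota.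
Qed.

(** After reduction modulo X^n - 1 the factors Z_(c^i), i < n, are pairwise nonassociate primes of
    the polynomial ring, so a constant product has all exponents 0. *)
Lemma mact_const e :
  (exists2 a, a != 0 & mact g e z1 = iota a) <-> 'X^n - 1 %| e.
Proof.
have z10 : z1 != 0 by apply: zn_neq0.
have dvd1 q : mact g (q * ('X^n - 1)) z1 = 1.
  rewrite mulrBr mulr1 (mactD g _ _ z10) (mactN g _ z10) mactMXn -mact_iter g_itern.
  exact: divff (mact_neq0 g q z10).
split=> [[a a0 De]|/(Xn_sub1_factor n_gt0)[q ->]]; last first.
  by exists 1; rewrite ?oner_neq0 // dvd1 mpolyC1 tofrac1.
have mon : 'X^n - 1 \is @monic int by apply: (monicXnsubC (1 : int) n_gt0).
pose r := e %% ('X^n - 1).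
have De' : e = e %/ ('X^n - 1) * ('X^n - 1) + r by apply: Pdiv.IdomainMonic.divp_eq.
have szr : (size r <= n)%N.
  have := ltn_modpN0 e (Xn_sub1_neq0 n_gt0).
  by rewrite (size_XnsubC (1 : int) n_gt0) ltnS.
suff r0 : r = 0 by rewrite De' r0 addr0 dvdp_mull.
have {De} Dr : mact g r z1 = iota a.
  by rewrite -De {1}De' (mactD g _ _ z10) dvd1 mul1r.
pose f : {rmorphism A -> E} := @tofrac A \o theta.
have f_inj : injective f by move=> x y /tofrac_inj/(can_inj thetaK).
have f1 : (1 : A) != 0 := oner_neq0 _.
pose D := loc_image f 1.
pose ix (i : 'I_n) : 'I_(p + nt) := lshift nt (Ordinal (ltn_pmod (c ^ i) p_gt0)).
pose P i : E := f 'X_(ix i).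
have pP i : prime_in D (P i).
  apply: (prime_in_image f_inj f1); first exact: rprime_mpolyX.
  by move/(rprime_dvd_unit (rprime_mpolyX _ _)); apply; apply: unitr1.
have nP i j : unit_in D (P i / P j) -> i = j.
  case=> _ [k [b Db]] _; have Pj0 : P j != 0 by case: (pP j).
  have : 'X_(ix i) = b * 'X_(ix j).
    apply: f_inj; rewrite rmorphM -Db rmorph1 expr1n mulr1.
    exact: esym (mulfVK Pj0 _).
  move=> dv; have /mpolyX_neq : rdvd ('X_(ix j) : A) 'X_(ix i) by exists b.
  move/(congr1 val) => /= /eqP; rewrite -Fp_nat_eq !natrX (eq_prim_root_expr prc).
  by rewrite !modn_small // => /eqP/val_inj.
have sD : is_subring D by apply: loc_image_subring.
have : unit_in D (lmon P [ffun i => r`_(i : 'I_n)]).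
  have -> : lmon P [ffun i => r`_(i : 'I_n)] = mact g r z1.
    rewrite (mact_wide g z1 szr); apply: eq_bigr => i _; rewrite ffunE g_iter //.
  rewrite Dr -(@dftC p nt zeta 1 a).
  exact: (@unit_in_image E A f 1 f_inj _ (mpolyC_unit _ a0)).
move/(prime_family_free sD pP nP) => /ffunP r0; apply/polyP => i; rewrite coef0.
have [ltin|lein] := ltnP i n; last by rewrite nth_default // (leq_trans szr).
by have := r0 (Ordinal ltin); rewrite !ffunE.
Qed.

Lemma scale_mono P : scale_var (mono P) = mono P.
Proof.
apply: (mpoly_rmorph_eq (f := scale_var \o mono) (g := mono)) P => [a|i] /=.
  by rewrite /mono /scale_var !mmapC.
rewrite monoX /W0 rmorphM rmorphXn /= /scale_var !mmapX !mmap1U exprZn -scalerAl -scalerAr.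
rewrite scalerA -exprM -exprD (_ : _ ^+ _ = 1) ?scale1r //; apply/eqP.
rewrite -(prim_order_dvd prim_inv) /wt /cwt /= p_gt1 mul1n; case: ltnP => ip; last by rewrite andbF.
by rewrite andbT; case: posnP => [->//|_]; rewrite subnKC // ltnW.
Qed.

Lemma h_map_u P : h (map_mpoly u P) = map_mpoly u (h P).
Proof.
by apply/mpolyP => m; rewrite mcoeff_sym !mcoeff_map_mpoly mcoeff_sym.
Qed.

(* The norm of the product of the W_i under g inverts it in a g-invariant way. *)
Lemma omega_norm : exists X Om : A, [/\ h X = X, h Om = Om, g (tofrac Om) = tofrac Om,
  Om != 0 & phiW omega * tofrac X = tofrac Om].
Proof.
pose B := theta (mono omega).
have hB : h B = B by rewrite /B h_theta scale_mono.
have hBi i : h (iter i (map_mpoly u) B) = iter i (map_mpoly u) B.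
  by elim: i => //= i IHi; rewrite h_map_u IHi.
have toB i : tofrac (iter i (map_mpoly u) B) = iter i g (phiW omega).
  by elim: i => //= i <-; rewrite gE.
exists (\prod_(i < n.-1) iter i.+1 (map_mpoly u) B), (\prod_(i < n) iter i (map_mpoly u) B).
have itn : iter n g (phiW omega) = phiW omega.
  rewrite rmorph_prod /=; elim: (index_enum _) => [|i r IHr].
    by rewrite big_nil; elim: (n) => //= k ->; rewrite rmorph1.
  rewrite big_cons; case: ifP => // ii; rewrite iter_rmorphM IHr; congr (_ * _).
  rewrite phiW_inner // iter_rmorphM.
  have zi m : iter n g (zn m) = zn m.
    have it k : iter k g (zn m) = zn (c ^ k * m).
      by elim: k => [|k IHk]; rewrite ?mul1n //= IHk g_zn expnS mulnA.
    rewrite it -zn_mod -[in RHS]zn_mod; congr (zn _); apply/eqP.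
    by rewrite -Fp_nat_eq natrM natrX (prim_expr_order prc) mul1r.
  congr (_ * _); first exact: zi.
  by elim: (p - i)%N => [|k IHk]; rewrite ?expr0 ?exprS ?iter_rmorphM ?IHk ?zi //;
    elim: (n) => //= k ->; rewrite rmorph1.
split.
- by rewrite rmorph_prod; apply: eq_bigr => i _; apply: hBi.
- by rewrite rmorph_prod; apply: eq_bigr => i _; apply: hBi.
- rewrite rmorph_prod (eq_bigr _ (fun i _ => toB _)) /= rmorph_prod.
  rewrite -(prednK n_gt0) big_ord_recr [in RHS]big_ord_recl /= mulrC -iterS prednK ?n_gt0 //.
  by rewrite itn.
- apply/prodf_neq0 => i _; rewrite -tofrac_eq0 toB iter_rmorph_eq0.
  by rewrite -(rmorph0 phiW) (inj_eq phiW_inj) omega_neq0.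
rewrite -[phiW omega]/(tofrac B) -tofracM; congr (tofrac _).
by case: (n) n_gt0 => // m _; rewrite big_ord_recl.
Qed.

(** * The polynomial ring of the rational model and the common localisation *)

Section RationalRing.
Variables (m : nat) (y : 'I_m -> E) (xi : algC) (alpha : A).
Hypothesis prxi : n.-primitive_root xi.
Hypothesis gy : forall j, g (y j) = y j.

Definition phiY : {mpoly algC[m]} -> E := mmap (@tofrac A \o @mpolyC _ _) y.
HB.instance Definition _ := GRing.RMorphism.copy phiY (mmap (@tofrac A \o @mpolyC _ _) y).

Hypothesis phiY_inj : injective phiY.
Hypotheses (alpha0 : alpha != 0) (h_alpha : h alpha = alpha).
Hypothesis g_alpha : g (tofrac alpha) = tofrac alpha.
Hypothesis y_alpha : forall j, exists2 a, h a = a & y j * tofrac alpha = tofrac a.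
Hypothesis y_denom : forall f, h f = f -> exists N Dn : {mpoly algC[m]},
  [/\ Dn != 0, g (phiY Dn) = phiY Dn & tofrac f * phiY Dn = phiY N].

Lemma phiYC a : phiY a%:MP = iota a.
Proof. exact: mmapC. Qed.

Lemma phiYX i : phiY 'X_i = y i.
Proof. by rewrite /phiY mmapX mmap1U. Qed.

Definition D1 : E -> Prop := loc_image phiY 1.

Lemma D1P x : D1 x -> exists P, x = phiY P.
Proof. by case=> k [a]; rewrite rmorph1 expr1n mulr1 => ->; exists a. Qed.

Lemma D1_phiY P : D1 (phiY P).
Proof. exact: image_loc. Qed.

Lemma D1_subring : is_subring D1. Proof. exact: loc_image_subring. Qed.

Lemma g_phiY P : g (phiY P) = phiY (map_mpoly u P).
Proof.
apply: (mpoly_rmorph_eq (f := g \o phiY) (g := phiY \o map_mpoly u)) P => [a|i] /=.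
  by rewrite phiYC g_iota map_mpolyC phiYC.
by rewrite map_mpolyX !phiYX gy.
Qed.

Lemma g'_phiY P : g' (phiY P) = phiY (map_mpoly (algC_invaut u) P).
Proof.
apply: (mpoly_rmorph_eq (f := g' \o phiY) (g := phiY \o map_mpoly (algC_invaut u))) P => [a|i] /=.
  by rewrite phiYC g'_iota map_mpolyC phiYC.
by rewrite map_mpolyX !phiYX -{1}gy gK.
Qed.

Lemma D1_unit x : unit_in D1 x <-> exists2 a, a != 0 & x = iota a.
Proof.
split=> [[x0 /D1P[P DP] /D1P[Q DQ]]|[a a0 ->]].
  have PQ : P * Q = 1.
    by apply: phiY_inj; rewrite rmorphM /= -DP -DQ (divff x0) rmorph1.
  have /mpoly_unitC[a a0 Da] : P \is a GRing.unit by apply/unitrPr; exists Q.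
  by exists a => //; rewrite DP Da phiYC.
rewrite -phiYC; exact: (@unit_in_image E _ phiY 1 phiY_inj _ (mpolyC_unit m a0)).
Qed.

Lemma loc_mpoly (D : E -> Prop) k (phi : {rmorphism {mpoly algC[k]} -> E}) P :
  is_subring D -> (forall a, D (phi a%:MP)) -> (forall i, D (phi 'X_i)) -> D (phi P).
Proof.
move=> sD DC DX; rewrite mpoly_rmorphE; apply: (sub_in_sum sD) => d _.
apply: (sub_inM sD); first exact: DC.
rewrite (mpolyXE_id _ d) rmorph_prod; apply: (sub_in_prod sD) => i _.
by rewrite rmorphXn; apply: (sub_inX sD); apply: DX.
Qed.

(** Each y_j is a C_p-invariant polynomial over alpha, and invariant polynomials lie in D2. *)
Lemma D1_loc x : D1 x -> loc D2 (tofrac alpha) x.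
Proof.
have Da := h_inv_D2 h_alpha; have sL := loc_subring D2_subring Da.
move=> /D1P[P ->]; apply: loc_mpoly => // [a|i] /=.
  by rewrite phiYC -phiWC; apply: sub_loc; apply: image_loc.
rewrite phiYX; have [a ha Dy] := y_alpha i; exists 1; rewrite expr1 Dy.
exact: h_inv_D2.
Qed.

Lemma D2_denominator : exists beta,
  [/\ D1 beta, beta != 0, g beta = beta & forall x, D2 x -> loc D1 beta x].
Proof.
have [X [Om [hX hOm gOm Om0 DOm]]] := omega_norm.
have hW i : h (theta (mono 'X_i)) = theta (mono 'X_i) by rewrite h_theta scale_mono.
have /choice[ND HND] i : exists ND : {mpoly algC[m]} * {mpoly algC[m]},
    [/\ ND.2 != 0, g (phiY ND.2) = phiY ND.2 & phiW 'X_i * phiY ND.2 = phiY ND.1].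
  by have [N [Dn H]] := y_denom (hW i); exists (N, Dn).
have [NX [DX [DX0 gDX HX]]] := y_denom hX.
have [NO [DO [DO0 gDO HO]]] := y_denom hOm.
pose b0 : {mpoly algC[m]} := (\prod_i (ND i).2) * DX * DO.
have b00 : b0 != 0.
  by rewrite /b0 !mulf_neq0 //; apply/prodf_neq0 => i _; case: (HND i).
have pb0 : phiY b0 != 0 by rewrite -(rmorph0 phiY) (inj_eq phiY_inj).
have gb0 : g (phiY b0) = phiY b0.
  rewrite /b0 !rmorphM !rmorph_prod /= gDX gDO; congr (_ * _ * _).
  by apply: eq_bigr => i _; case: (HND i).
have toOm0 : tofrac Om != 0 by rewrite tofrac_eq0.
have Db : D1 (tofrac Om * phiY b0).
  rewrite /b0 rmorphM mulrCA /= HO -rmorphM; exact: D1_phiY.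
(* b0 collects the y-denominators of all W_i, X and Om, so Om b0 lies in D1. Inverting beta inverts
   b0 and Om, which suffices because the inverse of omega is X / Om. *)
pose beta := phiY b0 * (tofrac Om * phiY b0).
have Dbeta : D1 beta by apply: (sub_inM D1_subring) => //; apply: D1_phiY.
have beta0 : beta != 0 := mulf_neq0 pb0 (mulf_neq0 toOm0 pb0).
have sL := loc_subring D1_subring Dbeta.
have binv : loc D1 beta beta^-1 := loc_inv D1_subring beta0.
have pb0inv : loc D1 beta (phiY b0)^-1.
  have -> : (phiY b0)^-1 = (tofrac Om * phiY b0) / beta.
    by rewrite /beta [phiY b0 * _]mulrC invfM mulrA (divff (mulf_neq0 toOm0 pb0)) mul1r.
  by apply: (sub_inM sL) => //; apply: sub_loc.
have Ominv : loc D1 beta (tofrac Om)^-1.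
  have -> : (tofrac Om)^-1 = (phiY b0 * phiY b0) / beta.
    by rewrite /beta mulrCA invfM mulrCA (divff (mulf_neq0 pb0 pb0)) mulr1.
  apply: (sub_inM sL) => //; apply: sub_loc.
  by apply: (sub_inM D1_subring); apply: D1_phiY.
have ldiv x P Q : x * phiY P = phiY Q -> (exists R, b0 = P * R) -> loc D1 beta x.
  move=> DQ [R DR]; rewrite -(mulfK pb0 x); apply: (sub_inM sL) => //.
  by rewrite DR rmorphM mulrA DQ -rmorphM; apply: sub_loc; apply: D1_phiY.
have lW i : loc D1 beta (phiW 'X_i).
  case: (HND i) => _ _ Hi; apply: ldiv Hi _.
  by rewrite /b0 (bigD1 i) //=; exists (\prod_(j | j != i) (ND j).2 * DX * DO); rewrite !mulrA.
have lX : loc D1 beta (tofrac X).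
  by apply: ldiv HX _; exists (\prod_i (ND i).2 * DO); rewrite /b0; ring.
exists beta; split=> //.
  by rewrite /beta !(rmorphM g) /= gb0 gOm.
move=> x Dx; have [k [a Da]] := Dx.
have w0 : phiW omega != 0 by rewrite -(rmorph0 phiW) (inj_eq phiW_inj) omega_neq0.
rewrite -(mulfK (expf_neq0 k w0) x) Da; apply: (sub_inM sL).
  apply: loc_mpoly => // d /=; rewrite phiWC -phiYC; exact/sub_loc/D1_phiY.
rewrite -exprVn; apply: (sub_inX sL).
have -> : (phiW omega)^-1 = tofrac X / tofrac Om.
  by apply: (mulIf w0); rewrite (mulVf w0) mulrAC [tofrac X * _]mulrC DOm (divff toOm0).
exact: (sub_inM sL).
Qed.

Theorem torus_certificate : exists a D : {poly int},
  [/\ ieval xi (a * D) = p%:R, ieval (c%:R : 'F_p) a = 0 &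
      forall z : 'F_p, z ^+ n = 1 -> z != c%:R -> ieval z D = 0].
Proof.
have [beta [Dbeta beta0 gbeta D2loc]] := D2_denominator.
have Da := h_inv_D2 h_alpha.
have toa0 : tofrac alpha != 0 by rewrite tofrac_eq0.
have [j Dj] := D1_loc Dbeta; have [k Dk] := D2loc _ Da.
have s1 := D1_subring; have s2 := D2_subring.
pose t := beta * (tofrac alpha * beta ^+ k).
pose s := tofrac alpha * (beta * tofrac alpha ^+ j).
have t0 : t != 0 := mulf_neq0 beta0 (mulf_neq0 toa0 (expf_neq0 k beta0)).
have s0 : s != 0 := mulf_neq0 toa0 (mulf_neq0 beta0 (expf_neq0 j toa0)).
have pF : p%:R = 0 :> 'F_p := pchar_Fp_0 p_pr.
have gt : g t = t by rewrite /t !(rmorphM g) (rmorphXn g) /= gbeta g_alpha.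
have gs : g s = s by rewrite /s !(rmorphM g) (rmorphXn g) /= gbeta g_alpha.
have z10 : z1 != 0 by apply: zn_neq0.
have D1f : factorial_in D1.
  apply: (@loc_image_factorial E _ phiY 1 phiY_inj _ (oner_neq0 _)).
  exact: mpoly_factorial.
apply: (@two_ring_certificate p n _ (c%:R : 'F_p) c%:Z xi p_gt0 pF prc erefl prxi E g g'
  D1 D2 s t z1 gK g'K s1 s2 D1f D2_factorial _ _ D2_g D2_g' _ t0 gt _ s0 gs _ _ z10).
- by move=> x /D1P[P ->]; rewrite g_phiY; apply: D1_phiY.
- by move=> x /D1P[P ->]; rewrite g'_phiY; apply: D1_phiY.
- exact: (sub_inM s1 Dbeta Dk).
- exact: (sub_inM s2 Da Dj).
- move=> x; split.
    exact: (loc_exchange s1 s2 Da Dbeta toa0 beta0 D1_loc Dj).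
  exact: (loc_exchange s2 s1 Dbeta Da beta0 toa0 D2loc Dk).
- by move=> x /D1_unit[a a0 ->]; apply: iota_unit.
- move=> f /D2_unit_Gp[e [a [e0 a0 ->]]]; exists e; first exact: e0.
  by apply/D1_unit; exists a; [exact: a0 | rewrite (mulfK (mact_neq0 g e z10))].
- exact: mact_unit.
by move=> e; rewrite -mact_const; apply: D1_unit.
Qed.

End RationalRing.
End Semilinear.
End TorusRing.

(** * From the abstract model in M to complex coefficients, through the field F0 = Q(x, t) *)

Section ConcreteModel.
Variables (p nt : nat) (M : fieldType) (f0 : {rmorphism rat -> M}).
Hypothesis p_gt0 : (0 < p)%N.
Hypothesis f0E : f0 =1 ratr.
Variables (x : 'I_p -> M) (t : 'I_nt -> M).
Hypotheses (Ix : alg_indep (@ratQ M) x) (It : alg_indep (cyclic_invariants x) t).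

Lemma rat_descent k (P : {mpoly M[k]}) : poly_over (@ratQ M) P ->
  exists P0 : {mpoly rat[k]}, P = map_mpoly f0 P0.
Proof.
move=> /choice[q Hq]; exists (\sum_(m <- msupp P) q m *: 'X_[m]).
rewrite {1}(mpolyE P) rmorph_sum /=; apply: eq_bigr => m _.
by rewrite map_mpolyZ map_mpolyX /= f0E -Hq.
Qed.

Lemma map_over_rat k (P0 : {mpoly rat[k]}) : poly_over (@ratQ M) (map_mpoly f0 P0).
Proof. by move=> m; exists P0@_m; rewrite mcoeff_map_mpoly /= f0E. Qed.

Lemma meval_map_rat k (v : 'I_k -> M) P0 : meval v (map_mpoly f0 P0) = mmap f0 v P0.
Proof.
apply: (mpoly_rmorph_eq (f := meval v \o map_mpoly f0) (g := mmap f0 v)) P0 => [a|i] /=.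
  by rewrite map_mpolyC mevalC mmapC.
by rewrite map_mpolyX mevalXU mmapX mmap1U.
Qed.

Lemma map_rat_inj k : injective (map_mpoly f0 : {mpoly rat[k]} -> {mpoly M[k]}).
Proof.
move=> P Q /mpolyP H; apply/mpolyP => m; have := H m.
by rewrite !mcoeff_map_mpoly; apply: fmorph_inj.
Qed.

Lemma indep_inj k (v : 'I_k -> M) : alg_indep (@ratQ M) v -> injective (mmap f0 v).
Proof.
move=> Iv P Q /eqP; rewrite -subr_eq0 -rmorphB /= -meval_map_rat => /eqP.
move/(Iv _ (@map_over_rat _ _)) => H; apply/eqP; rewrite -subr_eq0; apply/eqP.
by apply: map_rat_inj; rewrite H rmorph0.
Qed.

Local Notation evx := (mmap f0 x).
Local Notation s := (perm (@ordS_inj p)).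
Local Notation Rp := {mpoly rat[p]}.
Local Notation RN := {mpoly rat[p + nt]}.
Local Notation shN := (@msym (p + nt) rat (shift_var p nt)).

Definition xt (i : 'I_(p + nt)) : M :=
  match split i with inl j => x j | inr j => t j end.
Local Notation evM := (mmap f0 xt).

Lemma xtL j : xt (lshift nt j) = x j.
Proof. by rewrite /xt (unsplitK (inl j)). Qed.

Lemma xtR j : xt (rshift p j) = t j.
Proof. by rewrite /xt (unsplitK (inr j)). Qed.

Lemma evx_shift (q : Rp) : evx (msym s q) = mmap f0 (x \o @ordS p) q.
Proof.
apply: (mpoly_rmorph_eq (f := evx \o msym s) (g := mmap f0 (x \o @ordS p))) q => [a|i] /=.
  by rewrite [msym s _]mmapC !mmapC.
by rewrite /msym !mmapX !mmap1U mmapX mmap1U permE.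
Qed.

Lemma evx_invariant (q : Rp) : msym s q = q -> cyclic_invariants x (evx q).
Proof.
move=> sq; exists (map_mpoly f0 q), 1; split.
- exact: map_over_rat.
- by rewrite -(rmorph1 (map_mpoly f0)); apply: map_over_rat.
- by rewrite meval1 oner_neq0.
- by rewrite meval1 divr1 meval_map_rat.
by rewrite meval1 divr1 meval_map_rat -evx_shift sq.
Qed.

(** Polynomials in x and t seen as polynomials in t over Q[x], since the independence of t is given
    over the invariants of x. *)
Definition curry_var (i : 'I_(p + nt)) : {mpoly Rp[nt]} :=
  match split i with inl j => ('X_j)%:MP | inr j => 'X_j end.
Definition curry : RN -> {mpoly Rp[nt]} :=
  mmap (@mpolyC nt Rp \o @mpolyC p rat) curry_var.
HB.instance Definition _ := GRing.RMorphism.copy curry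
  (mmap (@mpolyC nt Rp \o @mpolyC p rat) curry_var).

Lemma curryL j : curry 'X_(lshift nt j) = ('X_j)%:MP.
Proof. by rewrite /curry mmapX mmap1U /curry_var (unsplitK (inl j)). Qed.

Lemma curryR j : curry 'X_(rshift p j) = 'X_j.
Proof. by rewrite /curry mmapX mmap1U /curry_var (unsplitK (inr j)). Qed.

Lemma curryC a : curry a%:MP = a%:MP%:MP.
Proof. exact: mmapC. Qed.

Definition widenL : Rp -> RN := mmap (@mpolyC _ rat) (fun j => 'X_(lshift nt j)).
HB.instance Definition _ := GRing.RMorphism.copy widenL
  (mmap (@mpolyC _ rat) (fun j => 'X_(lshift nt j) : RN)).

Lemma widenLX j : widenL 'X_j = 'X_(lshift nt j).
Proof. by rewrite /widenL mmapX mmap1U. Qed.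

Lemma widenLC a : widenL a%:MP = a%:MP.
Proof. exact: mmapC. Qed.

Lemma curry_inj : injective curry.
Proof.
pose G : {rmorphism {mpoly Rp[nt]} -> RN} := mmap widenL (fun j => 'X_(rshift p j)).
apply: (can_inj (g := G)).
apply: (mpoly_rmorph_eq (f := G \o curry) (g := idfun)) => [a|i] /=.
  by rewrite curryC mmapC /= widenLC.
case: (split_ordP i) => j ->; rewrite ?curryL ?curryR ?mmapC /= ?widenLX //.
by rewrite mmapX mmap1U.
Qed.

Lemma curry_shift P : curry (shN P) = map_mpoly (msym s) (curry P).
Proof.
apply: (mpoly_rmorph_eq (f := curry \o shN) (g := map_mpoly (msym s) \o curry)) P => [a|i] /=.
  by rewrite [shN _]mmapC curryC map_mpolyC /= [msym s _]mmapC.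
rewrite {1}/msym mmapX mmap1U; case: (split_ordP i) => j ->.
  by rewrite shift_varL !curryL map_mpolyC /= /msym mmapX mmap1U permE.
by rewrite shift_varR curryR map_mpolyX.
Qed.

Lemma evM_curry P : evM P = meval t (map_mpoly evx (curry P)).
Proof.
apply: (mpoly_rmorph_eq (f := evM) (g := meval t \o (map_mpoly evx \o curry))) P => [a|i] /=.
  by rewrite mmapC curryC map_mpolyC mevalC /= mmapC.
rewrite mmapX mmap1U; case: (split_ordP i) => j ->.
  by rewrite xtL curryL map_mpolyC mevalC /= mmapX mmap1U.
by rewrite xtR curryR map_mpolyX mevalXU.
Qed.

Lemma curried_invariant (Q : {mpoly Rp[nt]}) : map_mpoly (msym s) Q = Q ->
  poly_over (cyclic_invariants x) (map_mpoly evx Q).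
Proof.
move=> sQ m; rewrite mcoeff_map_mpoly; apply: evx_invariant.
by rewrite -{2}sQ mcoeff_map_mpoly.
Qed.

Lemma evM_invariant P : shN P = P -> gen_field (cyclic_invariants x) t (evM P).
Proof.
move=> shP; exists (map_mpoly evx (curry P)), 1; split.
- by apply: curried_invariant; rewrite -curry_shift shP.
- rewrite -(rmorph1 (map_mpoly evx)); apply: curried_invariant.
  by rewrite rmorph1.
- by rewrite meval1 oner_neq0.
by rewrite meval1 divr1 evM_curry.
Qed.

Lemma msym_norm_fixed k (R : comNzRingType) (w : {perm 'I_k}) (P : {mpoly R[k]}) :
  msym w (\prod_(i < #[w]%g) iter i (msym w) P) = \prod_(i < #[w]%g) iter i (msym w) P.
Proof.
have it j Q : iter j (@msym k R w) Q = msym (w ^+ j)%g Q.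
  by elim: j => [|j IHj]; rewrite ?msym1m //= IHj -msymMm expgSr.
rewrite rmorph_prod /=; case: #[w]%g (order_gt0 w) (expg_order w) => // j _ wj.
rewrite big_ord_recr [in RHS]big_ord_recl /= mulrC; congr (_ * _).
by rewrite -iterS it wj msym1m.
Qed.

(** t is only known to be independent over the fixed field, so a relation P is replaced by the
    product of its shifts; this norm has invariant coefficients, hence is 0, and so is one of its
    factors. *)
Lemma evM_inj : injective evM.
Proof.
suff H P : evM P = 0 -> P = 0.
  by move=> P Q /eqP; rewrite -subr_eq0 -rmorphB => /eqP/H/eqP; rewrite subr_eq0 => /eqP.
move=> P0; pose Nm := \prod_(i < #[shift_var p nt]%g) iter i shN P.
have /curried_invariant/It H : map_mpoly (msym s) (curry Nm) = curry Nm.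
  by rewrite -curry_shift msym_norm_fixed.
have Nm0 : Nm = 0.
  apply: curry_inj; rewrite rmorph0; apply/mpolyP => m.
  apply: (indep_inj Ix); rewrite mcoeff0 rmorph0 -mcoeff_map_mpoly H ?mcoeff0 //.
  rewrite -evM_curry rmorph_prod /=.
  by case: #[_]%g (order_gt0 (shift_var p nt)) => // j _; rewrite big_ord_recl /= P0 mul0r.
have /eqP/prodf_eq0[i _] := Nm0; elim: (i : nat) => [/eqP//|j IHj] /=.
move/eqP => sh0; apply: IHj; apply/eqP/mpolyP => m; rewrite mcoeff0.
have := congr1 (mcoeff [multinom m ((shift_var p nt)^-1 i)%g | i < p + nt]) sh0.
rewrite mcoeff_sym mcoeff0 => <-; congr (mcoeff _ _); apply/mnmP => k.
by rewrite !mnmE permK.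
Qed.

Lemma common_denominator (R : idomainType) k (phi : 'I_k -> {fraction R}) :
  exists2 d : R, d != 0 & forall i, exists a, phi i * tofrac d = tofrac a.
Proof.
have /choice[ab Hab] i : exists ab : R * R, ab.2 != 0 /\ phi i = tofrac ab.1 / tofrac ab.2.
  by have [a [b H]] := fraction_num_den (phi i); exists (a, b).
exists (\prod_i (ab i).2); first by apply/prodf_neq0 => i _; case: (Hab i).
move=> i; have [b0 ->] := Hab i.
have tb0 : tofrac (ab i).2 != 0 by rewrite tofrac_eq0.
exists ((ab i).1 * \prod_(j | j != i) (ab j).2).
by rewrite (bigD1 i) //= !tofracM mulrA (mulfVK tb0).
Qed.

Variables (m : nat) (y : 'I_m -> M).
Hypothesis Iy : alg_indep (@ratQ M) y.
Hypothesis Ey : forall z, gen_field (cyclic_invariants x) t z <-> gen_field (@ratQ M) y z.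
Local Notation F0 := {fraction RN}.
Variables (jM : {rmorphism F0 -> M}) (sh : {rmorphism F0 -> F0}).
Hypothesis jME : forall P, jM (tofrac P) = evM P.
Hypothesis shE : forall P, sh (tofrac P) = tofrac (shN P).

(** The copy in M of the fixed field of C_p on Q(x, t); it contains K(t), with K the fixed field on
    Q(x). *)
Definition inv_image (z : M) : Prop := exists2 f : F0, jM f = z & sh f = f.

Lemma inv_imageD a b : inv_image a -> inv_image b -> inv_image (a + b).
Proof. by move=> [f <- sf] [g <- sg]; exists (f + g); rewrite rmorphD // sf sg. Qed.

Lemma inv_imageM a b : inv_image a -> inv_image b -> inv_image (a * b).
Proof. by move=> [f <- sf] [g <- sg]; exists (f * g); rewrite rmorphM // sf sg. Qed.

Lemma inv_imageV a : inv_image a -> inv_image a^-1.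
Proof. by move=> [f <- sf]; exists f^-1; rewrite fmorphV // sf. Qed.

Lemma inv_image_rat q : inv_image (f0 q).
Proof.
exists (tofrac q%:MP); first by rewrite jME mmapC.
by rewrite shE [shN _]mmapC.
Qed.

Lemma inv_image_meval k (v : 'I_k -> M) (P : {mpoly M[k]}) :
  (forall i, inv_image (v i)) -> poly_over inv_image P -> inv_image (meval v P).
Proof.
move=> Iv IP; rewrite mevalE; elim/big_ind: _ => [||d _].
- by rewrite -(rmorph0 f0); apply: inv_image_rat.
- exact: inv_imageD.
apply: inv_imageM; first exact: IP.
have one : inv_image 1 by rewrite -(rmorph1 f0); apply: inv_image_rat.
elim/big_ind: _ => // [|i _]; first exact: inv_imageM.
by elim: (d i) => [|e IHe]; rewrite ?expr0 // exprS; apply: inv_imageM.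
Qed.

Lemma evx_widen q : jM (tofrac (widenL q)) = evx q.
Proof.
rewrite jME; apply: (mpoly_rmorph_eq (f := evM \o widenL) (g := evx)) q => [a|i] /=.
  by rewrite widenLC !mmapC.
by rewrite widenLX !mmapX !mmap1U xtL.
Qed.

Lemma sh_widen q : sh (tofrac (widenL q)) = tofrac (widenL (msym s q)).
Proof.
rewrite shE; congr (tofrac _).
apply: (mpoly_rmorph_eq (f := shN \o widenL) (g := widenL \o msym s)) q => [a|i] /=.
  by rewrite widenLC [msym s _]mmapC widenLC [msym _ _]mmapC.
by rewrite /msym widenLX !mmapX !mmap1U widenLX shift_varL permE.
Qed.

Lemma inv_image_cyclic z : cyclic_invariants x z -> inv_image z.
Proof.
move=> [A [B [/rat_descent[A0 ->] /rat_descent[B0 ->]]]].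
rewrite !meval_map_rat -!evx_shift => B0n0 Dz1 Dz2.
exists (tofrac (widenL A0) / tofrac (widenL B0)).
  by rewrite fmorph_div !evx_widen.
apply: (fmorph_inj jM); rewrite !fmorph_div !sh_widen !evx_widen.
by rewrite -Dz1 -Dz2.
Qed.

Lemma gen_field_inv_image z : gen_field (cyclic_invariants x) t z -> inv_image z.
Proof.
move=> [A [B [hA hB _ ->]]].
have It' i : inv_image (t i).
  exists (tofrac 'X_(rshift p i)); first by rewrite jME mmapX mmap1U xtR.
  by rewrite shE /msym mmapX mmap1U shift_varR.
apply: inv_imageM; last apply: inv_imageV.
  by apply: inv_image_meval => // d; apply/inv_image_cyclic/hA.
by apply: inv_image_meval => // d; apply/inv_image_cyclic/hB.
Qed.

Lemma y_lift : exists Y : 'I_m -> F0, (forall j, jM (Y j) = y j) /\ (forall j, sh (Y j) = Y j).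
Proof.
have /choice[Y HY] j : exists f, jM f = y j /\ sh f = f.
  have /gen_field_inv_image[f] : gen_field (cyclic_invariants x) t (y j).
    apply/Ey; exists 'X_j, 1; split.
    - by rewrite -(map_mpolyX f0); apply: map_over_rat.
    - by rewrite -(rmorph1 (map_mpoly f0)); apply: map_over_rat.
    - by rewrite meval1 oner_neq0.
    by rewrite mevalXU meval1 divr1.
  by exists f.
by exists Y; split=> j; case: (HY j).
Qed.

Variable Y : 'I_m -> F0.
Hypotheses (jMY : forall j, jM (Y j) = y j) (shY : forall j, sh (Y j) = Y j).
Local Notation cst := (@tofrac RN \o @mpolyC _ rat).
Local Notation evY := (mmap cst Y).

Lemma jM_evY Q : jM (evY Q) = mmap f0 y Q.
Proof.
apply: (mpoly_rmorph_eq (f := jM \o evY) (g := mmap f0 y)) Q => [a|i] /=.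
  by rewrite !mmapC /= jME mmapC.
by rewrite !mmapX !mmap1U jMY.
Qed.

Lemma evY_inj : injective evY.
Proof.
move=> P Q PQ; apply: (indep_inj Iy); rewrite -!jM_evY.
by rewrite PQ.
Qed.

Local Notation A := {mpoly algC[p + nt]}.
Local Notation E := {fraction A}.
Local Notation mr := (map_mpoly (ratr : rat -> algC)).
Variable jE : {rmorphism F0 -> E}.
Hypothesis jEE : forall P, jE (tofrac P) = tofrac (mr P).
Local Notation y' := (fun j => jE (Y j)).
Local Notation h := (@msym (p + nt) algC (shift_var p nt)).

Lemma jE_evY Q : jE (evY Q) = phiY y' (mr Q).
Proof.
apply: (mpoly_rmorph_eq (f := jE \o evY) (g := @phiY p nt m y' \o mr)) Q => [a|i] /=.
  by rewrite mmapC /= jEE !map_mpolyC phiYC.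
by rewrite mmapX mmap1U map_mpolyX phiYX.
Qed.

Lemma h_map_ratr P : h (mr P) = mr (shN P).
Proof. by apply/mpolyP => d; rewrite mcoeff_sym !mcoeff_map_mpoly mcoeff_sym. Qed.

(** Independence over Q persists over C: the coefficients are split along a Q-linearly independent
    family, and after clearing a common denominator each rational component is a relation over Q. *)
Lemma phiY_lift_inj : injective (phiY y').
Proof.
suff H P : phiY y' P = 0 -> P = 0.
  by move=> P Q /eqP; rewrite -subr_eq0 -rmorphB => /eqP/H/eqP; rewrite subr_eq0 => /eqP.
have [r [b [Q [free ->]]]] := mpoly_rat_coords P => _ P0.
have [d d0 /choice[a Ha]] := common_denominator (fun i => evY (Q i)).
have S0 : \sum_i b i *: mr (a i) = 0.
  apply: tofrac_inj; rewrite tofrac0 (raddf_sum (@tofrac A)) /=.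
  transitivity (phiY y' (\sum_i b i *: mr (Q i)) * jE (tofrac d)); last first.
    by rewrite P0 mul0r.
  rewrite (raddf_sum (@phiY p nt m y')) mulr_suml; apply: eq_bigr => i _.
  rewrite -!mul_mpolyC !rmorphM /= -jEE -Ha (rmorphM jE) jE_evY mulrA.
  by rewrite [phiY _ (_ * _)](rmorphM (@phiY p nt m y')) /= phiYC.
rewrite big1 // => i _; have -> : Q i = 0; last by rewrite rmorph0 scaler0.
have ai0 : a i = 0.
  apply/mpolyP => e; rewrite mcoeff0; apply: (free (fun i => (a i)@_e)).
  have := congr1 (mcoeff e) S0; rewrite raddf_sum mcoeff0 /= => H; rewrite -[RHS]H.
  by apply: eq_bigr => j _; rewrite mcoeffZ mcoeff_map_mpoly mulrC.
apply: evY_inj; rewrite rmorph0; apply/eqP; have := Ha i; rewrite ai0 tofrac0 => /eqP.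
by rewrite mulf_eq0 tofrac_eq0 (negPf d0) orbF.
Qed.

(** The norm of any common denominator is invariant, and then so are the numerators, because the Y_j
    are fixed. *)
Lemma invariant_denominator : exists alpha : RN,
  [/\ alpha != 0, shN alpha = alpha &
      forall j, exists2 a, shN a = a & Y j * tofrac alpha = tofrac a].
Proof.
have [d d0 Hd] := common_denominator Y.
pose al := \prod_(i < #[shift_var p nt]%g) iter i shN d.
have shal : shN al = al by apply: msym_norm_fixed.
have inj_sh : injective shN.
  by move=> P Q /(congr1 (@tofrac RN)); rewrite -!shE => /(fmorph_inj sh)/tofrac_inj.
exists al; split=> //.
  apply/prodf_neq0 => i _; elim: (i : nat) => //= j; apply: contraNneq => sh0.
  by apply/eqP/inj_sh; rewrite sh0 rmorph0.
have [e De] : exists e, al = d * e.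
  rewrite /al; case: #[_]%g (order_gt0 (shift_var p nt)) => // k _.
  by rewrite big_ord_recl; exists (\prod_(i < k) iter i.+1 shN d).
move=> j; have [a Ha] := Hd j.
have Dal : Y j * tofrac al = tofrac (a * e) by rewrite De !tofracM mulrA Ha.
exists (a * e) => //; apply: tofrac_inj; rewrite -shE -Dal (rmorphM sh) shY shE shal //.
Qed.

(** The rational components of an invariant are invariant, and each lies in K(t) = Q(y). Keeping the
    denominator rational makes it fixed by g. *)
Lemma invariant_rational f : h f = f -> exists N Dn : {mpoly algC[m]},
  [/\ Dn != 0, exists Dr, Dn = mr Dr & tofrac f * phiY y' Dn = phiY y' N].
Proof.
move=> hf; have [r [b [Q [_ Df sym]]]] := mpoly_rat_coords f.
have shQ i : shN (Q i) = Q i.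
  apply/mpolyP => d; rewrite mcoeff_sym; apply: sym; rewrite -mcoeff_sym.
  by rewrite hf.
have /choice[AB HAB] i : exists AB : {mpoly rat[m]} * {mpoly rat[m]},
    AB.2 != 0 /\ tofrac (mr (Q i)) * phiY y' (mr AB.2) = phiY y' (mr AB.1).
  have := evM_invariant (shQ i); rewrite Ey => -[A0 [B0]].
  case=> /rat_descent[A1 ->] /rat_descent[B1 ->]; rewrite !meval_map_rat => B1n0 DQ.
  exists (A1, B1); split=> /=.
    by apply: contraNneq B1n0 => ->; rewrite rmorph0.
  rewrite -jEE -!jE_evY -(rmorphM jE); congr (jE _).
  by apply: (fmorph_inj jM); rewrite (rmorphM jM) !jM_evY jME DQ (mulfVK B1n0).
exists (\sum_i b i *: (mr (AB i).1 * \prod_(j | j != i) mr (AB j).2)),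
  (\prod_i mr (AB i).2); split.
- apply/prodf_neq0 => i _; have [B0 _] := HAB i; apply: contraNneq B0 => B0.
  apply/eqP/mpolyP => d; rewrite mcoeff0; have := congr1 (mcoeff d) B0.
  by rewrite mcoeff_map_mpoly mcoeff0 => /eqP; rewrite fmorph_eq0 => /eqP.
- by exists (\prod_i (AB i).2); rewrite rmorph_prod.
rewrite [in LHS]Df !rmorph_sum mulr_suml; apply: eq_bigr => i _.
rewrite (bigD1 i) //= -!mul_mpolyC !rmorphM /= phiYC; have [_ <-] := HAB i.
by rewrite !mulrA.
Qed.

End ConcreteModel.

Theorem noether_certificate p c (xi : algC) :
    prime p -> stably_rational_QCp p ->
    (p.-1).-primitive_root (c%:R : 'F_p) -> (p.-1).-primitive_root xi ->
  exists a D : {poly int},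
  [/\ ieval xi (a * D) = p%:R, ieval (c%:R : 'F_p) a = 0 &
      forall z : 'F_p, z ^+ p.-1 = 1 -> z != c%:R -> ieval z D = 0].
Proof.
move=> p_pr [M [chM [x [Ix [nt [t [It [m [y [Iy Ey]]]]]]]]]] prc prxi.
have p_gt0 := prime_gt0 p_pr.
have [f0 f0E] := char0_ratr chM.
have [zeta prz] := C_prim_root_exists p_gt0.
have cp : coprime c p.
  rewrite coprime_sym prime_coprime // (dvdn_pcharf (pchar_Fp p_pr)).
  by rewrite (prim_root_eq0 prc) -lt0n; apply: prim_order_gt0 prc.
have [u Hu] := Qn_aut_exists cp.
have uz : u zeta = zeta ^+ c by apply/Hu/prim_expr_order.
pose RN := {mpoly rat[p + nt]}; pose A := {mpoly algC[p + nt]}.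
have map_inj (R S : fieldType) k (f : {rmorphism R -> S}) :
    injective (map_mpoly f : {mpoly R[k]} -> {mpoly S[k]}).
  move=> P Q /mpolyP H; apply/mpolyP => d; have := H d.
  by rewrite !mcoeff_map_mpoly; apply: fmorph_inj.
have [jM jME] := fraction_lift (evM_inj f0E Ix It).
have msymK (R : comNzRingType) k (w : {perm 'I_k}) : injective (@msym k R w).
  by move=> P Q PQ; rewrite -[P]msym1m -[Q]msym1m -(mulgV w) !msymMm PQ.
have shi : injective (@tofrac RN \o msym (shift_var p nt)).
  by move=> P Q /tofrac_inj/msymK.
have [sh shE] := fraction_lift shi.
have jEi : injective (@tofrac A \o map_mpoly (ratr : rat -> algC)).
  by move=> P Q /tofrac_inj/map_inj.
have [jE jEE] := fraction_lift jEi.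
have gi : injective (@tofrac A \o map_mpoly u) by move=> P Q /tofrac_inj/map_inj.
have [g gE] := fraction_lift gi.
have gi' : injective (@tofrac A \o map_mpoly (algC_invaut u)).
  by move=> P Q /tofrac_inj/map_inj.
have [g' gE'] := fraction_lift gi'.
have gK : cancel g g'.
  apply: (fraction_rmorph_eq (f := g' \o g) (g := idfun)) => P /=.
  rewrite gE /= gE' /=; congr (tofrac _); apply/mpolyP => d.
  by rewrite !mcoeff_map_mpoly /= algC_autK.
have g'K : cancel g' g.
  apply: (fraction_rmorph_eq (f := g \o g') (g := idfun)) => P /=.
  rewrite gE' /= gE /=; congr (tofrac _); apply/mpolyP => d.
  by rewrite !mcoeff_map_mpoly /= algC_invautK.
have [Y [jMY shY]] := y_lift f0E Ey jME shE.
have map_u k (P : {mpoly rat[k]}) : map_mpoly u (map_mpoly ratr P) = map_mpoly ratr P.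
  by apply/mpolyP => d; rewrite !mcoeff_map_mpoly /= fmorph_rat.
have gjE : forall f, g (jE f) = jE f.
  apply: (fraction_rmorph_eq (f := g \o jE) (g := jE)) => P /=.
  by rewrite jEE /= gE /= map_u.
have [al [al0 shal Hal]] := invariant_denominator shE shY.
have hm := @h_map_ratr p nt.
apply: (@torus_certificate p nt c zeta u p_pr prz uz prc g g' gE gK g'K m
  (fun j => jE (Y j)) xi (map_mpoly ratr al) prxi).
- by move=> j; apply: gjE.
- exact: (phiY_lift_inj f0E Iy jME jMY jEE).
- by rewrite -(rmorph0 (map_mpoly (ratr : rat -> algC))) (inj_eq (@map_inj _ _ _ _)).
- by rewrite hm shal.
- by rewrite gE /= map_u.
- move=> j; have [a sha Ha] := Hal j; exists (map_mpoly ratr a); first by rewrite hm sha.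
  have := congr1 jE Ha; rewrite (rmorphM jE) !jEE; exact.
move=> f hf; have [N [Dn [Dn0 [Dr DDn] HN]]] := invariant_rational f0E Ey jME jMY jEE hf.
exists N, Dn; split=> //; rewrite DDn.
by rewrite -(jE_evY Y jEE Dr) gjE.
Qed.

(** * Generators of degree one primes in cyclotomic rings *)

Section CyclotomicEvaluation.
Variables (n : nat) (xi : algC).
Hypothesis prx : n.-primitive_root xi.
Implicit Types (f e : {poly int}).

Let n_gt0 : (0 < n)%N. Proof. exact: prim_order_gt0 prx. Qed.

Lemma ieval_rmorph (S T : comNzRingType) (g : {rmorphism S -> T}) (z : S) e :
  g (ieval z e) = ieval (g z) e.
Proof.
elim/poly_ind: e => [|e a IHe]; first by rewrite !rmorph0.
by rewrite !rmorphD !rmorphM /= IHe !ievalX !ievalC rmorph_int.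
Qed.

Lemma ieval_comp (S : comNzRingType) (z : S) e k :
  ieval z (e \Po 'X^k) = ieval (z ^+ k) e.
Proof.
elim/poly_ind: e => [|e a IHe]; first by rewrite comp_poly0 !rmorph0.
rewrite comp_polyD comp_polyM comp_polyX comp_polyC !rmorphD !rmorphM /= IHe.
by rewrite rmorphXn /= !ievalX !ievalC.
Qed.

Lemma ieval_horner e (z : int) : ieval z e = e.[z].
Proof.
elim/poly_ind: e => [|e a IHe]; first by rewrite rmorph0 horner0.
by rewrite rmorphD rmorphM /= IHe ievalX ievalC hornerMXaddC intz.
Qed.

Lemma conj_aut k : coprime k n -> exists u : {rmorphism algC -> algC}, u xi = xi ^+ k.
Proof.
by move=> kn; have [u Hu] := Qn_aut_exists kn; exists u; apply/Hu/prim_expr_order.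
Qed.

Lemma ieval_Phi k : coprime k n -> ieval (xi ^+ k) 'Phi_n = 0.
Proof.
move=> kn; rewrite /ieval /= (Cintr_Cyclotomic prx).
by apply/rootP; rewrite (root_cyclotomic prx) (prim_root_exp_coprime _ prx).
Qed.

(** The remainder modulo Phi_n minus rho has more roots than its degree allows, so it is 0. This
    replaces integrality and Galois descent: a value common to all primitive n-th roots of unity is
    an integer. *)
Lemma ieval_const f (rho : algC) :
    (forall k, coprime k n -> ieval (xi ^+ k) f = rho) ->
  exists (N : int) q, f = N%:P + q * 'Phi_n /\ rho = N%:~R.
Proof.
move=> fk; pose r := f %% 'Phi_n.
have Df : f = f %/ 'Phi_n * 'Phi_n + r.
  by apply: Pdiv.IdomainMonic.divp_eq; apply: Cyclotomic_monic.
have szr : (size r <= totient n)%N.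
  have Phi0 : 'Phi_n != 0 by apply: monic_neq0; apply: Cyclotomic_monic.
  by have := ltn_modpN0 f Phi0; rewrite size_Cyclotomic ltnS.
have rk k : coprime k n -> ieval (xi ^+ k) r = rho.
  move=> kn; have := fk k kn; rewrite {1}Df rmorphD rmorphM /= ieval_Phi //.
  by rewrite mulr0 add0r.
pose R := map_poly intr r - rho%:P : {poly algC}.
have R0 : R = 0.
  apply/eqP; apply/negPn/negP => Rn0.
  pose rs := [seq xi ^+ k | k <- [seq k <- iota 0 n | coprime k n]].
  have : (size rs < size R)%N.
    apply: (max_poly_roots Rn0).
      apply/allP => z /mapP[k]; rewrite mem_filter => /andP[kn _] ->.
      by apply/rootP; rewrite hornerD hornerN hornerC -[X in X - _]/(ieval _ r) rk // subrr.
    rewrite map_inj_in_uniq ?filter_uniq ?iota_uniq // => i j.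
    rewrite !mem_filter !mem_iota /= !add0n => /andP[_ iltn] /andP[_ jltn] /eqP.
    by rewrite (eq_prim_root_expr prx) !modn_small // => /eqP.
  rewrite size_map size_filter; apply/negP; rewrite -leqNgt.
  have -> : count (coprime^~ n) (iota 0 n) = totient n.
    rewrite totient_count_coprime -sum1_count big_mkcond /index_iota subn0.
    by apply: eq_bigr => i _; rewrite coprime_sym; case: coprime.
  apply: leq_trans (size_polyD _ _) _; rewrite geq_max size_polyN size_polyC.
  have -> : size (map_poly intr r : {poly algC}) = size r.
    by apply: size_map_inj_poly => //; apply: intr_inj.
  by rewrite szr; case: eqP => //= _; rewrite totient_gt0.
have Dr : map_poly intr r = rho%:P by apply/eqP; rewrite -subr_eq0 -/R R0.
have Dr0 : rho = (r`_0)%:~R by rewrite -coef_map Dr coefC.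
have Dr1 : r = (r`_0)%:P.
  apply: (map_inj_poly (f := intr : int -> algC)) => //; first exact: intr_inj.
  by rewrite Dr map_polyC /= Dr0.
by exists r`_0, (f %/ 'Phi_n); split=> //; rewrite -Dr1 addrC.
Qed.

Lemma ieval_zero f : ieval xi f = 0 -> exists q, f = q * 'Phi_n.
Proof.
move=> f0; have [|N [q [-> N0]]] := @ieval_const f 0.
  by move=> k /conj_aut[u <-]; rewrite -ieval_rmorph f0 rmorph0.
exists q; have /eqP := N0; rewrite eq_sym intr_eq0 => /eqP->.
by rewrite add0r.
Qed.

Lemma coprime_prod_reindex (R : comNzRingType) (F : nat -> R) l :
    coprime l n -> (forall k, F (k %% n)%N = F k) ->
  \prod_(k < n | coprime k n) F (l * k)%N = \prod_(k < n | coprime k n) F k.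
Proof.
move=> ln Fn; pose phi (k : 'I_n) : 'I_n := Ordinal (ltn_pmod (l * k) n_gt0).
have phi_inj : injective phi.
  move=> i j /(congr1 val)/= /eqP; wlog ij : i j / (i <= j)%N.
    by move=> W; case/orP: (leq_total i j) => [/W//|/W H]; rewrite eq_sym => /H.
  rewrite eq_sym eqn_mod_dvd ?leq_mul2l ?ij ?orbT // -mulnBr Gauss_dvdr ?(coprime_sym n) //.
  rewrite -eqn_mod_dvd // !modn_small // => /eqP ji.
  exact/esym/val_inj.
rewrite [RHS](reindex_inj phi_inj); apply: eq_big => k; last by rewrite /= Fn.
by rewrite /= coprime_modl coprimeMl ln.
Qed.

Lemma xi_mod k : xi ^+ (k %% n) = xi ^+ k.
Proof. exact: prim_expr_mod. Qed.

Lemma norm_reindex (R : comNzRingType) (F : algC -> R) l : coprime l n ->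
  \prod_(k < n | coprime k n) F (xi ^+ (l * k)) = \prod_(k < n | coprime k n) F (xi ^+ k).
Proof.
by move=> ln; apply: (@coprime_prod_reindex _ (fun k => F (xi ^+ k))) => // k; rewrite xi_mod.
Qed.

(** The norm is also obtained as a polynomial identity modulo Phi_n, so that it can be evaluated at
    c modulo p^2. *)
Lemma norm_int f : exists (N : int) q,
  \prod_(k < n | coprime k n) (f \Po 'X^k) = N%:P + q * 'Phi_n /\
  \prod_(k < n | coprime k n) ieval (xi ^+ k) f = N%:~R.
Proof.
apply: ieval_const => l ln; rewrite rmorph_prod /=.
rewrite -(norm_reindex (fun z => ieval z f) ln); apply: eq_bigr => k _.
by rewrite ieval_comp exprM.
Qed.

Lemma ieval_neq0 f k : coprime k n -> ieval xi f != 0 -> ieval (xi ^+ k) f != 0.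
Proof. by move=> /conj_aut[u <-]; rewrite -ieval_rmorph fmorph_eq0. Qed.

Lemma norm_ge1 f : ieval xi f != 0 ->
  1 <= \prod_(k < n | coprime k n) `|ieval (xi ^+ k) f|.
Proof.
move=> f0; have [N [q [_ DN]]] := norm_int f; rewrite -normr_prod DN.
have N0 : N != 0.
  rewrite -(intr_eq0 algC) -DN; apply/prodf_neq0 => k kn; exact: ieval_neq0.
by rewrite -intr_norm -[1]/(1%:~R) ler_int -gtz0_ge1 normr_gt0.
Qed.

End CyclotomicEvaluation.

Lemma int_poly_mod (q : nat) (f : {poly int}) : prime q ->
  map_poly (intr : int -> 'F_q) f = 0 -> exists h, f = q%:Z *: h.
Proof.
move=> q_pr f0; exists (\poly_(i < size f) (f`_i %/ q%:Z)%Z).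
apply/polyP => i; rewrite coefZ coef_poly; case: ltnP => [_|le]; last first.
  by rewrite mulr0 nth_default.
rewrite mulrC divzK // -(Fp_int_eq0 _ q_pr) -coef_map /= f0 coef0 eqxx //.
Qed.

Lemma frobenius_congruence (q : nat) (f : {poly int}) : prime q ->
  exists h, f ^+ q = (f \Po 'X^q) + q%:Z *: h.
Proof.
move=> q_pr; have [|h Dh] := @int_poly_mod q (f ^+ q - (f \Po 'X^q)) q_pr; last first.
  by exists h; rewrite -Dh addrCA subrr addr0.
rewrite rmorphB rmorphXn /= map_comp_poly map_polyXn; apply/eqP; rewrite subr_eq0; apply/eqP.
have chq : q \in [pchar {poly 'F_q}] by rewrite pchar_poly; apply: pchar_Fp.
move: (map_poly _ f) => g; elim/poly_ind: g => [|g a IHg].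
  by rewrite expr0n comp_poly0 eqn0Ngt prime_gt0.
rewrite -(pFrobenius_autE chq) pFrobenius_autD_comm; last exact: mulrC.
rewrite pFrobenius_autM_comm ?pFrobenius_autE; last exact: mulrC.
rewrite IHg comp_polyD comp_polyM comp_polyX comp_polyC; congr (_ + _).
by rewrite -polyC_exp; have := expf_card a; rewrite card_Fp // => ->.
Qed.

(** * The norm of a(xi) and the inequalities it must satisfy *)

Section NormCertificate.
Variables (p c : nat) (xi : algC) (a D : {poly int}).
Local Notation n := p.-1.
Hypotheses (p_pr : prime p) (prx : n.-primitive_root xi).
Hypothesis prc : n.-primitive_root (c%:R : 'F_p).
Hypothesis Phic : (p%:Z ^+ 2 %| ('Phi_n).[c%:Z])%Z.
Hypotheses (aD : ieval xi (a * D) = p%:R) (ac : ieval (c%:R : 'F_p) a = 0).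
Hypothesis Dc : forall z : 'F_p, z ^+ n = 1 -> z != c%:R -> ieval z D = 0.

Hypothesis p_gt3 : (3 < p)%N.

Let n_gt0 : (0 < n)%N. Proof. exact: prim_order_gt0 prx. Qed.
Let n_gt2 : (2 < n)%N. Proof. by rewrite -ltnS prednK // ltnW // ltnW // ltnW. Qed.
Let d := totient n.

Lemma ieval_Fp k e : ieval ((c%:R : 'F_p) ^+ k) e = (e.[c%:Z ^+ k])%:~R.
Proof. by rewrite -ieval_horner ieval_rmorph rmorphXn. Qed.

Lemma Phi_pow k : coprime k n -> (p%:Z ^+ 2 %| ('Phi_n).[c%:Z ^+ k])%Z.
Proof.
move=> kn; have [q Dq] : exists q, 'Phi_n \Po 'X^k = q * 'Phi_n.
  by apply: (ieval_zero prx); rewrite ieval_comp ieval_Phi.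
have -> : ('Phi_n).[c%:Z ^+ k] = ('Phi_n \Po 'X^k).[c%:Z] by rewrite horner_comp hornerXn.
by rewrite Dq hornerM dvdz_mull.
Qed.

(** Sending xi to c is a ring map from Z[xi] to F_p; all later non-vanishing is tested this way. *)
Lemma neq0_criterion f : ieval (c%:R : 'F_p) f != 0 -> ieval xi f != 0.
Proof.
apply: contraNneq => /(ieval_zero prx)[q ->].
rewrite rmorphM /= -[c%:R in X in _ * X]expr1 ieval_Fp; apply/eqP.
rewrite [X in _ * X](_ : _ = 0) ?mulr0 //; apply/eqP; rewrite Fp_int_eq0 //.
by apply: dvdz_trans (Phi_pow (coprime1n _)); rewrite exprSr dvdz_mull.
Qed.

(** Sending xi to c^k is even a ring map to Z/p^2, which is what can distinguish valuation 1 from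
    higher valuations. *)
Lemma aD_mod k : coprime k n ->
  (p%:Z ^+ 2 %| a.[c%:Z ^+ k] * D.[c%:Z ^+ k] - p%:Z)%Z.
Proof.
move=> kn; have [q Dq] : exists q, a * D - p%:Z%:P = q * 'Phi_n.
  by apply: (ieval_zero prx); rewrite rmorphB /= aD ievalC subrr.
have := congr1 (fun f => f.[c%:Z ^+ k]) Dq; rewrite !hornerE => ->.
by rewrite dvdz_mull // Phi_pow.
Qed.

Lemma p2_ndvd : ~~ (p%:Z ^+ 2 %| p%:Z)%Z.
Proof.
rewrite dvdzE abszX /=; apply/negP => /(dvdn_leq (prime_gt0 p_pr)).
by rewrite leqNgt -{1}[p]expn1 ltn_exp2l // prime_gt1.
Qed.

(** D(c^k) is divisible by p; were a(c^k) so too, their product would vanish modulo p^2, where it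
    equals p. *)
Lemma a_ndvd k : coprime k n -> k != 1 %[mod n] -> ieval ((c%:R : 'F_p) ^+ k) a != 0.
Proof.
move=> kn k1; have Dk : ieval ((c%:R : 'F_p) ^+ k) D = 0.
  apply: Dc; first by rewrite exprAC (prim_expr_order prc) expr1n.
  by rewrite -[X in _ != X]expr1 (eq_prim_root_expr prc).
apply/negP => ak; case/negP: p2_ndvd.
rewrite -[X in (_ %| X)%Z](subKr (a.[c%:Z ^+ k] * D.[c%:Z ^+ k])).
apply: rpredB; last exact: aD_mod.
move: ak Dk; rewrite !ieval_Fp => ak /eqP Dk; rewrite !Fp_int_eq0 // in ak Dk.
by rewrite expr2; apply: dvdz_mul.
Qed.

Lemma card_coprimes : #|[pred k : 'I_n | coprime k n]| = d.
Proof.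
rewrite /d totient_count_coprime big_mkord -sum1_card big_mkcond.
by apply: eq_bigr => k _; rewrite inE /= coprime_sym; case: coprime.
Qed.

(* Modulo p^2 the norm is the product of the a(c^k), whose only factor divisible
   by p is a(c); that factor is not divisible by p^2 because a(c) D(c) = p mod p^2. *)
Theorem norm_eq_p : \prod_(k < n | coprime k n) `|ieval (xi ^+ k) a| = p%:R.
Proof.
have [NA [q [DA EA]]] := norm_int prx a; have [ND [_ [_ ED]]] := norm_int prx D.
have AD : NA * ND = p%:Z ^+ d.
  apply: (intr_inj (R := algC)); rewrite intrM -EA -ED -big_split rmorphXn /=.
  rewrite (eq_bigr (fun=> p%:R)) => [|k kn]; last first.
    have [u Du] := conj_aut prx kn; rewrite -rmorphM /= -Du -ieval_rmorph aD.
    by rewrite rmorph_nat.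
  by rewrite prodr_const card_coprimes.
have pA : (p%:Z ^+ 2 %| NA - \prod_(k < n | coprime k n) a.[c%:Z ^+ k])%Z.
  have := congr1 (fun f => f.[c%:Z]) DA; rewrite horner_prod hornerD hornerC hornerM.
  under eq_bigr do rewrite horner_comp hornerXn.
  move=> ->; rewrite opprD addrA subrr sub0r rpredN dvdz_mull //.
pose i1 : 'I_n := Ordinal (ltnW n_gt2).
pose Q := \prod_(k < n | coprime k n && (k != i1)) a.[c%:Z ^+ k].
have DP : \prod_(k < n | coprime k n) a.[c%:Z ^+ k] = a.[c%:Z] * Q.
  by rewrite (bigD1 i1) ?coprime1n.
have pQ : coprimez (p%:Z ^+ 2) Q.
  rewrite coprimezXl // coprimezE prime_coprime // -[(p %| _)%N]/(p%:Z %| Q)%Z.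
  rewrite -(Fp_int_eq0 _ p_pr) rmorph_prod; apply/prodf_neq0 => k /andP[kn k1] /=.
  by rewrite -ieval_Fp a_ndvd // !modn_small // ltnW.
have pa : (p%:Z %| a.[c%:Z])%Z.
  by have /eqP := ac; rewrite -[c%:R]expr1 ieval_Fp expr1 Fp_int_eq0.
have pNA : (p%:Z %| NA)%Z.
  rewrite -(subrK (\prod_(k < n | coprime k n) a.[c%:Z ^+ k]) NA) rpredD //.
    by apply: dvdz_trans pA; rewrite expr2 dvdz_mulr.
  by rewrite DP dvdz_mulr.
have p2NA : ~~ (p%:Z ^+ 2 %| NA)%Z.
  apply: contra p2_ndvd => p2N.
  have p2a : (p%:Z ^+ 2 %| a.[c%:Z])%Z.
    rewrite -(Gauss_dvdzl _ pQ) -DP.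
    by rewrite -(subKr NA (\prod_(k < n | coprime k n) _)) rpredB.
  rewrite -[X in (_ %| X)%Z](subKr (a.[c%:Z ^+ 1] * D.[c%:Z ^+ 1])).
  apply: rpredB; last exact: (aD_mod (coprime1n _)).
  by rewrite expr1 dvdz_mulr.
have := congr1 absz AD; rewrite abszM abszX /= => absAD.
have /(dvdn_pfactor _ _ p_pr)[m _ Dm] : (`|NA| %| p ^ d)%N by rewrite -absAD dvdn_mulr.
have m1 : m = 1%N.
  move: pNA p2NA; rewrite !dvdzE abszX /= Dm; case: m {Dm} => [|[|m]] //.
    by rewrite expn0 dvdn1 gtn_eqF // prime_gt1.
  by rewrite dvdn_exp2l.
rewrite -normr_prod EA -intr_norm -abszE Dm m1 expn1 //.
Qed.

Definition alpha (k : nat) : algC := `|ieval (xi ^+ k) a|.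

Lemma alpha_prod l : coprime l n -> \prod_(k < n | coprime k n) alpha (l * k) = p%:R.
Proof.
by move=> ln; rewrite (norm_reindex prx (fun z => `|ieval z a|) ln) norm_eq_p.
Qed.

Lemma conj_xi k : (xi ^+ k)^* = xi ^+ (n.-1 * k).
Proof.
have xn : `|xi| = 1.
  by apply/eqP; rewrite -(pexpr_eq1 n_gt0) // -normrX (prim_expr_order prx) normr1.
have x0 : xi != 0 by rewrite -normr_eq0 xn oner_neq0.
have -> : (xi ^+ k)^* = (xi^*) ^+ k by rewrite rmorphXn.
have -> : xi^* = xi^-1 by rewrite invC_norm xn expr1n invr1 mul1r.
rewrite exprM; congr (_ ^+ _); apply: (mulIf x0).
by rewrite mulVf // -exprSr prednK // (prim_expr_order prx).
Qed.

Lemma alpha_conj k : alpha (n.-1 * k) = alpha k.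
Proof. by rewrite /alpha -conj_xi -ieval_rmorph norm_conjC. Qed.

Lemma coprime_pred : coprime n.-1 n.
Proof. by rewrite coprime_sym coprimenP. Qed.

Lemma pred_neq1 : n.-1 != 1 %[mod n].
Proof.
rewrite !modn_small ?prednK // ?(ltnW n_gt2) //.
by rewrite -(eqn_add2r 1) !addn1 prednK // neq_ltn orbC n_gt2.
Qed.

Lemma natr_le_norm (X : {poly int}) (b : nat) : ieval xi X != 0 ->
  (b ^ d)%:R <= \prod_(k < n | coprime k n) `|ieval (xi ^+ k) (b%:Z *: X)|.
Proof.
move=> X0; have := norm_ge1 prx X0.
have -> : \prod_(k < n | coprime k n) `|ieval (xi ^+ k) (b%:Z *: X)|
    = (b ^ d)%:R * \prod_(k < n | coprime k n) `|ieval (xi ^+ k) X|.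
  rewrite natrX -card_coprimes -prodr_const -big_split; apply: eq_bigr => k _ /=.
  by rewrite -mul_polyC rmorphM /= ievalC normrM normr_nat.
by move=> H; rewrite ler_peMr // ler0n.
Qed.

(* Frobenius makes a(x)^l a(x^-l) - a(x^l) a(x^-1)^l divisible by l; it is nonzero
   at xi, being nonzero modulo p at c, so its norm is at least l^d. *)
Theorem ell_bound ell : prime ell -> coprime ell n -> ell != 1 %[mod n] ->
  (ell ^ d <= 2 ^ d * p ^ ell.+1)%N.
Proof.
move=> ell_pr elln ell1.
pose b := a \Po 'X^(n.-1); pose al := a \Po 'X^ell; pose bl := b \Po 'X^ell.
pose G := a ^+ ell * bl - al * b ^+ ell.
have [h Dh] := frobenius_congruence a ell_pr.
have [h' Dh'] := frobenius_congruence b ell_pr.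
pose X := h * bl - al * h'.
have DG : G = ell%:Z *: X.
  rewrite /G Dh Dh' -/al -/bl /X -!mul_polyC.
  by move: (ell%:Z%:P) => e; ring.
have evb z : ieval (z : 'F_p) b = ieval (z ^+ n.-1) a by rewrite /b ieval_comp.
have G0 : ieval xi G != 0.
  (* At c the first product dies with a(c); the second involves only a(c^ell) and a(c^(-1)), both
     nonzero modulo p. *)
  apply: neq0_criterion; rewrite rmorphB !rmorphM !rmorphXn /= ac expr0n.
  rewrite eqn0Ngt prime_gt0 // mul0r sub0r oppr_eq0 mulf_neq0 ?expf_neq0 //.
    by rewrite /al ieval_comp a_ndvd.
  by rewrite evb a_ndvd ?coprime_pred ?pred_neq1.
have X0 : ieval xi X != 0.
  by apply: contraNneq G0 => X0; rewrite DG -mul_polyC rmorphM /= X0 mulr0.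
have := natr_le_norm ell X0; rewrite -DG => lower.
have upper : \prod_(k < n | coprime k n) `|ieval (xi ^+ k) G| <= (2 ^ d * p ^ ell.+1)%:R.
  have -> : (2 ^ d * p ^ ell.+1)%:R =
      \prod_(k < n | coprime k n) (2%:R * (alpha (1 * k) ^+ ell * alpha (ell * k))) :> algC.
    rewrite !big_split /= prodrXl !alpha_prod ?coprime1n // prodr_const card_coprimes.
    by rewrite natrM !natrX exprSr.
  apply: ler_prod => k kn; rewrite normr_ge0 /= rmorphB !rmorphM !rmorphXn /=.
  apply: le_trans (ler_normB _ _) _; rewrite !normrM !normrX mul1n.
  rewrite /bl /al /b !ieval_comp -!exprM mulrDl mul1r.
  have -> : `|ieval (xi ^+ (k * (ell * n.-1))) a| = alpha (ell * k).
    by rewrite mulnA mulnC [(k * ell)%N]mulnC -/(alpha _) alpha_conj.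
  have -> : `|ieval (xi ^+ (k * n.-1)) a| = alpha k.
    by rewrite mulnC -/(alpha _) alpha_conj.
  have -> : `|ieval (xi ^+ (k * ell)) a| = alpha (ell * k) by rewrite mulnC.
  by rewrite [alpha (ell * k) * _]mulrC.
by have := le_trans lower upper; rewrite ler_nat.
Qed.

Lemma parity_split (e : {poly int}) : exists E O : {poly int},
  forall (S : comNzRingType) (z : S),
    ieval z e = ieval z E + ieval z O /\ ieval (- z) e = ieval z E - ieval z O.
Proof.
elim/poly_ind: e => [|e b [E [O EO]]].
  by exists 0, 0 => S z; rewrite !rmorph0 subr0 addr0.
exists (O * 'X + b%:P), (E * 'X) => S z; have [Dp Dm] := EO S z.
rewrite !rmorphD !rmorphM /= !ievalX !ievalC Dp Dm; split; ring.
Qed.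

Lemma weighted_am_gm (A B : algC) : 0 <= A -> 0 <= B ->
  3125%:R * (A ^+ 4 * B) <= 256%:R * (A + B) ^+ 5.
Proof.
move=> A0 B0; rewrite -subr_ge0.
(* Equality holds at A = 4 B, hence the double factor; the cofactor has nonnegative coefficients. *)
have -> : 256%:R * (A + B) ^+ 5 - 3125%:R * (A ^+ 4 * B) = (A - 4%:R * B) ^+ 2 *
  (256%:R * A ^+ 3 + 203%:R * (A ^+ 2 * B) + 88%:R * (A * B ^+ 2) + 16%:R * B ^+ 3) by ring.
apply: mulr_ge0; first by rewrite real_exprn_even_ge0 // rpredB ?rpredM ?ger0_real.
by rewrite !addr_ge0 ?mulr_ge0 ?exprn_ge0.
Qed.

(* With delta(x) = a(x) a(-x^-1), delta(-xi) is the conjugate of delta(xi), so that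
   delta = E + O splits into real and imaginary parts and |delta|^4 is the sum of
   4 |E O|^2 and |E^2 + O^2|^2, both of norm at least 1. *)
Theorem quartic_bound m : n = (4 * m)%N -> (5 ^ d <= p ^ 8)%N.
Proof.
move=> Dn; have m_gt0 : (0 < m)%N by move: n_gt0; rewrite Dn; case: m {Dn}.
(* For a primitive n-th root z one has z^(2m) = -1, so z^e = -1/z and z^tau = -z. *)
pose e := (2 * m).-1; pose tau := (2 * m).+1.
have De : (2 * m)%N = e.+1 by rewrite prednK // muln_gt0.
have cop_odd k : odd k -> coprime k (2 * m) -> coprime k n.
  by move=> ok km; rewrite Dn -[4%N]/(2 * 2)%N -mulnA coprimeMr km andbT coprimen2.
have en : coprime e n.
  apply: cop_odd; last by rewrite De coprimenS.
  by rewrite -[odd e]negbK -[~~ odd e]/(odd e.+1) -De oddM.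
have tn : coprime tau n by apply: cop_odd; rewrite ?coprimeSn //= oddM.
have half (F : fieldType) (z : F) : n.-primitive_root z -> z ^+ (2 * m) = -1.
  move=> prz; have /eqP : (z ^+ (2 * m)) ^+ 2 = 1.
    by rewrite -exprM mulnAC -[(2 * 2 * m)%N]Dn (prim_expr_order prz).
  rewrite sqrf_eq1 => /orP[|/eqP//].
  rewrite -(prim_order_dvd prz) Dn => /(dvdn_leq _); lia.
pose dl := a * (a \Po 'X^e); have [E [O EO]] := parity_split dl.
have evdl (S : comNzRingType) (z : S) : ieval z dl = ieval z a * ieval (z ^+ e) a.
  by rewrite rmorphM /= ieval_comp.
pose s := E * O; pose t := E ^+ 2 + O ^+ 2.
(* At c, delta vanishes, so E = -O there, while delta(-c) is a product of two nonzero values of a;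
   as tau e = -1 modulo n, they are taken at c^tau and c^(-1). *)
have [sc tc] : ieval (c%:R : 'F_p) s != 0 /\ ieval (c%:R : 'F_p) t != 0.
  have [Dp Dm] := EO _ (c%:R : 'F_p).
  rewrite rmorphM rmorphD !rmorphXn /=; move: (ieval _ E) (ieval _ O) Dp Dm => u v.
  rewrite evdl ac mul0r => /esym/eqP; rewrite addr_eq0 => /eqP-> Dm.
  have : ieval (- (c%:R : 'F_p)) dl != 0.
    rewrite -mulN1r -(half _ _ prc) -exprSr evdl -exprM mulf_neq0 //.
      by rewrite a_ndvd // !modn_small ?Dn; lia.
    rewrite -(prim_expr_mod prc) (_ : (tau * e %% n)%N = n.-1 %% n)%N; last first.
      rewrite -(modnMDl m.-1 n.-1); congr (_ %% _)%N; rewrite Dn /tau /e; nia.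
    by rewrite (prim_expr_mod prc) a_ndvd ?coprime_pred ?pred_neq1.
  rewrite Dm -opprD oppr_eq0 -mulr2n -mulr_natl mulf_eq0 negb_or => /andP[n2 v0].
  by rewrite sqrrN -mulr2n -mulr_natl !mulf_neq0 ?oppr_eq0 ?expf_neq0.
have s1 := norm_ge1 prx (neq0_criterion sc); have t1 := norm_ge1 prx (neq0_criterion tc).
have bound k : coprime k n -> 3125%:R * (`|ieval (xi ^+ k) s| ^+ 8 * `|ieval (xi ^+ k) t| ^+ 2)
    <= (alpha (1 * k) * alpha (e * k)) ^+ 20.
  move=> kn; have ok : odd k.
    have : coprime k 2 by move: kn; rewrite Dn -[4%N]/(2 * 2)%N -mulnA coprimeMr => /andP[].
    by rewrite coprimen2.
  have prk : n.-primitive_root (xi ^+ k) by rewrite (prim_root_exp_coprime _ prx).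
  rewrite mul1n /alpha [(e * k)%N]mulnC exprM -normrM -evdl.
  have cdl : (ieval (xi ^+ k) dl)^* = ieval (- xi ^+ k) dl.
    rewrite !evdl rmorphM /= !ieval_rmorph mulrC.
    have xe : xi ^+ k * xi ^+ k ^+ e = -1 by rewrite -exprS -De half.
    have nk : `|xi ^+ k| = 1.
      by apply/eqP; rewrite -(pexpr_eq1 n_gt0) // -normrX (prim_expr_order prk) normr1.
    have xk0 : xi ^+ k != 0 by rewrite -normr_eq0 nk oner_neq0.
    have cx : (xi ^+ k)^* = - xi ^+ k ^+ e.
      by apply: (mulfI xk0); rewrite mulrN xe -normCK nk expr1n opprK.
    have oe : odd e by rewrite -[odd e]negbK -[~~ odd e]/(odd e.+1) -De oddM.
    congr (ieval _ a * ieval _ a); last first.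
      by apply: etrans cx _; rewrite exprNn -signr_odd oe mulN1r.
    apply: (inv_inj conjCK); apply: etrans (conjCK _) _.
    by rewrite rmorphN /= cx opprK.
  have -> : ieval (xi ^+ k) s = ieval (xi ^+ k) E * ieval (xi ^+ k) O by rewrite rmorphM.
  have -> : ieval (xi ^+ k) t = ieval (xi ^+ k) E ^+ 2 + ieval (xi ^+ k) O ^+ 2.
    by rewrite rmorphD !rmorphXn.
  move: cdl; have [-> ->] := EO _ (xi ^+ k).
  move: (ieval _ E) (ieval _ O) => u v cuv.
  have cvu : (u - v)^* = u + v by rewrite -cuv conjCK.
  have two0 : (2%:R : algC) != 0 by rewrite pnatr_eq0.
  have cu : u^* = u.
    apply: (mulfI two0); move: cuv cvu; rewrite rmorphD rmorphB /= => H1 H2.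
    have -> : 2%:R * u^* = (u^* + v^*) + (u^* - v^*) by ring.
    by rewrite H1 H2; ring.
  have cv : v^* = - v.
    by move: cuv; rewrite rmorphD /= cu => /addrI.
  have -> : `|u + v| ^+ 20 = (4%:R * `|u * v| ^+ 2 + `|u ^+ 2 + v ^+ 2| ^+ 2) ^+ 5.
    rewrite -[20%N]/(2 * (2 * 5))%N !exprM; congr (_ ^+ 5).
    by rewrite !normCK !(rmorphM, rmorphD, rmorphB, rmorphXn) /= cu cv; ring.
  (* With A = 4 |uv|^2 the factor A^4 contributes 4^4 = 256, which cancels the constant of the
     weighted inequality. *)
  rewrite -(ler_pM2l (_ : 0 < 256%:R)) ?ltr0n //.
  apply: le_trans (weighted_am_gm (A := 4%:R * `|u * v| ^+ 2) _ _).
  - by rewrite le_eqVlt; apply/orP; left; apply/eqP; ring.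
  - by rewrite mulr_ge0 // exprn_ge0.
  by rewrite exprn_ge0.
suff : (3125 ^ d <= p ^ (8 * 5))%N.
  by rewrite -[3125%N]/(5 ^ 5)%N -expnM mulnC !expnM leq_exp2r.
rewrite -(ler_nat algC) !natrX.
have -> : p%:R ^+ (8 * 5) = \prod_(k < n | coprime k n) (alpha (1 * k) * alpha (e * k)) ^+ 20.
  by rewrite prodrXl big_split /= !alpha_prod ?coprime1n // -expr2 -exprM.
apply: le_trans (_ : _ <= \prod_(k < n | coprime k n)
   (3125%:R * (`|ieval (xi ^+ k) s| ^+ 8 * `|ieval (xi ^+ k) t| ^+ 2))) _; last first.
  by apply: ler_prod => k kn; rewrite bound // !mulr_ge0 ?exprn_ge0.
rewrite big_split /= prodr_const card_coprimes big_split /= !prodrXl.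
rewrite ler_peMr ?exprn_ge0 ?ler0n //.
by rewrite mulr_ege1 // exprn_ege1.
Qed.
End NormCertificate.

(** The iterated form keeps intermediate numbers small when the criterion is evaluated by
    computation. *)
Lemma iter_mod_exp q k m : (1 < q)%N -> iter m (fun x => x * k %% q)%N 1%N = (k ^ m %% q)%N.
Proof.
move=> q1; elim: m => [|m IHm]; first by rewrite expn0 modn_small.
by rewrite iterS IHm modnMml expnSr.
Qed.

(** * The norm to an imaginary quadratic subfield *)

Section QuadraticCertificate.
Variables (p : nat) (xi : algC) (a : {poly int}) (H : seq nat).
Local Notation n := p.-1.
Hypothesis prx : n.-primitive_root xi.
Hypothesis norm_p : \prod_(k < n | coprime k n) `|ieval (xi ^+ k) a| = p%:R.
Hypothesis H_units :
  perm_eq [seq k <- iota 0 n | coprime k n] (H ++ [seq (n.-1 * k %% n)%N | k <- H]).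
Hypothesis H_mul : all (fun j => perm_eq [seq (j * k %% n)%N | k <- H] H) H.

(** H is a subgroup of index 2 in the units modulo n that avoids -1; mu represents the norm of a(xi)
    to its fixed field, and [mubar] the complex conjugate. *)
Let mu := \prod_(k <- H) (a \Po 'X^k).
Let mubar := mu \Po 'X^(n.-1).
Let mu0 := ieval xi mu.

Lemma conj_ieval k f : (ieval (xi ^+ k) f)^* = ieval (xi ^+ (n.-1 * k)) f.
Proof. by rewrite ieval_rmorph -(conj_xi prx). Qed.

Lemma mu_fixed k : (k %% n)%N \in H -> ieval (xi ^+ k) mu = mu0.
Proof.
move=> kH; rewrite /mu0 /mu !rmorph_prod /= -[RHS](perm_big _ (allP H_mul _ kH)) big_map.
by apply: eq_bigr => j _; rewrite !ieval_comp (xi_mod prx) !exprM (xi_mod prx).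
Qed.

Lemma mubarE k : ieval (xi ^+ k) mubar = (ieval (xi ^+ k) mu)^*.
Proof. by rewrite ieval_comp -exprM mulnC -conj_ieval. Qed.

Lemma mu_conj k : coprime k n ->
  ieval (xi ^+ k) mu = mu0 /\ ieval (xi ^+ k) mubar = mu0^*
  \/ ieval (xi ^+ k) mu = mu0^* /\ ieval (xi ^+ k) mubar = mu0.
Proof.
move=> kn; have n_gt0 : (0 < n)%N by exact: prim_order_gt0 prx.
have : (k %% n)%N \in [seq k <- iota 0 n | coprime k n].
  by rewrite mem_filter coprime_modl kn mem_iota ltn_mod.
rewrite (perm_mem H_units) mem_cat => /orP[kH|/mapP[j jH Dk]].
  by left; rewrite mubarE mu_fixed.
have Dmu : ieval (xi ^+ k) mu = mu0^*.
  have jn : (j %% n)%N = j.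
    have : j \in H ++ [seq (n.-1 * k %% n)%N | k <- H] by rewrite mem_cat jH.
    by rewrite -(perm_mem H_units) mem_filter mem_iota add0n => /andP[_ jn]; rewrite modn_small.
  by rewrite -(xi_mod prx) Dk (xi_mod prx) -conj_ieval mu_fixed ?jn.
by right; rewrite mubarE Dmu conjCK.
Qed.

Lemma mu_norm : mu0 * mu0^* = p%:R.
Proof.
have -> : mu0 * mu0^* = \prod_(k <- H) (`|ieval (xi ^+ k) a| * `|ieval (xi ^+ (n.-1 * k)) a|).
  rewrite /mu0 /mu !rmorph_prod /= -big_split; apply: eq_bigr => k _ /=.
  by rewrite !ieval_comp -conj_ieval norm_conjC -expr2 normCK.
rewrite -norm_p big_split /= -(big_mkord (fun k => coprime k n) (fun k => `|ieval (xi ^+ k) a|)).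
rewrite -[RHS]big_filter /index_iota subn0 (perm_big _ H_units) /= big_cat big_map /=.
by congr (_ * _); apply: eq_bigr => k _; rewrite (xi_mod prx).
Qed.

(* The trace u of mu to Q satisfies (mu - mubar)^2 = u^2 - 4p, and mu - mubar is
   fixed by Frobenius at the primes q in H; so u^2 - 4p is a square modulo q. *)
Theorem quadratic_trace : exists u : nat, (u ^ 2 <= 4 * p)%N /\
  forall q, prime q -> odd q -> (q %% n)%N \in H ->
  let k := ((u ^ 2 + 4 * p * q.-1) %% q)%N in
  iter q.+1./2 (fun x => x * k %% q)%N 1%N = k.
Proof.
have [|U [_ [_ DU]]] := @ieval_const _ _ prx (mu + mubar) (mu0 + mu0^*).
  by move=> k /mu_conj[] [E1 E2]; rewrite rmorphD /= E1 E2 // addrC.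
pose Delta := mu - mubar; pose E := U ^+ 2 - 4%:R * p%:Z.
have E1 : ieval xi mu = mu0 by [].
have E2 : ieval xi mubar = mu0^* by rewrite -[xi]expr1 mubarE expr1.
have cD : (ieval xi Delta)^* = - ieval xi Delta.
  by rewrite rmorphB /= E1 E2 rmorphB /= conjCK opprB.
have D2 : ieval xi Delta ^+ 2 = E%:~R.
  have -> : E%:~R = (mu0 + mu0^*) ^+ 2 - 4%:R * p%:R :> algC.
    by rewrite DU [LHS]rmorphB /= rmorphXn rmorphM /= !rmorph_nat.
  rewrite -mu_norm [in LHS]rmorphB /= E1 E2; ring.
exists `|U|%N; split.
  have : E%:~R <= 0 :> algC.
    by rewrite -D2 expr2 -{2}[ieval xi Delta]opprK -cD mulrN -normCK oppr_le0 exprn_ge0.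
  by rewrite lerz0 subr_le0 -lez_nat; lia.
move=> q q_pr q_odd qH; rewrite /= iter_mod_exp ?prime_gt1 // modnXm.
(* q - 1 stands for -1, so k is U^2 - 4p modulo q in natural numbers. The exponent (q + 1)/2 states
   Euler's criterion in a form that includes k = 0. *)
set k := (`|U| ^ 2 + _)%N.
have Dq : ieval xi (Delta \Po 'X^q) = ieval xi Delta.
  rewrite ieval_comp rmorphB /= mubarE mu_fixed //.
  by rewrite rmorphB /= E1 E2.
clearbody Delta; have [h Dh] := frobenius_congruence Delta q_pr.
(* Frobenius gives Delta^q = Delta + q h at xi; multiplying by Delta gives N = q h Delta. So N / q
   is rational and the value of an integer polynomial, hence an integer. *)
pose N := E ^+ q.+1./2 - E.
have [|M [_ [_ DM]]] := @ieval_const _ _ prx (h * Delta) (N%:~R / q%:R).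
  move=> l /(conj_aut prx)[u <-]; rewrite -ieval_rmorph.
  have -> : ieval xi (h * Delta) = N%:~R / q%:R.
    apply: (canRL (mulfK _)); first by rewrite pnatr_eq0 -lt0n prime_gt0.
    have := congr1 (fun f => ieval xi f * ieval xi Delta) Dh.
    rewrite rmorphXn rmorphD /= Dq -exprSr -mul_polyC rmorphM /= ievalC.
    rewrite -[in LHS](odd_double_half q.+1) /= q_odd add0n -mul2n exprM D2 => H'.
    rewrite /N rmorphB rmorphXn /= H' -D2 rmorphM /=; ring.
  by rewrite fmorph_div rmorph_int rmorph_nat.
have {}DM : N = M * q%:Z.
  apply: (intr_inj (R := algC)); rewrite rmorphM /= -DM mulfVK //.
  by rewrite pnatr_eq0 -lt0n prime_gt0.
have kE : (k%:Z = E %[mod q])%Z.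
  apply/eqP; rewrite eqz_mod_dvd; apply/dvdzP; exists (4%:R * p%:Z).
  rewrite /k /E -{2}[q]prednK ?prime_gt0 //; move: (q.-1) => r.
  nia.
suff /(congr1 absz) : ((k ^ q.+1./2)%N%:Z = k%:Z %[mod q])%Z by rewrite !modz_nat.
rewrite -natz natrX natz -modzXm kE modzXm; apply/eqP; rewrite eqz_mod_dvd -/N DM.
exact: dvdz_mull.
Qed.

(** The decidable form: if each possible trace u < B were refuted by some split prime in Q, no such
    a could exist. *)
Theorem quadratic_certificate B Q : (4 * p < B ^ 2)%N ->
    all (fun q => [&& prime q, odd q & (q %% n)%N \in H]) Q ->
  ~~ all (fun u => has (fun q => let k := ((u ^ 2 + 4 * p * q.-1) %% q)%N in
            iter q.+1./2 (fun x => x * k %% q)%N 1%N != k) Q) (iota 0 B).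
Proof.
move=> pB Qok; have [u [u2 uq]] := quadratic_trace.
have uB : (u < B)%N by rewrite -ltn_sqr (leq_ltn_trans u2).
apply/negP => /allP/(_ u); rewrite mem_iota uB => /(_ isT)/hasP[q qQ /eqP[]].
by have /and3P[q_pr q_odd qH] := allP Qok q qQ; apply: uq.
Qed.

End QuadraticCertificate.

(* The p-th power of any primitive root modulo p is one modulo p^2. *)
Lemma primitive_root_lift p : prime p -> exists c : nat,
  (p.-1).-primitive_root (c%:R : 'F_p) /\ (p%:Z ^+ 2 %| ('Phi_(p.-1)).[c%:Z])%Z.
Proof.
move=> p_pr; have p1 := prime_gt1 p_pr; set n := p.-1.
have n_gt0 : (0 < n)%N by rewrite -ltnS prednK // ltnW.
have cardF : #|[pred x : 'F_p | x != 0]| = n.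
  by have := cardC1 (0 : 'F_p); rewrite card_Fp // => <-; apply: eq_card.
have [z prz] : exists z : 'F_p, n.-primitive_root z.
  have /hasP[z _ prz] : has n.-primitive_root (enum [pred x : 'F_p | x != 0]).
    apply: has_prim_root => //; rewrite ?enum_uniq // -?cardE ?cardF //.
    apply/allP => x; rewrite mem_enum inE unity_rootE => x0; apply/eqP.
    apply: (mulfI x0); rewrite mulr1 -exprS prednK ?(ltnW p1) //.
    by have := expf_card x; rewrite card_Fp.
  by exists z.
pose b : nat := z; pose c := (b ^ p)%N.
have Db : b%:R = z by rewrite /b natr_Zp.
have Dc : c%:R = z.
  by rewrite natrX Db; have := expf_card z; rewrite card_Fp.
exists c; rewrite Dc; split=> //.
have copb : coprime b (p ^ 2).
  rewrite coprimeXr // coprime_sym prime_coprime //; apply/negP => pb.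
  have z0 : z = 0 by apply/eqP; rewrite -Db -[b%:R]/(b%:Z%:~R) Fp_int_eq0.
  by have /eqP := prim_expr_order prz; rewrite z0 expr0n gtn_eqF // eq_sym oner_eq0.
have pc : (p%:Z ^+ 2 %| c%:Z ^+ n - 1)%Z.
  rewrite -eqz_mod_dvd -!natz -!natrX !natz !modz_nat /c -expnM.
  by rewrite -[X in (_ ^ X)%N]mulnC -[p in (n * p)%N]expn1 -(totient_pfactor p_pr (e := 2)) //
    (Euler_exp_totient copb).
(* p^2 divides c^n - 1, the product of the Phi_d(c) over d dividing n. For d < n the factor is prime
   to p, since c has exact order n modulo p, so p^2 divides Phi_n(c). *)
clearbody c; have := prod_Cyclotomic n_gt0; move/(congr1 (fun f => f.[c%:Z])).
rewrite horner_prod hornerD hornerXn hornerN hornerC => DP.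
rewrite -{}DP (bigD1_seq n) ?divisors_uniq -?dvdn_divisors //= in pc.
move: pc; rewrite Gauss_dvdzl //; set Q := (X in coprimez _ X).
rewrite coprimezXl // coprimezE prime_coprime // -[(p %| _)%N]/(p%:Z %| Q)%Z.
rewrite -(Fp_int_eq0 _ p_pr) rmorph_prod prodf_seq_neq0; apply/allP => d.
rewrite -dvdn_divisors // => dn; apply/implyP => d1 /=.
have d_gt0 := dvdn_gt0 n_gt0 dn.
apply: contraNneq d1 => Phid; rewrite eqn_dvd dn /= (prim_order_dvd prz) -Dc.
have := prod_Cyclotomic d_gt0; move/(congr1 (fun f => (f.[c%:Z])%:~R : 'F_p)).
rewrite horner_prod rmorph_prod hornerD hornerXn hornerN hornerC rmorphB rmorphXn /=.
rewrite (bigD1_seq d) ?divisors_uniq -?dvdn_divisors //= Phid mul0r => /esym/eqP.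
by rewrite subr_eq0.
Qed.

Theorem stably_rational_bounds p : prime p -> (3 < p)%N -> stably_rational_QCp p ->
  let n := p.-1 in
  [/\ forall ell, prime ell -> coprime ell n -> ell != 1 %[mod n] ->
        (ell ^ totient n <= 2 ^ totient n * p ^ ell.+1)%N,
      forall m, n = (4 * m)%N -> (5 ^ totient n <= p ^ 8)%N &
      forall H B Q,
        perm_eq [seq k <- iota 0 n | coprime k n] (H ++ [seq (n.-1 * k %% n)%N | k <- H]) ->
        all (fun j => perm_eq [seq (j * k %% n)%N | k <- H] H) H ->
        (4 * p < B ^ 2)%N -> all (fun q => [&& prime q, odd q & (q %% n)%N \in H]) Q ->
        ~~ all (fun u => has (fun q => let k := ((u ^ 2 + 4 * p * q.-1) %% q)%N in
          iter q.+1./2 (fun x => x * k %% q)%N 1%N != k) Q) (iota 0 B)].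
Proof.
move=> p_pr p3 rat n; have n_gt0 : (0 < n)%N by rewrite /n -subn1 subn_gt0 prime_gt1.
have [c [prc Phic]] := primitive_root_lift p_pr.
have [xi prx] := C_prim_root_exists n_gt0.
have [a [D [aD ac Dc]]] := noether_certificate p_pr rat prc prx.
have norm := norm_eq_p p_pr prx prc Phic aD ac Dc p3.
split=> [ell|m|H B Q HU HM].
- exact: (ell_bound p_pr prx prc Phic aD ac Dc p3).
- exact: (quartic_bound p_pr prx prc Phic aD ac Dc p3).
exact: (quadratic_certificate prx norm HU HM).
Qed.

(** * Numerical bounds *)

Lemma uniq_primes_prod_dvd (s : seq nat) n :
  uniq s -> all prime s -> all (fun q => q %| n)%N s -> (\prod_(q <- s) q %| n)%N.
Proof.
elim: s => [|q s IHs] /=; first by rewrite big_nil dvd1n.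
move=> /andP[qs us] /andP[q_pr sp] /andP[qn sn]; rewrite big_cons Gauss_dvd ?qn ?IHs //.
rewrite prime_coprime // Euclid_dvd_prod // big_has; apply/hasPn => r rs /=.
rewrite dvdn_prime2 ?(allP sp r rs) //; apply: contraNneq qs => ->; exact: rs.
Qed.

(** A prime below n is either coprime to n, and counted by the totient, or divides n; at most k
    divide it, since their product is at most n < 2^(k+1). *)
Lemma totient_ge_primes (s : seq nat) n k :
    uniq s -> all prime s -> all (fun q => q < n)%N s -> (n < 2 ^ k.+1)%N -> (0 < n)%N ->
  (size s <= totient n + k)%N.
Proof.
move=> us sp sn nk n0; pose P q := (q %| n)%N.
rewrite -(count_predC P s) addnC leq_add //.
  rewrite -size_filter totient_count_coprime.
  have -> : (\sum_(0 <= d < n) coprime n d = size [seq d <- iota 0 n | coprime n d])%N.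
    rewrite size_filter -sum1_count [RHS]big_mkcond /index_iota subn0.
    by apply: eq_bigr => d _; case: coprime.
  apply: uniq_leq_size; rewrite ?filter_uniq // => q.
  rewrite !mem_filter mem_iota /= => /andP[qn qs]; rewrite (allP sn) // andbT.
  by rewrite coprime_sym prime_coprime ?(allP sp).
rewrite -size_filter; set f := filter _ _.
have fp : all prime f by apply/allP => q; rewrite mem_filter => /andP[_ /(allP sp)].
have le_prod : (\prod_(q <- f) q <= n)%N.
  apply: dvdn_leq => //; apply: uniq_primes_prod_dvd; rewrite ?filter_uniq //.
  exact: filter_all.
rewrite -ltnS -(ltn_exp2l _ _ (isT : 1 < 2)%N); apply: leq_ltn_trans nk.
apply: leq_trans le_prod.
elim: (f) fp => [|q r IHr] /=; first by rewrite big_nil.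
by move=> /andP[q_pr /IHr le_r]; rewrite big_cons expnS leq_mul // prime_gt1.
Qed.

Lemma N_of_natM m n : N.of_nat (m * n) = N.mul (N.of_nat m) (N.of_nat n).
Proof. lia. Qed.

Lemma N_of_natX m n : N.of_nat (m ^ n) = N.pow (N.of_nat m) (N.of_nat n).
Proof.
elim: n => [|n IHn]; first by rewrite expn0.
by rewrite expnS N_of_natM IHn Nnat.Nat2N.inj_succ N.pow_succ_r'.
Qed.

Lemma N_of_nat_ltP m n : N.ltb (N.of_nat m) (N.of_nat n) = (m < n)%N.
Proof. by apply/idP/idP; lia. Qed.

Lemma ltn_exp_N a b c d :
    N.ltb (N.pow (N.of_nat a) (N.of_nat b)) (N.pow (N.of_nat c) (N.of_nat d)) ->
  (a ^ b < c ^ d)%N.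
Proof. by rewrite -!N_of_natX N_of_nat_ltP. Qed.

(** Binary integers make the large powers computable. *)
Definition ell_test p ell :=
  let d := N.of_nat (totient p.-1) in
  (~~ (ell %| p.-1)%N) && N.ltb (N.mul (N.pow 2 d) (N.pow (N.of_nat p) (N.of_nat ell.+1)))
                                 (N.pow (N.of_nat ell) d).

Lemma ell_testE p ell : ell_test p ell =
  (~~ (ell %| p.-1) && (2 ^ totient p.-1 * p ^ ell.+1 < ell ^ totient p.-1))%N.
Proof. by rewrite -N_of_nat_ltP N_of_natM !N_of_natX. Qed.

Lemma small_primes_test :
  all (fun p => if (p \in excR) || (p \in [:: 47; 53; 73; 79]%N) then true
                else has (ell_test p) [:: 5; 7; 11; 13]%N)
      [seq p <- iota 0 501 | prime p].
Proof. by vm_compute. Qed.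

Lemma large_test ell d : (81 <= d)%N -> ell \in [:: 5; 7; 11; 13]%N ->
  (2 ^ d * 20000 ^ ell.+1 < ell ^ d)%N.
Proof.
move=> d81 ell4; have base : (2 ^ 81 * 20000 ^ ell.+1 < ell ^ 81)%N.
  rewrite -N_of_nat_ltP N_of_natM !N_of_natX.
  rewrite (_ : N.of_nat 20000 = 20000%num); last by vm_compute.
  by move: ell4; rewrite !inE => /or4P[]/eqP->; vm_compute.
have ell2 : (2 <= ell)%N by move: ell4; rewrite !inE => /or4P[]/eqP->.
(* Increasing d multiplies the left side by 2 and the right side by ell >= 2, so the case d = 81
   suffices. *)
elim: d d81 => // d IHd; rewrite leq_eqVlt => /predU1P[<- //|].
rewrite ltnS => /IHd lt; rewrite ![(_ ^ d.+1)%N]expnS -mulnA.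
by apply: leq_ltn_trans (leq_mul ell2 (leqnn _)) _; rewrite ltn_pmul2l // (ltnW ell2).
Qed.

Theorem theorem1p1 (p : nat) :
  prime p -> (p < 20000)%N ->
  ((p \notin excR) && (p \notin excU) && (p \notin excX)
   \/ (GRH /\ (p \notin excR) && (p \notin excU))) ->
  ~ stably_rational_QCp p.
Proof.
move=> p_pr p20 hyp rat.
have {hyp} pR : p \notin excR by case: hyp => [/andP[/andP[]]|[_ /andP[]]].
have p43 : (43 < p)%N.
  have small : all (fun q => prime q ==> (q \in excR)) (iota 0 44) by vm_compute.
  rewrite ltnNge; apply: contra pR => p43.
  by have := allP small p; rewrite mem_iota ltnS p43 p_pr => /(_ isT).
have p3 : (3 < p)%N by apply: leq_trans p43.
have [ell_le quartic quadratic] := stably_rational_bounds p_pr p3 rat.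
have ell_kill ell : ell \in [:: 5; 7; 11; 13]%N -> ~~ (ell %| p.-1)%N ->
    ~~ (2 ^ totient p.-1 * p ^ ell.+1 < ell ^ totient p.-1)%N.
  move=> ell4 elln; rewrite -leqNgt.
  have [ell_pr ell14 ell1] : [/\ prime ell, ell < 14 & 1 < ell]%N.
    by move: ell4; rewrite !inE => /or4P[]/eqP->.
  apply: ell_le; rewrite ?prime_coprime // !modn_small ?gtn_eqF //; clear -p43 ell14 ell1; lia.
have [p500|p500] := ltnP p 501.
  have := allP small_primes_test p; rewrite mem_filter mem_iota p500 p_pr (negPf pR).
  move/(_ isT); case: ifPn => [Dp _|_]; last first.
    by case/hasP=> ell /ell_kill kill; rewrite ell_testE => /andP[/kill/negP].
  move: Dp; rewrite /= !inE => /or4P[]/eqP Dp; rewrite {}Dp in quartic quadratic.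
  (* For p = 47 the list H is the group of squares modulo 46, with fixed field Q(sqrt(-23)); 14^2
     exceeds 188, and the last list consists of split primes. *)
  - have := quadratic [:: 1; 3; 9; 13; 25; 27; 29; 31; 35; 39; 41]%N 14%N
                      [:: 3; 13; 31; 41]%N.
    by case/(_ _ _ _ _)/negP; vm_compute.
  - by have := quartic 13%N erefl; apply/negP; rewrite -ltnNge; apply: ltn_exp_N; vm_compute.
  - by have := quartic 18%N erefl; apply/negP; rewrite -ltnNge; apply: ltn_exp_N; vm_compute.
  (* For p = 79 the fixed field is Q(sqrt(-39)), and 18^2 exceeds 316. *)
  - have := quadratic [:: 1; 5; 11; 25; 41; 43; 47; 49; 55; 59; 61; 71]%N 18%N
                      [:: 5; 11; 41; 43]%N.
    by case/(_ _ _ _ _)/negP; vm_compute.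
(* There are 95 primes below 500, at most 14 of which divide p - 1 < 2^15. *)
have d81 : (81 <= totient p.-1)%N.
  have := @totient_ge_primes [seq q <- iota 0 500 | prime q] p.-1 14.
  rewrite filter_uniq ?iota_uniq // filter_all (_ : size _ = 95%N); last by vm_compute.
  rewrite -[95%N]/(81 + 14)%N leq_add2r; apply=> //.
  - by apply/allP => q; rewrite mem_filter mem_iota => /and3P[_ _]; lia.
  - apply: leq_ltn_trans (leq_pred _) (ltn_trans p20 _).
    by rewrite -[20000%N]expn1; apply: ltn_exp_N; vm_compute.
  - by lia.
have [ell ell4 elln] : exists2 ell, ell \in [:: 5; 7; 11; 13]%N & ~~ (ell %| p.-1)%N.
  apply/hasP/negPn; rewrite -all_predC; apply/negP => /= /and5P[].
  rewrite !negbK => n5 n7 n11 n13 _.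
  (* The only candidates below 20000 are 5005 k + 1 with k = 1, 2, 3, namely 5006, 10011 and 15016,
     divisible by 2, 3 and 2. *)
  have : (5 * (7 * (11 * 13)) %| p.-1)%N by rewrite !Gauss_dvd ?n5 ?n7 ?n11.
  case/dvdnP=> k Dk; have lt_p : (p < 200 * 100)%N.
    by rewrite (_ : 200 * 100 = 20000)%N //; vm_compute.
  have np2 : ~~ (2 %| p)%N by rewrite dvdn_prime2 //; clear -p43; lia.
  have np3 : ~~ (3 %| p)%N by rewrite dvdn_prime2 //; clear -p43; lia.
  have k4 : (k < 4)%N by clear -Dk lt_p; lia.
  by clear -k4 Dk np2 np3 p43; lia.
case/negP: (ell_kill ell ell4 elln).
apply: leq_ltn_trans (large_test d81 ell4).
by rewrite leq_mul2l leq_exp2r // (ltnW p20) orbT.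
Qed.
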